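(* Let $n$ be an odd positive integer. The number of primitive square-tiled surfaces of type A with $n$ squares in the stratum $\mathcal{H}(2)$ is \[ a_n^{\mathrm{p}}=\frac{3}{16}(n-1)n^2\prod_{p\mid n}\Bigl(1-\frac{1}{p^2}\Bigr), \] and the number of primitive square-tiled surfaces of type B with $n$ squares in $\mathcal{H}(2)$ is \[ b_n^{\mathrm{p}}=\frac{3}{16}(n-3)n^2\prod_{p\mid n}\Bigl(1-\frac{1}{p^2}\Bigr) \] for $n\geq 3$, and $0$ for $n=1$. Here $\prod_{p\mid n}$ is a product over the prime divisors $p$ of $n$.
   Context: A square-tiled surface with $n$ squares is a connected surface obtained from $n$ unit squares by identifying, via translations, each top side with some bottom side and each right side with some left side; equivalently, a connected degree-$n$ cover of the torus $\mathbb{C}/(\mathbb{Z}+i\mathbb{Z})$ branched over a single point. Surfaces are counted up to isomorphism of translation surfaces (isomorphism of covers). Each vertex of the tiling has a cone angle $2\pi(k+1)$ with $k\geq 0$. The stratum $\mathcal{H}(2)$ consists of the surfaces of genus $2$ having exactly one cone point, of angle $6\pi$. The lattice of periods $\mathrm{Per}(S)\subset\mathbb{Z}^2$ of a square-tiled surface $S$ is the subgroup generated by the holonomy vectors of its saddle connections (straight segments joining cone points); $S$ is primitive if $\mathrm{Per}(S)=\mathbb{Z}^2$. For $S\in\mathcal{H}(2)$, the involution induced by $-\mathrm{Id}$ has six fixed points, the Weierstrass points; for a square-tiled surface these have coordinates in $\frac12\mathbb{Z}^2$ (vertices of the squares having integer coordinates). For odd $n$, a surface with $n$ squares in $\mathcal{H}(2)$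 is of type A if exactly one of its Weierstrass points has integer coordinates, and of type B if exactly three of them have integer coordinates; every such surface is of type A or B. (For odd $n\ge5$ the primitive surfaces of type A, resp. B, form one $\mathrm{SL}(2,\mathbb{Z})$-orbit, denoted $A_n$, resp. $B_n$.) *)

(* Defs.v *)
(* Square-tiled surfaces encoded by their monodromy:
   a surface with n squares labelled by 'I_n is a pair (h, v) of
   permutations: h s = square to the right of s, v s = square above s. *)
From HB Require Import structures.
From mathcomp Require Import all_boot all_order all_algebra all_fingroup.
From mathcomp Require Import boolp.
Set Implicit Arguments. Unset Strict Implicit. Unset Printing Implicit Defensive.
Import Order.TTheory GRing.Theory Num.Theory.

Section STS.
Variable n : nat.
Notation P := {perm 'I_n}.
Implicit Types (h v : P) (s : 'I_n).

Definition sts_connected h v : bool :=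
  [forall x, forall y, connect (fun a b => (b == h a) || (b == v a)) x y].

(* the vertex-turning permutation: the squares having a given vertex as
   bottom-left corner form one orbit of vcycle h v = [~ h, v]
   (vcycle h v s = v (h (v^-1 (h^-1 s)))); the cone angle of the vertex
   which is the bottom-left corner of s is 2*pi*#|porbit (vcycle h v) s|. *)
Definition vcycle h v : P := (h^-1 * v^-1 * h * v)%g.

Definition vangle h v (s : 'I_n) : nat := #|porbit (vcycle h v) s|.

(* stratum H(2): exactly one cone point, of angle 6 pi
   (genus 2 then follows from Gauss-Bonnet / Riemann-Hurwitz). *)
Definition inH2 h v : bool :=
  [forall x, (vangle h v x == 1) || (vangle h v x == 3)] &&
  (#|[set x | vangle h v x != 1]| == 3).

(* a ray leaving the vertex X = bottom-left corner of s in the primitive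
   direction (p,q) starts in the square having X at the corner opposite to
   the direction *)
Definition seg_start h v (p q : int) s : 'I_n :=
  let s1 := if (q < 0)%R then (v^-1)%g s else s in
  if (p < 0)%R then (h^-1)%g s1 else s1.

(* the unfolded segment from (0,0) to (a,b) (a,b>=0 coprime) crosses the
   unit squares of the plane; (i,j) is the current plane square.  It
   leaves through the right side iff b(i+1) < a(j+1). *)
Fixpoint seg_walk (hs vs : 'I_n -> 'I_n) (a b fuel i j : nat) (t : 'I_n)
  : 'I_n :=
  match fuel with
  | 0 => t
  | fuel'.+1 =>
      if b * i.+1 < a * j.+1 then seg_walk hs vs a b fuel' i.+1 j (hs t)
      else seg_walk hs vs a b fuel' i j.+1 (vs t)
  end.

(* one piece of a straight segment: from the vertex BL(s) in direction
   (p,q) to the first lattice point (p,q); the result is a square whose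
   bottom-left corner is the endpoint. *)
Definition seg_piece h v (p q : int) s : 'I_n :=
  let hs := fun x => if (0 < p)%R then h x else (h^-1)%g x in
  let vs := fun x => if (0 < q)%R then v x else (v^-1)%g x in
  let a := `|p|%N in let b := `|q|%N in
  let t := seg_walk hs vs a b (a + b - 2) 0 0 (seg_start h v p q s) in
  let u := if (0 < p)%R then h t else t in
  if (0 < q)%R then v u else u.

(* a saddle connection starting at the cone point BL(s), in the primitive
   direction (p,q), with holonomy k(p,q): all intermediate lattice points
   are regular points, the k-th one is a cone point. *)
Definition saddle_connection h v s (p q : int) (k : nat) : Prop :=
  vangle h v s != 1 /\ gcdn `|p| `|q| = 1%N /\ (0 < k)%N /\
  (forall i, (0 < i < k)%N -> vangle h v (iter i (seg_piece h v p q) s) = 1%N) /\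
  vangle h v (iter k (seg_piece h v p q) s) != 1.

Definition saddle_holonomy h v (z : int * int) : Prop :=
  exists s p q k, saddle_connection h v s p q k /\
    z = ((k%:Z * p)%R, (k%:Z * q)%R).

Inductive in_periods h v : int * int -> Prop :=
  | per_gen z : saddle_holonomy h v z -> in_periods h v z
  | per_zero : in_periods h v (0%R, 0%R)
  | per_add z w : in_periods h v z -> in_periods h v w ->
      in_periods h v ((z.1 + w.1)%R, (z.2 + w.2)%R)
  | per_opp z : in_periods h v z -> in_periods h v ((- z.1)%R, (- z.2)%R).

Definition primitive h v : Prop := forall z, in_periods h v z.

(* the involution induced by -Id: square s is sent (rotated by pi) to
   square sg s; it satisfies sg o h = h^-1 o sg and sg o v = v^-1 o sg. *)
Definition minus_id h v (sg : P) : bool :=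
  [forall x, (sg (h x) == (h^-1)%g (sg x)) && (sg (v x) == (v^-1)%g (sg x))
             && (sg (sg x) == x)].

(* -Id sends BL(s) to TR(sg s) = BL(v (h (sg s))); number of vertices
   (points with integer coordinates) fixed by it. *)
Definition n_int_weierstrass h v (sg : P) : nat :=
  #|[set porbit (vcycle h v) x
     | x in [set x | v (h (sg x)) \in porbit (vcycle h v) x]]|.

Definition typeA h v : bool :=
  [exists sg, minus_id h v sg && (n_int_weierstrass h v sg == 1)].
Definition typeB h v : bool :=
  [exists sg, minus_id h v sg && (n_int_weierstrass h v sg == 3)].

Definition sts_class (x : P * P) : {set P * P} :=
  (fun g : P => ((x.1 ^ g)%g, (x.2 ^ g)%g)) @: [set: P].

Definition n_classes (Q : P -> P -> bool) : nat :=
  #|[set sts_class x | x in [set x : P * P | Q x.1 x.2]]|.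

Definition n_prim_typeA : nat :=
  n_classes (fun h v => [&& sts_connected h v, inH2 h v,
                             `[< primitive h v >] & typeA h v]).
Definition n_prim_typeB : nat :=
  n_classes (fun h v => [&& sts_connected h v, inH2 h v,
                             `[< primitive h v >] & typeB h v]).

End STS.

Definition prime_factor_prod (n : nat) : rat :=
  (\prod_(p <- primes n) (1 - ((p%:R : rat) ^+ 2)^-1))%R.

(* Main.v *)
Require Import Defs.
From mathcomp Require Import all_boot all_order all_algebra all_fingroup.
From mathcomp Require Import boolp.
From mathcomp Require Import zify ring lra.
Set Implicit Arguments. Unset Strict Implicit. Unset Printing Implicit Defensive.
Import Order.TTheory GRing.Theory Num.Theory.

(* A surface in H(2) is cut along its horizontal saddle connections into one or two
   cylinders.  Two cylinders are described by their circumferences w1 < w2, heights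
   h1, h2 and twists t1, t2, with w1 h1 + w2 h2 = n; one cylinder is described by the
   lengths of the three saddle connections on its boundary, its height and its twist,
   each surface having three such descriptions, one for each cone square.  In these
   parameters -Id is explicit, so that the type depends on parities only, and being
   primitive is a coprimality condition, because the periods are spanned by the
   (w_i, 0) and (t_i, h_i).

   Let P(m) be the number of primitive parameters with m squares.  Sorting all the
   parameters by lattice of periods gives
     sum_(m | n) sigma_1(n / m) P(m) = number of all parameters with n squares.
   For two cylinders the right-hand side is a sum of products w1 w2 over the solutions
   of w1 h1 + w2 h2 = n with prescribed parities; for n odd, Liouville's substitution
   (a, b, x, y) -> (a, a + b, x - y, y) evaluates it in terms of sigma_3, sigma_2 and
   sigma_1.  The relation determines P, and the formula is then verified with the help
   of sum_(d | n) J_2(d) = n^2, where J_2(n) = n^2 prod_(p | n) (1 - 1/p^2). *)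

(** * Cone squares *)

(** Write c for [vcycle h v]. The cycles of [h] through the three cone squares are the bottoms of
    the cylinders, and the cycles of z -> c (h z) through them are the tops. Comparing the lengths
    of these two kinds of cycles leaves only the two patterns of gluing.

    That the coprimality conditions are necessary is shown without following paths. A function on
    the squares with values in Z/m that grows by constants along [h] and [v] takes the same value on
    the three cone squares, so its pair of constants annihilates every period modulo m; a primitive
    surface has no such function except the locally constant ones.

    Liouville's substitution helps because 4ab = (a+b)^2 - (a-b)^2. It turns sums of (a+b)^2 over y
    < x, and sums of (a-b)^2 over a < b, into sums of the square of a single variable under the
    other of these conditions. In the difference only the diagonals x = y and a = b survive, and
    these are divisor sums. *)

Definition cone n (h v : {perm 'I_n}) (x : 'I_n) := vcycle h v x != x.

Lemma vcycleE n (h v : {perm 'I_n}) x : vcycle h v (h (v x)) = v (h x).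
Proof. by rewrite /vcycle !permM !permK. Qed.

Lemma vangle_eq1 n (h v : {perm 'I_n}) x : (vangle h v x == 1) = ~~ cone h v x.
Proof.
rewrite /vangle /cone negbK; apply/idP/eqP => [/cards1P[y Ey]|cx].
  have := porbit_id (vcycle h v) x; rewrite Ey inE => /eqP xy.
  by have := mem_porbit (vcycle h v) 1 x; rewrite expg1 Ey inE -xy => /eqP.
apply/cards1P; exists x; apply/setP=> y; rewrite inE.
apply/porbitP/eqP => [[i ->]|->]; last by exists 0; rewrite expg0 perm1.
by rewrite permX; elim: i => //= i ->.
Qed.

(** By [vcycleE] the commutator carries [h (v x)] to [v (h x)]; if it fixes the latter, injectivity
    makes the two equal. *)
Lemma commute_regular n (h v : {perm 'I_n}) x :
  ~~ cone h v (v (h x)) -> v (h x) = h (v x).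
Proof.
by rewrite /cone negbK -(vcycleE h v x) (inj_eq perm_inj) vcycleE => /eqP.
Qed.

Lemma cone_vcycle n (h v : {perm 'I_n}) x :
  cone h v (vcycle h v x) = cone h v x.
Proof. by rewrite /cone (inj_eq perm_inj). Qed.

(** Three squares moved by a permutation of order dividing 3 form a single cycle, so counting the
    moved squares already says that there is one vertex of angle 6 pi. *)
Lemma inH2P n (h v : {perm 'I_n}) :
  reflect ((forall x, vcycle h v (vcycle h v (vcycle h v x)) = x) /\
           #|[set x | cone h v x]| = 3) (inH2 h v).
Proof.
set c := vcycle h v.
have -> : [set x | cone h v x] = [set x | vangle h v x != 1].
  by apply/setP=> x; rewrite !inE vangle_eq1 negbK.
have per x : #|porbit c x| = 3 -> c (c (c x)) = x.
  by move=> E; have := iter_porbit c x; rewrite E.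
apply: (iffP andP) => [[/forallP H /eqP ->]|[H ->]]; split=> //.
  move=> x; have /orP[|/eqP/per//] := H x.
  by rewrite vangle_eq1 negbK -/c => /eqP; rewrite -/c => E; rewrite !E.
apply/forallP=> x; have [//|] := boolP (vangle h v x == 1).
rewrite vangle_eq1 negbK /cone -/c => cx /=.
rewrite /vangle -/c.
suff -> : porbit c x = [set x; c x; c (c x)].
  rewrite -setUA !cardsU1 !inE cards1 negb_or ![x == _]eq_sym cx.
  have -> : c (c x) != x.
    by apply: contra cx => /eqP E; rewrite -{2}(H x) -/c E.
  by rewrite [c x == _]eq_sym (inj_eq perm_inj) cx.
apply/setP=> y; rewrite !inE; apply/porbitP/idP=> [[i ->]|].
  rewrite permX; elim: i => [|i]; first by rewrite /= eqxx.
  rewrite iterS => /orP[/orP[]|] /eqP ->; rewrite ?eqxx ?orbT //.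
  by rewrite H eqxx.
case/orP=> [/orP[]|] /eqP ->.
- by exists 0; rewrite expg0 perm1.
- by exists 1; rewrite expg1.
by exists 2; rewrite permX.
Qed.

Lemma connP n (h v : {perm 'I_n}) :
  reflect (forall P : pred 'I_n, (forall x, P x -> P (h x)) ->
             (forall x, P x -> P (v x)) -> forall x y, P x -> P y)
          (sts_connected h v).
Proof.
apply: (iffP forallP) => [H P Ph Pv x y Px|H x].
  have /forallP/(_ y)/connectP[p + ->] := H x.
  elim: p x Px => //= a p IH x Px /andP[/orP[]/eqP -> Hp];
    by apply: IH Hp; auto.
apply/forallP=> y.
apply: (H (connect (fun a b => (b == h a) || (b == v a)) x)) (connect0 _ _);
  move=> z /connect_trans; apply; apply: connect1; rewrite eqxx ?orbT //.
Qed.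

(** * Iterates of a permutation of a finite set *)

Section PermIter.
Variables (T : finType) (s : {perm T}).

Lemma perm_period x : exists2 m, 0 < m & iter m s x = x.
Proof.
exists #|porbit s x|; last exact: iter_porbit.
by apply/card_gt0P; exists x; exact: porbit_id.
Qed.

Lemma iter_inj m : injective (iter m s).
Proof. by elim: m => [//|m IH] x y /perm_inj/IH. Qed.

Lemma iter_fix m k x : iter m s x = x -> iter (k * m) s x = x.
Proof. by move=> E; elim: k => // k IH; rewrite mulSn iterD IH. Qed.

Lemma iter_mod m k x : iter m s x = x -> iter (k %% m) s x = iter k s x.
Proof. by move=> E; rewrite {2}(divn_eq k m) addnC iterD iter_fix. Qed.

Lemma iter_back k x : exists m, iter m s (iter k s x) = x.
Proof.
have [p p0 E] := perm_period x; exists (k * p - k).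
by rewrite -iterD subnK ?iter_fix // leq_pmulr.
Qed.

Lemma closed_back (P : pred T) x : (forall x, P x -> P (s x)) -> P (s x) -> P x.
Proof.
move=> H; have [[//|m] _ E] := perm_period x.
move: E; rewrite iterSr => E Px; rewrite -E; elim: (m) => //= k IH; exact: H.
Qed.

End PermIter.

(** * Charts *)

(* A stack of unit squares over the points 0, ..., bW - 1: the tower over x has
   height bH x, its squares are joined to those of the tower over br x on their
   right, and its top is glued to the bottom of the tower over bG x. *)
Record base := Base {bW : nat; bH : nat -> nat; br : nat -> nat; bG : nat -> nat}.

Record base_ok (B : base) : Prop := BaseOk {
  br_lt : forall x, x < bW B -> br B x < bW B;
  bG_lt : forall x, x < bW B -> bG B x < bW B;
  br_inj : forall x y, x < bW B -> y < bW B -> br B x = br B y -> x = y;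
  bG_inj : forall x y, x < bW B -> y < bW B -> bG B x = bG B y -> x = y;
  bH_gt0 : forall x, x < bW B -> 0 < bH B x;
  bH_br : forall x, x < bW B -> bH B (br B x) = bH B x }.

Definition cell (B : base) : pred (nat * nat) :=
  [pred p | (p.1 < bW B) && (p.2 < bH B p.1)].
Definition hN (B : base) (p : nat * nat) := (br B p.1, p.2).
Definition vN (B : base) (p : nat * nat) :=
  if p.2.+1 < bH B p.1 then (p.1, p.2.+1) else (bG B p.1, 0).
Definition cells (B : base) : seq (nat * nat) :=
  [seq (x, y) | x <- iota 0 (bW B), y <- iota 0 (bH B x)].

Record chart (B : base) n (h v : {perm 'I_n}) (psi : nat * nat -> 'I_n) : Prop :=
  Chart {
    ch_inj : {in cell B &, injective psi};
    ch_surj : forall i, exists2 p, p \in cell B & psi p = i;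
    ch_h : forall p, p \in cell B -> h (psi p) = psi (hN B p);
    ch_v : forall p, p \in cell B -> v (psi p) = psi (vN B p) }.

Lemma mem_cells B : cells B =i cell B.
Proof.
move=> p; apply/allpairsPdep/andP => [[x [y []]]|[p1 p2]].
  by rewrite !mem_iota /= => xW yH ->.
by exists p.1, p.2; rewrite !mem_iota /=; split => //; case: p {p1 p2}.
Qed.

Lemma cells_uniq B : uniq (cells B).
Proof.
apply: allpairs_uniq_dep; rewrite ?iota_uniq //.
  by move=> x _; rewrite iota_uniq.
by move=> [x y] [x' y'] _ _ [-> ->].
Qed.

Lemma size_cells B : size (cells B) = \sum_(0 <= x < bW B) bH B x.
Proof.
rewrite size_allpairs_dep sumnE big_map /index_iota subn0.
by apply: eq_bigr => x _; rewrite size_iota.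
Qed.

Section BaseOk.
Variables (B : base) (okB : base_ok B).

Lemma hN_cell p : p \in cell B -> hN B p \in cell B.
Proof. by case/andP=> *; rewrite !inE /= br_lt ?bH_br. Qed.

Lemma vN_cell p : p \in cell B -> vN B p \in cell B.
Proof.
case/andP=> p1 p2; rewrite /vN; case: ifP => H; rewrite !inE /=.
  by rewrite p1 H.
by rewrite bG_lt ?bH_gt0 // bG_lt.
Qed.

Lemma hN_inj : {in cell B &, injective (hN B)}.
Proof.
by move=> [x y] [x' y'] /andP[/= ? ?] /andP[/= ? ?] [/br_inj E ->]; rewrite E.
Qed.

Lemma vN_inj : {in cell B &, injective (vN B)}.
Proof.
move=> [x y] [x' y'] /andP[/= X Y] /andP[/= X' Y']; rewrite /vN /=.
case: ltnP => A; case: ltnP => A' // [].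
  by move=> -> ->.
move=> /bG_inj E; rewrite E //; rewrite E // in A Y; congr pair; lia.
Qed.

Lemma chart_exists n : 0 < n -> size (cells B) = n ->
  exists h v : {perm 'I_n}, exists psi, chart B h v psi.
Proof.
case: n => // n _ sz.
pose psi p : 'I_n.+1 := inord (index p (cells B)).
pose phi (i : 'I_n.+1) := nth (0, 0) (cells B) i.
have phiK : cancel phi psi.
  by move=> i; apply/val_inj; rewrite /= inordK ?index_uniq ?cells_uniq ?sz //.
have psiK p : p \in cell B -> phi (psi p) = p.
  move=> Hp; rewrite /phi inordK ?nth_index ?mem_cells //.
  by rewrite -sz index_mem mem_cells.
have phi_cell i : phi i \in cell B.
  by rewrite -mem_cells mem_nth // sz.
have hinj : injective (fun i => psi (hN B (phi i))).
  move=> i j /(congr1 phi); rewrite !psiK ?hN_cell // => /hN_inj E.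
  by rewrite -(phiK i) E ?phiK.
have vinj : injective (fun i => psi (vN B (phi i))).
  move=> i j /(congr1 phi); rewrite !psiK ?vN_cell // => /vN_inj E.
  by rewrite -(phiK i) E ?phiK.
exists (perm hinj), (perm vinj), psi; split.
- by move=> p q Hp Hq /(congr1 phi); rewrite !psiK.
- by move=> i; exists (phi i).
- by move=> p Hp; rewrite permE psiK.
- by move=> p Hp; rewrite permE psiK.
Qed.

Variables (n : nat) (h v : {perm 'I_n}) (psi : nat * nat -> 'I_n).
Hypothesis ch : chart B h v psi.

Lemma chart_coordinates : exists phi : 'I_n -> nat * nat,
  [/\ forall i, phi i \in cell B, cancel phi psi &
      forall p, p \in cell B -> phi (psi p) = p].
Proof.
have /choice[phi phiP] : forall i, exists p, p \in cell B /\ psi p = i.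
  by move=> i; have [p] := ch_surj ch i; exists p.
have phi_cell i : phi i \in cell B by have [] := phiP i.
have phiK i : psi (phi i) = i by have [] := phiP i.
exists phi; split=> // p Hp.
by apply: (ch_inj ch); rewrite ?phiK.
Qed.

Lemma chart_size : size (cells B) = n.
Proof.
have U : uniq (map psi (cells B)).
  by rewrite map_inj_in_uniq ?cells_uniq // => p q; rewrite !mem_cells; exact: (ch_inj ch).
rewrite -(size_map psi) -[RHS](card_ord n) -(card_uniqP U).
apply: eq_card => i; rewrite inE; have [p Hp <-] := ch_surj ch i.
by rewrite map_f // mem_cells.
Qed.

Lemma chart_card (P : pred 'I_n) :
  #|[set i | P i]| = count (fun p => P (psi p)) (cells B).
Proof.
have U : uniq (map psi (cells B)).
  by rewrite map_inj_in_uniq ?cells_uniq // => p q; rewrite !mem_cells; exact: (ch_inj ch).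
rewrite -(count_map psi P) -size_filter -(card_uniqP (filter_uniq P U)).
apply: eq_card => i; rewrite mem_filter inE.
have [p Hp <-] := ch_surj ch i.
by rewrite map_f ?andbT // mem_cells.
Qed.

Lemma chart_base x y : x < bW B -> y < bH B x -> psi (x, y) = iter y v (psi (x, 0)).
Proof.
move=> xW; elim: y => //= y IH yH; rewrite -IH; last lia.
by rewrite (ch_v ch) /vN ?inE /= ?yH // xW /=; lia.
Qed.

Lemma chart_roof x : x < bW B -> iter (bH B x) v (psi (x, 0)) = psi (bG B x, 0).
Proof.
move=> xW; have H0 := bH_gt0 okB xW; case E: (bH B x) H0 => [//|k] _ /=.
rewrite -chart_base ?E ?leqnn // (ch_v ch); last by rewrite inE /= xW E leqnn.
by rewrite /vN /= E ltnn.
Qed.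

Lemma chart_row x y k : x < bW B -> y < bH B x ->
  psi (iter k (br B) x, y) = iter k h (psi (x, y)).
Proof.
move=> xW yH; have aux k' : iter k' (br B) x < bW B /\ bH B (iter k' (br B) x) = bH B x.
  by elim: k' => //= k' [A1 A2]; rewrite br_lt ?bH_br.
elim: k => //= k <-; have [A1 A2] := aux k.
by rewrite (ch_h ch) // !inE /= A1 A2.
Qed.

(** The two squares are reached from the topmost square of the tower over x by up-then-right and by
    right-then-up. So a cone point can only sit where [br] and [bG] fail to commute. *)
Lemma chart_vcycle x : x < bW B ->
  vcycle h v (psi (br B (bG B x), 0)) = psi (bG B (br B x), 0).
Proof.
move=> xW; have H0 := bH_gt0 okB xW.
have rx := br_lt okB xW; have Hr := bH_br okB xW.
have [C1 C2] : (x, (bH B x).-1) \in cell B /\ (br B x, (bH B x).-1) \in cell B.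
  by rewrite !inE /= xW rx Hr; split; lia.
have := vcycleE h v (psi (x, (bH B x).-1)).
rewrite (ch_v ch) // (ch_h ch C1) (ch_v ch) /vN /hN //= Hr prednK // ltnn (ch_h ch) //.
by rewrite !inE /= bG_lt // bH_gt0 // bG_lt.
Qed.

Lemma chart_regular x y : x < bW B -> 0 < y -> y < bH B x -> ~~ cone h v (psi (x, y)).
Proof.
move=> xW; case: y => // y _ yH; rewrite /cone negbK.
(* An injective self-map of the finite set of columns is onto, so x has a left neighbour. *)
have [x' xW' E] : exists2 x', x' < bW B & br B x' = x.
  pose f (i : 'I_(bW B)) := Ordinal (br_lt okB (ltn_ord i)).
  have finj : injective f.
    by move=> i j [] /(br_inj okB (ltn_ord i) (ltn_ord j)) /val_inj.
  have [g _ gK] := injF_bij finj.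
  by exists (g (Ordinal xW)) => //; have := congr1 val (gK (Ordinal xW)).
have Hr := bH_br okB xW'; rewrite E in Hr.
have C1 : (x', y) \in cell B by rewrite !inE /= xW'; lia.
have C2 : (x, y) \in cell B by rewrite !inE /= xW; lia.
have := vcycleE h v (psi (x', y)).
rewrite (ch_v ch C1) (ch_h ch C1) /vN /hN /= -Hr yH E (ch_v ch C2) (ch_h ch) /vN /hN /= ?yH ?E.
  by move=> ->.
by rewrite !inE /= xW' -Hr.
Qed.

End BaseOk.

(** The towers cannot overlap: if two of them met at different heights, going down and then along
    the row to a cone square would produce a cone square strictly inside one of them. They exhaust
    the surface because their union is stable under [h] and [v]. *)
Lemma chart_of_rows B n (h v : {perm 'I_n}) (beta : nat -> 'I_n) :
  base_ok B -> sts_connected h v -> 0 < bW B ->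
  (forall x, x < bW B -> h (beta x) = beta (br B x)) ->
  (forall x y, x < bW B -> 0 < y < bH B x -> ~~ cone h v (iter y v (beta x))) ->
  (forall x, x < bW B -> iter (bH B x) v (beta x) = beta (bG B x)) ->
  (forall x y, x < bW B -> y < bW B -> beta x = beta y -> x = y) ->
  (forall x, x < bW B -> exists j, cone h v (iter j h (beta x))) ->
  chart B h v (fun p => iter p.2 v (beta p.1)).
Proof.
move=> okB conn W0 Hh Hreg Htop Hinj Hcone.
have iter_lt x k : x < bW B -> iter k (br B) x < bW B /\ bH B (iter k (br B) x) = bH B x.
  by move=> xW; elim: k => //= k [A1 A2]; rewrite br_lt ?bH_br.
have comm x y : x < bW B -> y < bH B x -> h (iter y v (beta x)) = iter y v (beta (br B x)).
  move=> xW; elim: y => [|y IH] yH /=; first exact: Hh.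
  rewrite -IH; last lia.
  symmetry; apply: commute_regular; rewrite IH; last lia.
  by rewrite -iterS Hreg ?br_lt ?bH_br.
have commk x y k : x < bW B -> y < bH B x ->
    iter k h (iter y v (beta x)) = iter y v (beta (iter k (br B) x)).
  move=> xW yH; elim: k => //= k ->; have [A1 A2] := iter_lt x k xW.
  by rewrite comm ?A2.
have disj x y x' y' : x < bW B -> y < bH B x -> x' < bW B -> y' < bH B x' -> y <= y' ->
    iter y v (beta x) = iter y' v (beta x') -> (x, y) = (x', y').
  move=> xW yH xW' yH' yy; rewrite -(subnKC yy) iterD => /iter_inj.
  case: (posnP (y' - y)) => [->|k0] E; first by rewrite addn0; congr pair; exact: Hinj.
  have [j] := Hcone x xW; rewrite E commk //; last lia.
  have [A1 A2] := iter_lt x' j xW'.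
  by rewrite (negPf (Hreg _ _ A1 _)) // A2; lia.
split=> /=.
- move=> [x y] [x' y'] /andP[/= X Y] /andP[/= X' Y'] E.
  case/orP: (leq_total y y') => yy; first exact: (disj _ _ _ _ X Y X' Y').
  by symmetry; apply: (disj _ _ _ _ X' Y' X Y).
- move=> i; pose P i := i \in [seq iter p.2 v (beta p.1) | p <- cells B].
  suff /mapP[p Hp ->] : P i by exists p; rewrite -?mem_cells.
  have P0 : P (beta 0) by apply/mapP; exists (0, 0); rewrite // mem_cells !inE /= W0 bH_gt0.
  apply: (connP h v conn P _ _ _ _ P0) => _ /mapP[p + ->]; rewrite mem_cells => Hp; apply/mapP.
    exists (hN B p); first by rewrite mem_cells hN_cell.
    by case/andP: Hp => *; rewrite comm.
  exists (vN B p); first by rewrite mem_cells vN_cell.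
  case/andP: Hp => A1 A2; rewrite /vN; case: ltnP => //= A.
  have E : bH B p.1 = p.2.+1 by apply/eqP; rewrite eqn_leq A.
  by rewrite -Htop // E.
- by move=> [x y] /andP[/= X Y]; exact: comm.
move=> [x y] /andP[/= X Y]; rewrite /vN /=; case: ltnP => //= A.
have E : bH B x = y.+1 by apply/eqP; rewrite eqn_leq A.
by rewrite -Htop // E.
Qed.

(** * Cylinder decomposition *)

Definition rot2 w1 w2 x :=
  if x.+1 == w1 then 0 else if x.+1 == w1 + w2 then w1 else x.+1.
(** Top coordinate of the column over x: the twist is subtracted cyclically within each of the two
    rows. *)
Definition shift2 w1 w2 t1 t2 x :=
  if x < w1 then (if x < t1 then x + w1 - t1 else x - t1)
  else (if x < w1 + t2 then x + w2 - t2 else x - t2).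
(** The horizontal saddle connections have lengths w1, w1 and w2 - w1. The top of the first cylinder
    is glued to the start of the bottom of the second, the start of the top of the second to the
    bottom of the first, and the remaining interval to the one with the same coordinates. *)
Definition swap2 w1 x :=
  if x < w1 then x + w1 else if x < w1 + w1 then x - w1 else x.

(* Two cylinders of circumferences w1 < w2, heights h1, h2 and twists t1, t2;
   the bottom of the first is [0, w1), that of the second [w1, w1 + w2). *)
Definition base2 w1 w2 h1 h2 t1 t2 := Base (w1 + w2)
  (fun x => if x < w1 then h1 else h2) (rot2 w1 w2)
  (fun x => swap2 w1 (shift2 w1 w2 t1 t2 x)).
Definition valid2 w1 w2 h1 h2 t1 t2 :=
  [&& 0 < w1, w1 < w2, 0 < h1, 0 < h2, t1 < w1 & t2 < w2].

Definition rot1 w x := if x.+1 == w then 0 else x.+1.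
Definition shift1 w t x := if x < t then x + w - t else x - t.
Definition flip3 l1 l2 l3 x :=
  if x < l1 then x + l2 + l3 else if x < l1 + l2 then x + l3 - l1
  else x - l1 - l2.

(* One cylinder of height H and twist t, on whose top and bottom the saddle
   connections of lengths l1, l2, l3 appear in opposite orders. *)
Definition base1 l1 l2 l3 H t := Base (l1 + l2 + l3) (fun=> H)
  (rot1 (l1 + l2 + l3)) (fun x => flip3 l1 l2 l3 (shift1 (l1 + l2 + l3) t x)).
Definition valid1 l1 l2 l3 H t :=
  [&& 0 < l1, 0 < l2, 0 < l3, 0 < H & t < l1 + l2 + l3].

Ltac split_ifs := repeat match goal with
  |- context [if ?b then _ else _] =>
    lazymatch b with context [if _ then _ else _] => fail | _ => case: (boolP b) => ? end
  end.
Ltac base_lia :=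
  rewrite /= /rot2 /swap2 /shift2 /rot1 /flip3 /shift1; split_ifs; lia.

Lemma base2_ok w1 w2 h1 h2 t1 t2 :
  valid2 w1 w2 h1 h2 t1 t2 -> base_ok (base2 w1 w2 h1 h2 t1 t2).
Proof. by case/and5P=> ? ? ? ? /andP[? ?]; split=> [x|x|x y|x y|x|x]; base_lia. Qed.

Lemma base1_ok l1 l2 l3 H t :
  valid1 l1 l2 l3 H t -> base_ok (base1 l1 l2 l3 H t).
Proof. by case/and5P=> ? ? ? ? ?; split=> [x|x|x y|x y|x|x]; base_lia. Qed.

Lemma least_nat (P : pred nat) : (exists k, P k) ->
  exists2 k, P k & forall j, j < k -> ~~ P j.
Proof.
move=> exP; case: (ex_minnP exP) => k Pk min; exists k => // j jk.
by apply/negP=> /min; rewrite leqNgt jk.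
Qed.

Section Height.
Variables (n : nat) (h v : {perm 'I_n}).
Local Notation c := (vcycle h v).
Local Notation cone := (cone h v).
Implicit Types (x : 'I_n) (k : nat).

(** The columns climb separately, [iter H v] after [iter k h], because the row may break up at
    height H, where [h] and [v] no longer commute; below H the order is immaterial by
    [height_comm]. *)
Definition is_height x H := [/\ 0 < H, exists k, cone (iter H v (iter k h x)) &
  forall y k, 0 < y < H -> ~~ cone (iter y v (iter k h x))].

Lemma height_exists x : cone x -> exists H, is_height x H.
Proof.
move=> Cx; pose P y := (0 < y) && `[<exists k, cone (iter y v (iter k h x))>].
have /least_nat[H /andP[H0 /asboolP HC] Hmin] : exists y, P y.
  have [m m0 E] := perm_period v x; exists m; rewrite /P m0 /=; apply/asboolP.
  by exists 0; rewrite /= E.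
exists H; split=> // y k /andP[y0 /Hmin]; rewrite /P y0 /= => /asboolPn N.
by apply/negP => C; apply: N; exists k.
Qed.

Variables (x : 'I_n) (H : nat) (hgt : is_height x H).

Lemma height_comm y k : y < H ->
  h (iter y v (iter k h x)) = iter y v (iter k.+1 h x).
Proof.
case: hgt => _ _ reg; elim: y => // y IH yH; rewrite [in RHS]iterS -IH; last lia.
symmetry; apply: commute_regular; rewrite IH; last lia.
by rewrite -iterS reg.
Qed.

Lemma height_comm_iter y j k : y < H ->
  iter j h (iter y v (iter k h x)) = iter y v (iter (j + k) h x).
Proof. by move=> yH; elim: j => //= j ->; rewrite height_comm. Qed.

(** Just below the top, right-then-up is up-then-right corrected by the commutator. Hence z -> c (h
    z) runs along the top of the cylinder as [h] runs along its bottom. *)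
Lemma height_top k :
  iter H v (iter k.+1 h x) = c (h (iter H v (iter k h x))).
Proof.
case: hgt => H0 _ _; case: H H0 (@height_comm) => // H' _ comm.
by rewrite [in LHS]iterS -comm // -vcycleE.
Qed.

Lemma height_top_iter j k :
  iter H v (iter (j + k) h x) = iter j (fun z => c (h z)) (iter H v (iter k h x)).
Proof. by elim: j => // j IH; rewrite addSn height_top IH. Qed.

End Height.

(** Descend from the common square: the lower cylinder reaches its bottom row, hence a cone square,
    at a height where a strictly higher one would have none. *)
Lemma height_disjoint n (h v : {perm 'I_n}) x x' H H' k k' :
  cone h v x -> cone h v x' -> is_height h v x H -> is_height h v x' H' ->
  iter H v (iter k h x) = iter H' v (iter k' h x') -> exists j, iter j h x = x'.
Proof.
have aux y y' G G' m m' : cone h v y -> is_height h v y G -> is_height h v y' G' ->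
  G <= G' -> iter G v (iter m h y) = iter G' v (iter m' h y') -> iter m h y = iter m' h y'.
  move=> Cy hgt hgt' le; rewrite -(subnKC le) iterD => /iter_inj.
  case: (posnP (G' - G)) => [-> //|k0] E.
  have [j Ej] := iter_back h m y.
  case: hgt => G0 _ _; case: (hgt') => _ _ /(_ (G' - G) (j + m')).
  rewrite -(height_comm_iter hgt'); last lia.
  by rewrite -E Ej Cy => F; have // : ~~ true by apply: F; lia.
move=> Cx Cx' hx hx' E; have E' : iter k h x = iter k' h x'.
  case/orP: (leq_total H H') => le; first exact: aux E.
  by symmetry; apply: aux (esym E).
by have [j Ej] := iter_back h k' x'; exists (j + k); rewrite iterD E'.
Qed.

(** The commutator is trivial away from the cone squares, so [h] and z -> c (h z) agree up to the
    next cone square, which the latter replaces by its image under c. *)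
Lemma vcycle_h_run n (h v : {perm 'I_n}) x l :
  (forall j, 0 < j < l -> ~~ cone h v (iter j h x)) ->
  (forall j, j < l -> iter j (fun z => vcycle h v (h z)) x = iter j h x) /\
  (0 < l -> iter l (fun z => vcycle h v (h z)) x = vcycle h v (iter l h x)).
Proof.
move=> reg; have A j : j < l -> iter j (fun z => vcycle h v (h z)) x = iter j h x.
  elim: j => //= j IH jl; rewrite IH; last lia.
  by have := reg j.+1 jl; rewrite /cone negbK => /eqP.
by split=> //; case: l reg A => // l reg A _; rewrite !iterS A.
Qed.

Lemma cone_cycle n (h v : {perm 'I_n}) a : inH2 h v -> cone h v a ->
  let b := vcycle h v a in let d := vcycle h v b in
  [/\ [/\ a <> b, a <> d & b <> d], [/\ cone h v b, cone h v d & vcycle h v d = a] &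
      forall x, cone h v x -> [\/ x = a, x = b | x = d]].
Proof.
move=> /inH2P[c3 card3] Ca b d; set c := vcycle h v in c3 b d *.
have Cb : cone h v b by rewrite cone_vcycle.
have Cd : cone h v d by rewrite cone_vcycle.
have ab : b != a := Ca.
have bd : d != b by rewrite /d (inj_eq perm_inj).
have ad : a != d by rewrite -(c3 a) -/b -/d (inj_eq perm_inj).
split; [by split; apply/eqP; rewrite // eq_sym| by split => //; exact: c3|].
have : [set x | cone h v x] = [set a; b; d].
  apply/esym/eqP; rewrite eqEcard card3; apply/andP; split.
    by apply/subsetP=> x; rewrite !inE => /orP[/orP[]|] /eqP ->.
  by rewrite -setUA !cardsU1 !inE cards1 negb_or ![a == _]eq_sym ab eq_sym ad [b == _]eq_sym bd.
move=> /setP E x Cx; have := E x; rewrite !inE Cx => /esym/orP[/orP[]|] /eqP ->;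
  by [constructor 1|constructor 2|constructor 3].
Qed.

Lemma order_exists (T : finType) (s : {perm T}) x :
  exists w, [/\ 0 < w, iter w s x = x & forall j, 0 < j < w -> iter j s x <> x].
Proof.
have /least_nat[w /andP[w0 /eqP Ew] wmin] : exists w, (0 < w) && (iter w s x == x).
  by have [m m0 E] := perm_period s x; exists m; rewrite m0 E eqxx.
exists w; split=> // j /andP[j0 /wmin]; rewrite j0 /= => /eqP; done.
Qed.

(* lia is slowed down by the hypotheses about cone points, which it cannot use. *)
Ltac cone_lia := repeat match goal with
  | H : is_true (cone _ _ _) |- _ => clear H
  | H : is_true (inH2 _ _) |- _ => clear H
  | H : is_true (sts_connected _ _) |- _ => clear H
  | H : is_true (valid2 _ _ _ _ _ _) |- _ => clear H
  | H : is_height _ _ _ _ |- _ => clear H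
  end; lia.

(** Here a is alone in its row while b and d share another one. The cycles of [f] force the pattern
    of [base2], with a and d at the starts of the two bottoms. *)
Lemma classify2 n (h v : {perm 'I_n}) a : sts_connected h v -> inH2 h v ->
  cone h v a ->
  let b := vcycle h v a in let d := vcycle h v b in
  (forall k, iter k h a <> b) -> (forall k, iter k h a <> d) ->
  (exists k, iter k h d = b) ->
  exists w1 w2 h1 h2 t1 t2, valid2 w1 w2 h1 h2 t1 t2 /\
    exists psi, chart (base2 w1 w2 h1 h2 t1 t2) h v psi.
Proof.
move=> conn H2 Ca b d nab nad [p0' Ep0'].
have [[a_b a_d b_d] [Cb Cd cda] Kx] := cone_cycle H2 Ca; rewrite -/b -/d in Kx a_b a_d b_d Cb Cd cda.
have cab : vcycle h v a = b by []. have cbd : vcycle h v b = d by [].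
have [w1 [w10 Ew1 w1min]] := order_exists h a.
have [w2 [w20 Ew2 w2min]] := order_exists h d.
have /least_nat[p /eqP Ep pmin] : exists k, iter k h d == b by exists p0'; rewrite Ep0'.
have p0 : 0 < p by rewrite lt0n; apply/eqP=> E; rewrite E /= in Ep; apply: b_d.
have pw2 : p < w2.
  rewrite ltnNge; apply/negP => le; have := pmin (p %% w2).
  by rewrite iter_mod // Ep eqxx (leq_trans _ le) ?ltn_mod // => /(_ isT).
have nda k : iter k h d <> a.
  by move=> E; have [m Em] := iter_back h k d; apply: (nad m); rewrite -E.
have ra j : 0 < j < w1 -> ~~ cone h v (iter j h a).
  by move=> /w1min nj; apply/negP => /Kx[/nj|/nab|/nad].
have rd j : 0 < j < p -> ~~ cone h v (iter j h d).
  move=> jp; apply/negP => /Kx[]; first exact: nda.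
    by have /negP := pmin j (proj2 (andP jp)); move=> N E; apply: N; rewrite E.
  by apply: w2min; lia.
have rb j : 0 < j < w2 - p -> ~~ cone h v (iter j h b).
  move=> jp; apply/negP; rewrite -Ep -iterD => /Kx[]; first exact: nda.
    by rewrite -Ep [j + p]addnC [in LHS]iterD => /iter_inj; apply: w2min; lia.
  by apply: w2min; lia.
have Eb : iter (w2 - p) h b = d by rewrite -Ep -iterD subnK // ltnW.
(* On the cone squares, [f] brings d back to itself after p steps, a to b after w1 steps, and b to a
   after w2 - p steps. *)
pose f z := vcycle h v (h z).
have [fa1 fa2] := vcycle_h_run ra; have [fd1 fd2] := vcycle_h_run rd.
have [fb1 fb2] := vcycle_h_run rb; rewrite -/f in fa1 fa2 fb1 fb2 fd1 fd2.
have {fa2} fa2 : iter w1 f a = b by rewrite fa2 // Ew1.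
have {fd2} fd2 : iter p f d = d by rewrite fd2 // Ep.
have {fb2} fb2 : iter (w2 - p) f b = a by rewrite fb2 ?Eb // subn_gt0.
have [h1 hgt1] := height_exists Ca; have [h2 hgt2] := height_exists Cd.
have [h10 [k1 Ck1] reg1] := hgt1; have [h20 [k2 Ck2] reg2] := hgt2.
have per1 k : iter h1 v (iter (w1 + k) h a) = iter h1 v (iter k h a).
  by rewrite addnC [in LHS]iterD Ew1.
have per2 k : iter h2 v (iter (w2 + k) h d) = iter h2 v (iter k h d).
  by rewrite addnC [in LHS]iterD Ew2.
(* By [per1] the first top has period w1 under [f], whereas w1 steps of [f] carry a to b. *)
have na k : iter h1 v (iter k h a) <> a.
  by move=> E; have := per1 k; rewrite (height_top_iter hgt1) -/f E fa2 => /esym.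
have Ek1 : iter h1 v (iter k1 h a) = d.
  case/Kx: Ck1 => // E; first by have := na k1.
  by have := na (w2 - p + k1); rewrite (height_top_iter hgt1) -/f E fb2.
(* The first top is the cycle of d under [f], which has length p, and it is as long as the
   bottom. *)
have pw1 : p = w1.
  apply/eqP; rewrite eqn_leq; apply/andP; split; rewrite leqNgt; apply/negP => lt.
    have := per1 k1; rewrite (height_top_iter hgt1) -/f Ek1 fd1 //.
    by apply: w2min; lia.
  have := height_top_iter hgt1 p k1; rewrite -/f Ek1 fd2 -Ek1 => /iter_inj.
  by rewrite addnC iterD => /iter_inj; apply: w1min; lia.
have [t1 t1w Et1] : exists2 t, t < w1 & iter h1 v (iter t h a) = d.
  by exists (k1 %% w1); rewrite ?ltn_mod // iter_mod.
have [t2 t2w Et2] : exists2 t, t < w2 & iter h2 v (iter t h d) = a.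
  have [k Ek] : exists k, iter h2 v (iter k h d) = a.
    case/Kx: Ck2 => E; [by exists k2| | ].
      by exists (w2 - p + k2); rewrite (height_top_iter hgt2) -/f E fb2.
    (* If the second top met d it would share it with the first, and [height_disjoint] would put a
       and d in one row. *)
    have [j /nad //] : exists j, iter j h a = d.
    by apply: (height_disjoint Ca Cd hgt1 hgt2 (etrans Et1 (esym E))).
  by exists (k %% w2); rewrite ?ltn_mod // iter_mod.
have V : valid2 w1 w2 h1 h2 t1 t2.
  by rewrite /valid2 w10 h10 h20 t1w t2w -pw1 pw2.
exists w1, w2, h1, h2, t1, t2; split=> //.
pose beta x := if x < w1 then iter x h a else iter (x - w1) h d.
exists (fun q => iter q.2 v (beta q.1)).
have shift_row j : j < w1 -> iter h1 v (iter (j + t1) h a) = iter j h d.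
  by move=> jw; rewrite (height_top_iter hgt1) -/f Et1 fd1 // pw1.
have shift_row2 j : j < w2 -> iter h2 v (iter (j + t2) h d) =
    if j < w1 then iter j h a else iter j h d.
  move=> jw; rewrite (height_top_iter hgt2) -/f Et2; case: ltnP => jw1; first exact: fa1.
  rewrite -(subnK jw1) iterD fa2 fb1; last cone_lia.
  by rewrite -Ep pw1 -iterD.
apply: chart_of_rows => //; first exact: base2_ok.
- by rewrite /= addn_gt0 w10.
- move=> x xW; rewrite /beta /= /rot2.
  have [E|E] := eqVneq x.+1 w1; first by (have -> : x < w1 by cone_lia); rewrite w10 -iterS E Ew1.
  have [E'|E'] := eqVneq x.+1 (w1 + w2).
    rewrite ltnn subnn; case: ltnP => A; first cone_lia.
    by rewrite -iterS -subSn // E' addKn Ew2.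
  case: ltnP => A; first by have -> : x.+1 < w1 by cone_lia.
  have -> : x.+1 < w1 = false by cone_lia.
  by rewrite subSn.
- by move=> x y xW; rewrite /= /beta; case: (ltnP x w1) => A yH; [exact: (reg1 _ _ yH)|exact: (reg2 _ _ yH)].
- move=> x xW; rewrite /= /beta /swap2 /shift2.
  case: (ltnP x w1) => A.
    case: (ltnP x t1) => B.
      have -> : x + w1 - t1 < w1 by cone_lia.
      have -> : x + w1 - t1 + w1 < w1 = false by cone_lia.
      by rewrite addnK -shift_row ?subnK ?(addnC x) ?per1 //; cone_lia.
    have -> : x - t1 < w1 by cone_lia.
    have -> : x - t1 + w1 < w1 = false by cone_lia.
    by rewrite addnK -shift_row ?subnK //; cone_lia.
  have [j jw [-> ->]] : exists2 j, j < w2 &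
      (if x < w1 + t2 then x + w2 - t2 else x - t2) = w1 + j /\
      iter h2 v (iter (x - w1) h d) = iter h2 v (iter (j + t2) h d).
    case: ltnP => B.
      exists (x + w2 - t2 - w1); first cone_lia.
      split; first by cone_lia.
      by rewrite -per2; congr (iter h2 v (iter _ h d)); cone_lia.
    exists (x - t2 - w1); first by move: xW => /=; cone_lia.
    split; first by cone_lia.
    by congr (iter h2 v (iter _ h d)); cone_lia.
  rewrite shift_row2 // !ltnNge leq_addr leq_add2l /= -ltnNge.
  case: (ltnP j w1) => B /=; first by rewrite addKn -ltnNge B.
  by rewrite leq_addr /= addKn.
- move=> x y /= xW yW; rewrite /beta.
  have winj w z i j : (forall j, 0 < j < w -> iter j h z <> z) -> i < w -> j < w ->
      i <= j -> iter i h z = iter j h z -> i = j.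
    move=> wmin iw jw ij; rewrite -{1 2}(subnKC ij) iterD => /iter_inj E.
    have [E0|k0] := posnP (j - i); first cone_lia.
    by have := wmin (j - i); rewrite -E; case; last by []; cone_lia.
  have winj' w z i j : (forall j, 0 < j < w -> iter j h z <> z) -> i < w -> j < w ->
      iter i h z = iter j h z -> i = j.
    move=> wmin iw jw E; case/orP: (leq_total i j) => le; first exact: (winj _ _ _ _ wmin iw jw le E).
    by symmetry; exact: (winj _ _ _ _ wmin jw iw le (esym E)).
  have nad' i j : iter i h a <> iter j h d.
    move=> E; have [m Em] := iter_back h j d; apply: (nad (m + i)).
    by rewrite iterD E.
  case: ltnP => A; case: ltnP => B.
  + exact: (winj' _ _ _ _ w1min A B).
  + by move/nad'.
  + by move/esym/nad'.
  by move=> E; have := winj' _ _ _ _ w2min _ _ E; cone_lia.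
move=> x _; rewrite /beta; case: ifP => _.
  by have [m Em] := iter_back h x a; exists m; rewrite Em.
by have [m Em] := iter_back h (x - w1) d; exists m; rewrite Em.
Qed.

(** The three cone squares share a row of length w, so the top has to be a single cycle of [f] of
    length w; this decides their cyclic order. *)
Lemma classify1 n (h v : {perm 'I_n}) a : sts_connected h v -> inH2 h v ->
  cone h v a ->
  let b := vcycle h v a in let d := vcycle h v b in
  (exists k, iter k h a = b) -> (exists k, iter k h a = d) ->
  exists l1 l2 l3 H t, valid1 l1 l2 l3 H t /\
    exists2 psi, chart (base1 l1 l2 l3 H t) h v psi & psi (0, 0) = a.
Proof.
move=> conn H2 Ca b d [p' Ep'] [q' Eq'].
have [[a_b a_d b_d] [Cb Cd cda] Kx] := cone_cycle H2 Ca; rewrite -/b -/d in Kx a_b a_d b_d Cb Cd cda.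
have cab : vcycle h v a = b by []. have cbd : vcycle h v b = d by [].
have [w [w0 Ew wmin]] := order_exists h a.
have first_at z k' : iter k' h a = z -> z <> a -> exists k, [/\ 0 < k, k < w, iter k h a = z &
    forall j, j < w -> iter j h a = z -> j = k].
  move=> Ek' za; exists (k' %% w); rewrite ltn_mod iter_mod //.
  have E : iter (k' %% w) h a = z by rewrite iter_mod.
  split=> //; first by rewrite lt0n; apply/eqP=> E0; rewrite E0 in E; apply: za.
  move=> j jw; rewrite -E; have kw : k' %% w < w by rewrite ltn_mod.
  move: (k' %% w) kw => k kw; case/orP: (leq_total j k) => le.
    rewrite -{1 2}(subnKC le) iterD => /iter_inj Ej.
    have [|k0] := posnP (k - j); first cone_lia.
    by have := wmin (k - j); rewrite -Ej; case; last by []; cone_lia.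
  rewrite -{1 2}(subnKC le) iterD => /iter_inj Ej.
  have [|k0] := posnP (j - k); first cone_lia.
  by have := wmin (j - k); rewrite Ej; case; last by []; cone_lia.
have [p [p0 pw Ep pu]] := first_at b p' Ep' (nesym a_b).
have [q [q0 qw Eq qu]] := first_at d q' Eq' (nesym a_d).
have reg j : 0 < j < w -> j != p -> j != q -> ~~ cone h v (iter j h a).
  move=> jw /eqP jp /eqP jq; apply/negP => /Kx[].
  - exact: wmin.
  - by move/pu => E; apply: jp; apply: E; cone_lia.
  - by move/qu => E; apply: jq; apply: E; cone_lia.
have reg' m l : m + l <= w -> (forall j, 0 < j < l -> j + m != p) ->
    (forall j, 0 < j < l -> j + m != q) ->
    forall j, 0 < j < l -> ~~ cone h v (iter j h (iter m h a)).
  by move=> ml mp mq j jl; rewrite -iterD reg ?mp ?mq //; cone_lia.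
have [H hgt] := height_exists Ca; have [H0 [k0 Ck0] regH] := hgt.
pose f z := vcycle h v (h z).
have noper m z : 0 < m < w -> iter m f z = z -> forall k, iter H v (iter k h a) <> z.
  move=> mw E k Ek; have := height_top_iter hgt m k; rewrite -/f Ek E -Ek => /iter_inj.
  by rewrite addnC iterD => /iter_inj; exact: wmin.
have pq : p != q by apply/eqP=> E; apply: b_d; rewrite -Ep E.
(* In the order a, d, b every cone square would return to itself under [f] in fewer than w steps,
   which [noper] forbids on the top. *)
have {pq} pq : p < q.
  rewrite ltn_neqAle pq leqNgt; apply/negP=> qp.
  have A1 : iter q f a = a.
    have [_ /(_ q0)] := vcycle_h_run (reg' 0 q ltac:(cone_lia) ltac:(cone_lia) ltac:(cone_lia)).
    by rewrite /= -/f Eq cda.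
  have A2 : iter (p - q) f d = d.
    have [_] := vcycle_h_run (reg' q (p - q) ltac:(cone_lia) ltac:(cone_lia) ltac:(cone_lia)).
    by rewrite -iterD (subnK (ltnW qp)) Ep -/f Eq => ->; rewrite ?subn_gt0.
  have A3 : iter (w - p) f b = b.
    have [_] := vcycle_h_run (reg' p (w - p) ltac:(cone_lia) ltac:(cone_lia) ltac:(cone_lia)).
    by rewrite -iterD (subnK (ltnW pw)) Ew -/f Ep => ->; rewrite ?subn_gt0.
  case/Kx: Ck0; first exact: (noper q a ltac:(cone_lia) A1).
    exact: (noper (w - p) b ltac:(cone_lia) A3).
  exact: (noper (p - q) d ltac:(cone_lia) A2).
have [fa1 fa2] : (forall j, j < p -> iter j f a = iter j h a) /\ iter p f a = d.
  have [A1 /(_ p0)] := vcycle_h_run (reg' 0 p ltac:(cone_lia) ltac:(cone_lia) ltac:(cone_lia)).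
  by rewrite /= -/f Ep.
have [fb1 fb2] : (forall j, j < q - p -> iter j f b = iter j h b) /\ iter (q - p) f b = a.
  have := vcycle_h_run (reg' p (q - p) ltac:(cone_lia) ltac:(cone_lia) ltac:(cone_lia)).
  by rewrite -iterD (subnK (ltnW pq)) -/f Ep Eq subn_gt0 => -[A1 ->].
have [fd1 fd2] : (forall j, j < w - q -> iter j f d = iter j h d) /\ iter (w - q) f d = b.
  have := vcycle_h_run (reg' q (w - q) ltac:(cone_lia) ltac:(cone_lia) ltac:(cone_lia)).
  by rewrite -iterD (subnK (ltnW qw)) -/f Eq Ew subn_gt0 => -[A1 ->].
have per k : iter H v (iter (w + k) h a) = iter H v (iter k h a).
  by rewrite addnC [in LHS]iterD Ew.
(* The twist is measured at d because [flip3] glues the top coordinate 0 to q, the position of d. *)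
have [t tw Et] : exists2 t, t < w & iter H v (iter t h a) = d.
  have [k Ek] : exists k, iter H v (iter k h a) = d.
    case/Kx: Ck0 => E; last by exists k0.
      by exists (p + k0); rewrite (height_top_iter hgt) -/f E.
    exists (p + (q - p + k0)).
    by rewrite (height_top_iter hgt) (height_top_iter hgt (q - p)) -/f E fb2.
  by exists (k %% w); rewrite ?ltn_mod // iter_mod.
have W : (w - q) + (q - p) + p = w by cone_lia.
have V : valid1 (w - q) (q - p) p H t by rewrite /valid1 W tw H0 p0; cone_lia.
exists (w - q), (q - p), p, H, t; split=> //.
exists (fun z => iter z.2 v (iter z.1 h a)) => //.
have roof j : j < w -> iter H v (iter (j + t) h a) = iter (flip3 (w - q) (q - p) p j) h a.
  move=> jw; rewrite (height_top_iter hgt) -/f Et /flip3.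
  case: (ltnP j (w - q)) => A; first by rewrite fd1 // -Eq -iterD; congr (iter _ h a); cone_lia.
  case: (ltnP j (w - q + (q - p))) => B.
    rewrite -{1}(subnK A) iterD fd2 fb1; last cone_lia.
    by rewrite -Ep -iterD; congr (iter _ h a); cone_lia.
  have -> : j = (j - (w - q) - (q - p)) + (q - p) + (w - q) by cone_lia.
  rewrite iterD fd2 iterD fb2 fa1; last cone_lia.
  by congr (iter _ h a); cone_lia.
apply: (chart_of_rows (beta := fun x => iter x h a)) => //.
- exact: base1_ok.
- by rewrite /= W.
- move=> x _; rewrite /= W /rot1; case: eqP => // E; by rewrite -iterS E Ew.
- by move=> x y _; exact: regH.
- move=> x /=; rewrite W => xw; rewrite -roof /shift1; last by case: ifP; cone_lia.
  case: ifP => A; last by congr (iter H v (iter _ h a)); cone_lia.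
  by rewrite -(per x); congr (iter H v (iter _ h a)); cone_lia.
- move=> x y /=; rewrite W => xw yw E.
  have [E0|E0] := EM (iter x h a = a).
    have Z z : z < w -> iter z h a = a -> z = 0.
      by move=> zw Ez; apply/eqP; rewrite -leqn0 leqNgt; apply/negP => z0; apply: (wmin z); rewrite ?z0.
    by rewrite (Z x) // (Z y) // -E.
  by have [k [_ _ _ ku]] := first_at _ x (erefl _) E0; rewrite (ku x) // (ku y).
by move=> x _; have [m Em] := iter_back h x a; exists m; rewrite Em.
Qed.

(** A cone square alone in its row is carried by an iterate of [f] to its image under c. So all
    three lie on one cycle of [f], and every cylinder would have a on its top; but two cylinders
    cannot share a top. *)
Lemma three_rows_false n (h v : {perm 'I_n}) a : inH2 h v -> cone h v a ->
  let b := vcycle h v a in let d := vcycle h v b in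
  (forall k, iter k h a <> b) -> (forall k, iter k h a <> d) ->
  (forall k, iter k h b <> d) -> False.
Proof.
move=> H2 Ca b d nab nad nbd.
have [_ [Cb Cd cda] Kx] := cone_cycle H2 Ca; rewrite -/b -/d in Kx Cb Cd cda.
have nba k : iter k h b <> a.
  by move=> E; have [m Em] := iter_back h k b; apply: (nab m); rewrite -E.
have nda k : iter k h d <> a.
  by move=> E; have [m Em] := iter_back h k d; apply: (nad m); rewrite -E.
have ndb k : iter k h d <> b.
  by move=> E; have [m Em] := iter_back h k d; apply: (nbd m); rewrite -E.
pose f z := vcycle h v (h z).
have turn x : cone h v x -> (forall y, cone h v y -> y <> x -> forall k, iter k h x <> y) ->
    exists m, iter m f x = vcycle h v x.
  move=> Cx nx; have [w [w0 Ew wmin]] := order_exists h x; exists w.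
  have [|_ /(_ w0)] := @vcycle_h_run _ h v x w; last by rewrite Ew.
  move=> j jw; apply/negP=> Cj.
  have [E|E] := EM (iter j h x = x); first exact: wmin jw E.
  exact: (nx _ Cj E j).
have [ma Ema] : exists m, iter m f a = b by apply: turn => // y /Kx[] ->.
have [mb Emb] : exists m, iter m f b = d by apply: turn => // y /Kx[] ->.
have [md Emd] : exists m, iter m f d = a.
  by rewrite -cda; apply: turn => // y /Kx[] ->.
have hit x : cone h v x -> exists2 H, is_height h v x H &
    exists k, iter H v (iter k h x) = a.
  move=> Cx; have [H hgt] := height_exists Cx; exists H => //.
  have [_ [k Ck] _] := hgt; case/Kx: Ck => E.
  - by exists k.
  - exists (md + (mb + k)).
    by rewrite (height_top_iter hgt) (height_top_iter hgt mb) -/f E Emb.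
  - by exists (md + k); rewrite (height_top_iter hgt) -/f E.
have [H hgt [k Ek]] := hit a Ca; have [H' hgt' [k' Ek']] := hit b Cb.
by have [j /nab] := height_disjoint Ca Cb hgt hgt' (etrans Ek (esym Ek')).
Qed.

Theorem classification n (h v : {perm 'I_n}) : sts_connected h v -> inH2 h v ->
  (exists w1 w2 h1 h2 t1 t2, valid2 w1 w2 h1 h2 t1 t2 /\
    exists psi, chart (base2 w1 w2 h1 h2 t1 t2) h v psi) \/
  (forall a, cone h v a -> exists l1 l2 l3 H t, valid1 l1 l2 l3 H t /\
    exists2 psi, chart (base1 l1 l2 l3 H t) h v psi & psi (0, 0) = a).
Proof.
move=> conn H2; have [c3 card3] := inH2P _ _ H2.
pose R x y := exists k, iter k h x = y.
have Rs x y : R x y -> R y x.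
  by case=> k <-; have [m Em] := iter_back h k x; exists m.
have Rt x y z : R x y -> R y z -> R x z.
  by case=> k <- [k' <-]; exists (k' + k); rewrite iterD.
have not_ex x y : ~ R x y -> forall k, iter k h x <> y.
  by move=> N k E; apply: N; exists k.
(* Either some cone square is alone in its row, or each of the three has a companion, and then all
   three share one row. *)
have [[a [Ca na nd]]|all1] := EM (exists a, [/\ cone h v a, ~ R a (vcycle h v a) &
    ~ R a (vcycle h v (vcycle h v a))]).
  left; have [r|nr] := EM (R (vcycle h v a) (vcycle h v (vcycle h v a))).
    by apply: (classify2 conn H2 Ca); [exact: not_ex|exact: not_ex|exact: Rs].
  by case: (three_rows_false H2 Ca); exact: not_ex.
right=> a Ca; set b := vcycle h v a; set d := vcycle h v b.
have Cb : cone h v b by rewrite cone_vcycle.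
have Cd : cone h v d by rewrite cone_vcycle.
have cda : vcycle h v d = a by exact: c3.
have alt x : cone h v x -> R x (vcycle h v x) \/ R x (vcycle h v (vcycle h v x)).
  move=> Cx; have [?|n1] := EM (R x (vcycle h v x)); first by left.
  have [?|n2] := EM (R x (vcycle h v (vcycle h v x))); first by right.
  by case: all1; exists x.
have A3 : R a b \/ R a d := alt a Ca.
have A2 : R b d \/ R b a by case: (alt b Cb) => r; [left|right; rewrite -cda].
have A1 : R d a \/ R d b.
  by case: (alt d Cd) => r; [left; rewrite -cda|right; rewrite /b -cda].
suff [r1 r2] : R a b /\ R a d by apply: (classify1 conn H2 Ca).
case: A3 => r; split => //.
- case: A1 => [/Rs//|/Rs r']; exact: Rt r r'.
- case: A2 => [r'|/Rs//]; exact: Rt r (Rs _ _ r').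
Qed.

(** * Uniqueness of the parameters *)

Definition is_order (T : finType) (s : {perm T}) x w :=
  [/\ 0 < w, iter w s x = x & forall j, 0 < j < w -> iter j s x <> x].

Lemma is_order_uniq (T : finType) (s : {perm T}) x w w' :
  is_order s x w -> is_order s x w' -> w = w'.
Proof.
move=> [w0 E m] [w0' E' m']; have [lt|lt|//] := ltngtP w w'.
  by case: (m' w); rewrite ?w0.
by case: (m w'); rewrite ?w0'.
Qed.

Lemma is_order_inj (T : finType) (s : {perm T}) x w i j :
  is_order s x w -> i < w -> j < w -> iter i s x = iter j s x -> i = j.
Proof.
move=> [w0 _ m]; wlog le : i j / i <= j.
  move=> W iw jw E; case/orP: (leq_total i j) => le; first exact: W.
  by symmetry; apply: W.
move=> iw jw; rewrite -{1 2}(subnKC le) iterD => /iter_inj E.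
have [|k0] := posnP (j - i); first lia.
by case: (m (j - i)); rewrite -?E //; lia.
Qed.

Lemma is_height_uniq n (h v : {perm 'I_n}) x H H' :
  is_height h v x H -> is_height h v x H' -> H = H'.
Proof.
move=> [H0 [k C] m] [H0' [k' C'] m']; have [lt|lt|//] := ltngtP H H'.
  by have := m' H k; rewrite C H0 lt => /(_ isT).
by have := m H' k'; rewrite C' H0' lt => /(_ isT).
Qed.

Lemma inH2_of_cycle n (h v : {perm 'I_n}) a b d :
  a <> b -> a <> d -> b <> d ->
  vcycle h v a = b -> vcycle h v b = d -> vcycle h v d = a ->
  (forall x, cone h v x -> [\/ x = a, x = b | x = d]) -> inH2 h v.
Proof.
move=> /eqP ab /eqP ad /eqP bd ca cb cd K; apply/inH2P; split.
  move=> x; have [/K[] ->|] := boolP (cone h v x); rewrite ?ca ?cb ?cd ?ca ?cb //.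
  by rewrite negbK => /eqP Ex; rewrite !Ex.
suff -> : [set x | cone h v x] = [set a; b; d].
  by rewrite -setUA !cardsU1 !inE cards1 negb_or ab ad bd.
apply/setP=> x; rewrite !inE; apply/idP/idP=> [/K[] ->|]; rewrite ?eqxx ?orbT //.
by rewrite /cone => /orP[/orP[]|] /eqP ->; rewrite ?ca ?cb ?cd // eq_sym.
Qed.

Section Chart2.
Variables (w1 w2 h1 h2 t1 t2 n : nat) (h v : {perm 'I_n}) (psi : nat * nat -> 'I_n).
Hypothesis V : valid2 w1 w2 h1 h2 t1 t2.
Let B := base2 w1 w2 h1 h2 t1 t2.
Hypothesis ch : chart B h v psi.
Let okB : base_ok B := base2_ok V.

Local Notation a := (psi (0, 0)).
Local Notation b := (psi (w1 + w1, 0)).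
Local Notation d := (psi (w1, 0)).

Lemma chart2_cell0 x : x < w1 + w2 -> (x, 0) \in cell B.
Proof. by case/and5P: V => ? ? ? ? ? xW; rewrite !inE /= xW; case: ifP. Qed.

Lemma chart2_inj0 x y : x < w1 + w2 -> y < w1 + w2 -> psi (x, 0) = psi (y, 0) -> x = y.
Proof.
by move=> xW yW /(ch_inj ch (chart2_cell0 xW) (chart2_cell0 yW)) [].
Qed.

Lemma chart2_vcycle z : z < w1 + w2 ->
  vcycle h v (psi (rot2 w1 w2 (swap2 w1 z), 0)) = psi (swap2 w1 (rot2 w1 w2 z), 0).
Proof.
(* The complementary twists invert [shift2]; when a twist is 0 the complement is a full turn, which
   acts trivially. *)
move=> zW; pose x := shift2 w1 w2 (w1 - t1) (w2 - t2) z.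
case/and5P: (V) => ? ? ? ? /andP[? ?].
have [xW [Ex Erx]] : x < w1 + w2 /\ shift2 w1 w2 t1 t2 x = z /\
    shift2 w1 w2 t1 t2 (rot2 w1 w2 x) = rot2 w1 w2 z.
  by rewrite /x; split; last split; base_lia.
by have := chart_vcycle okB ch xW; rewrite /= Ex Erx.
Qed.

Lemma chart2_ca : vcycle h v a = b.
Proof.
case/and5P: (V) => ? ? ? ? /andP[? ?].
have W : w1 + w1 - 1 < w1 + w2 by lia.
have := chart2_vcycle W.
have -> : rot2 w1 w2 (swap2 w1 (w1 + w1 - 1)) = 0 by base_lia.
by have -> : swap2 w1 (rot2 w1 w2 (w1 + w1 - 1)) = w1 + w1 by base_lia.
Qed.

Lemma chart2_cb : vcycle h v b = d.
Proof.
case/and5P: (V) => ? ? ? ? /andP[? ?].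
have W : w1 - 1 < w1 + w2 by lia.
have := chart2_vcycle W.
have -> : rot2 w1 w2 (swap2 w1 (w1 - 1)) = w1 + w1 by base_lia.
by have -> : swap2 w1 (rot2 w1 w2 (w1 - 1)) = w1 by base_lia.
Qed.

Lemma chart2_cd : vcycle h v d = a.
Proof.
case/and5P: (V) => ? ? ? ? /andP[? ?].
have W : w1 + w2 - 1 < w1 + w2 by lia.
have := chart2_vcycle W.
have -> : rot2 w1 w2 (swap2 w1 (w1 + w2 - 1)) = w1 by base_lia.
by have -> : swap2 w1 (rot2 w1 w2 (w1 + w2 - 1)) = 0 by base_lia.
Qed.

Lemma chart2_cone x y : (x, y) \in cell B ->
  cone h v (psi (x, y)) = (y == 0) && [|| x == 0, x == w1 | x == w1 + w1].
Proof.
case/and5P: (V) => ? ? ? ? /andP[? ?] /andP[/= xW yH].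
have [y0|y0] := eqVneq y 0; last first.
  by apply/negbTE/(chart_regular okB ch) => //; rewrite lt0n.
move: yH; rewrite y0 => _ /=.
have ne i j : i < w1 + w2 -> j < w1 + w2 -> i <> j -> psi (i, 0) != psi (j, 0).
  by move=> iW jW ij; apply/eqP => /chart2_inj0 E; apply: ij; exact: E.
have [->|x0] := eqVneq x 0; first by rewrite /cone chart2_ca; apply: ne; lia.
have [->|x1] := eqVneq x w1; first by rewrite /cone chart2_cd; apply: ne; lia.
have [->|x2] := eqVneq x (w1 + w1); first by rewrite /cone chart2_cb; apply: ne; lia.
have zW : swap2 w1 (x - 1) < w1 + w2 by base_lia.
have := chart2_vcycle zW.
have -> : rot2 w1 w2 (swap2 w1 (swap2 w1 (x - 1))) = x by base_lia.
have -> : swap2 w1 (rot2 w1 w2 (swap2 w1 (x - 1))) = x by base_lia.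
by rewrite /cone => ->; rewrite eqxx.
Qed.

Lemma chart2_inH2 : inH2 h v.
Proof.
case/and5P: (V) => ? ? ? ? /andP[? ?].
apply: (inH2_of_cycle _ _ _ chart2_ca chart2_cb chart2_cd).
- by move/chart2_inj0; lia.
- by move/chart2_inj0; lia.
- by move/chart2_inj0; lia.
move=> z; have [[x y] Hp <-] := ch_surj ch z; rewrite chart2_cone //.
by case/andP=> /eqP -> /or3P[] /eqP ->; [constructor 1|constructor 3|constructor 2].
Qed.

Lemma chart2_row1 j : j < w1 -> iter j h a = psi (j, 0).
Proof.
case/and5P: (V) => ? ? ? ? /andP[? ?] jw.
rewrite -(chart_row okB ch) /=; [|lia|by case: ifP].
congr (psi (_, _)); elim: j jw => //= j IH jw; rewrite IH; last lia.
by base_lia.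
Qed.

Lemma chart2_row2 j : j < w2 -> iter j h d = psi (w1 + j, 0).
Proof.
case/and5P: (V) => ? ? ? ? /andP[? ?] jw.
rewrite -(chart_row okB ch) /=; [|lia|by case: ifP].
congr (psi (_, _)); elim: j jw => [|j IH] jw /=; first lia.
rewrite IH; last lia.
by base_lia.
Qed.

Lemma chart2_order1 : is_order h a w1.
Proof.
case/and5P: (V) => w10 ? ? ? /andP[? ?]; split=> // [|j jw].
  rewrite -{1}(prednK w10) /= chart2_row1; last lia.
  rewrite (ch_h ch); last by apply: chart2_cell0; lia.
  by congr (psi (_, _)); base_lia.
by rewrite chart2_row1; [move/chart2_inj0; lia|lia].
Qed.

Lemma chart2_order2 : is_order h d w2.
Proof.
case/and5P: (V) => ? ? ? ? /andP[? ?]; split=> // [||j jw]; first lia.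
  have w20 : 0 < w2 by lia.
  rewrite -{1}(prednK w20) /= chart2_row2; last lia.
  rewrite (ch_h ch); last by apply: chart2_cell0; lia.
  by congr (psi (_, _)); base_lia.
by rewrite chart2_row2; [move/chart2_inj0; lia|lia].
Qed.

Lemma chart2_row1_all k : exists2 j, j < w1 & iter k h a = psi (j, 0).
Proof.
have [w10 E _] := chart2_order1.
by exists (k %% w1); rewrite ?ltn_mod // -(@chart2_row1 (k %% w1)) ?ltn_mod // iter_mod.
Qed.

Lemma chart2_row2_all k : exists2 j, j < w2 & iter k h d = psi (w1 + j, 0).
Proof.
have [w10 E _] := chart2_order2.
by exists (k %% w2); rewrite ?ltn_mod // -(@chart2_row2 (k %% w2)) ?ltn_mod // iter_mod.
Qed.

Lemma chart2_twist1 : iter h1 v (iter t1 h a) = d.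
Proof.
case/and5P: (V) => ? ? ? ? /andP[? ?]; rewrite chart2_row1 //.
have t1W : t1 < bW B by rewrite /=; lia.
have := chart_roof okB ch t1W; rewrite /=.
have -> : t1 < w1 by []. move->; congr (psi (_, _)); base_lia.
Qed.

Lemma chart2_twist2 : iter h2 v (iter t2 h d) = a.
Proof.
case/and5P: (V) => ? ? ? ? /andP[? ?]; rewrite chart2_row2 //.
have t1W : w1 + t2 < bW B by rewrite /=; lia.
have := chart_roof okB ch t1W; rewrite /=.
have -> : w1 + t2 < w1 = false by lia. move->; congr (psi (_, _)); base_lia.
Qed.

Lemma chart2_height1 : is_height h v a h1.
Proof.
case/and5P: (V) => ? ? ? ? /andP[? ?]; split=> // [|y k yh].
  exists t1; rewrite chart2_twist1 chart2_cone ?eqxx ?orbT //; apply: chart2_cell0; lia.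
have [j jw ->] := chart2_row1_all k.
rewrite -(chart_base ch) /= ?jw; [|lia|lia].
by apply: (chart_regular okB ch) => //=; rewrite ?jw; lia.
Qed.

Lemma chart2_height2 : is_height h v d h2.
Proof.
case/and5P: (V) => ? ? ? ? /andP[? ?]; split=> // [|y k yh].
  exists t2; rewrite chart2_twist2 chart2_cone ?eqxx ?orbT //; apply: chart2_cell0; lia.
have [j jw ->] := chart2_row2_all k.
have E : w1 + j < w1 = false by lia.
rewrite -(chart_base ch) /= ?E; [|lia|lia].
by apply: (chart_regular okB ch) => //=; rewrite ?E; lia.
Qed.

(** This singles out the origin of a two-cylinder chart among the cone squares in terms of [h] and
    [v] only. *)
Lemma chart2_alone k : cone h v (iter k h a) -> iter k h a = a.
Proof.
case/and5P: (V) => ? ? ? ? /andP[? ?].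
have [j jw ->] := chart2_row1_all k; rewrite chart2_cone; last by apply: chart2_cell0; lia.
by case/or3P => /eqP; [move=> -> | lia | lia].
Qed.

Lemma chart2_conn : sts_connected h v.
Proof.
case/and5P: (V) => ? ? ? ? /andP[? ?]; apply/connP => P Ph Pv.
have PhE x : P (h x) = P x by apply/idP/idP => [/(closed_back Ph)|/Ph].
have PvE x : P (v x) = P x by apply/idP/idP => [/(closed_back Pv)|/Pv].
have ih k x : P (iter k h x) = P x by elim: k => //= k <-; rewrite PhE.
have iv k x : P (iter k v x) = P x by elim: k => //= k <-; rewrite PvE.
have all i : P i = P a.
  have [[x y] Hp <-] := ch_surj ch i.
  rewrite (chart_base ch) ?iv; [|by case/andP: Hp|by case/andP: Hp].
  have [xw|xw] := ltnP x w1; first by rewrite -chart2_row1 ?ih.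
  have jw : x - w1 < w2 by case/andP: Hp => /=; lia.
  have := chart2_row2 jw; rewrite subnKC // => <-; rewrite ih -(ih t2) -(iv h2).
  by rewrite chart2_twist2.
by move=> x y; rewrite !all.
Qed.

End Chart2.

(** The cone square alone in its row is the origin of both charts. The other data are then
    determined by [h] and [v]: as orders, as heights, and as the position of a cone square on each
    top. *)
Lemma chart2_uniq n (h v : {perm 'I_n}) w1 w2 h1 h2 t1 t2 psi w1' w2' h1' h2' t1' t2' psi' :
  valid2 w1 w2 h1 h2 t1 t2 -> chart (base2 w1 w2 h1 h2 t1 t2) h v psi ->
  valid2 w1' w2' h1' h2' t1' t2' -> chart (base2 w1' w2' h1' h2' t1' t2') h v psi' ->
  [/\ psi (0, 0) = psi' (0, 0), w1 = w1', w2 = w2', h1 = h1' & h2 = h2'] /\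
  t1 = t1' /\ t2 = t2'.
Proof.
move=> V ch V' ch'.
have alone := chart2_alone V ch; have alone' := chart2_alone V' ch'.
have ca := chart2_ca V ch; have cb := chart2_cb V ch; have cd := chart2_cd V ch.
have ca' := chart2_ca V' ch'; have cb' := chart2_cb V' ch'; have cd' := chart2_cd V' ch'.
have [|_ [Cb Cd _] Kx] := cone_cycle (chart2_inH2 V ch) (a := psi (0, 0)).
  by rewrite (chart2_cone V ch) //; apply: (chart2_cell0 V); case/and5P: V; lia.
have Ca' : cone h v (psi' (0, 0)).
  by rewrite (chart2_cone V' ch') //; apply: (chart2_cell0 V'); case/and5P: V'; lia.
have /and5P[W1 W2 _ _ /andP[T1 T2]] := V; have /and5P[W1' W2' _ _ /andP[T1' T2']] := V'.
have Erow : iter w1 h (psi (w1, 0)) = psi (w1 + w1, 0) by rewrite (chart2_row2 V ch).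
have bd : psi (w1 + w1, 0) <> psi (w1, 0) by move/(chart2_inj0 V ch); lia.
rewrite ca cb in Cb Cd Kx.
have Ea : psi (0, 0) = psi' (0, 0).
  case/Kx: Ca' => // E; case: bd.
    have [m Em] := iter_back h w1 (psi (w1, 0)); rewrite Erow in Em.
    by have := alone' m; rewrite E Em; move/(_ Cd) => ->.
  by have := alone' w1; rewrite E Erow; move/(_ Cb).
have Ed : psi (w1, 0) = psi' (w1', 0) by rewrite -cb -ca Ea ca' cb'.
have Ew1 : w1 = w1'.
  by apply: (is_order_uniq (chart2_order1 V ch)); rewrite Ea; exact: (chart2_order1 V' ch').
have Ew2 : w2 = w2'.
  by apply: (is_order_uniq (chart2_order2 V ch)); rewrite Ed; exact: (chart2_order2 V' ch').
have Eh1 : h1 = h1'.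
  by apply: (is_height_uniq (chart2_height1 V ch)); rewrite Ea; exact: (chart2_height1 V' ch').
have Eh2 : h2 = h2'.
  by apply: (is_height_uniq (chart2_height2 V ch)); rewrite Ed; exact: (chart2_height2 V' ch').
split=> //; split.
  apply: (is_order_inj (chart2_order1 V ch)) => //; first by rewrite Ew1.
  apply: (@iter_inj _ v h1); rewrite (chart2_twist1 V ch) Ea Ed Eh1.
  by rewrite (chart2_twist1 V' ch').
apply: (is_order_inj (chart2_order2 V ch)) => //; first by rewrite Ew2.
apply: (@iter_inj _ v h2); rewrite (chart2_twist2 V ch) Ed Ea Eh2.
by rewrite (chart2_twist2 V' ch').
Qed.

Section Chart1.
Variables (l1 l2 l3 H t n : nat) (h v : {perm 'I_n}) (psi : nat * nat -> 'I_n).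
Hypothesis V : valid1 l1 l2 l3 H t.
Let B := base1 l1 l2 l3 H t.
Hypothesis ch : chart B h v psi.
Let okB : base_ok B := base1_ok V.

Local Notation w := (l1 + l2 + l3).
Local Notation a := (psi (0, 0)).
Local Notation b := (psi (l3, 0)).
Local Notation d := (psi (l2 + l3, 0)).

Lemma chart1_cell0 x : x < w -> (x, 0) \in cell B.
Proof. by case/and5P: V => ? ? ? ? ? xW; rewrite !inE /= xW. Qed.

Lemma chart1_inj0 x y : x < w -> y < w -> psi (x, 0) = psi (y, 0) -> x = y.
Proof.
by move=> xW yW /(ch_inj ch (chart1_cell0 xW) (chart1_cell0 yW)) [].
Qed.

Lemma chart1_vcycle z : z < w ->
  vcycle h v (psi (rot1 w (flip3 l1 l2 l3 z), 0)) = psi (flip3 l1 l2 l3 (rot1 w z), 0).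
Proof.
move=> zW; pose x := shift1 w (w - t) z.
case/and5P: (V) => ? ? ? ? ?.
have [xW [Ex Erx]] : x < w /\ shift1 w t x = z /\ shift1 w t (rot1 w x) = rot1 w z.
  by rewrite /x; split; last split; base_lia.
by have := chart_vcycle okB ch xW; rewrite /= Ex Erx.
Qed.

Lemma chart1_ca : vcycle h v a = b.
Proof.
case/and5P: (V) => ? ? ? ? ?.
have W : l1 - 1 < w by lia.
have := chart1_vcycle W.
have -> : rot1 w (flip3 l1 l2 l3 (l1 - 1)) = 0 by base_lia.
by have -> : flip3 l1 l2 l3 (rot1 w (l1 - 1)) = l3 by base_lia.
Qed.

Lemma chart1_cb : vcycle h v b = d.
Proof.
case/and5P: (V) => ? ? ? ? ?.
have W : w - 1 < w by lia.
have := chart1_vcycle W.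
have -> : rot1 w (flip3 l1 l2 l3 (w - 1)) = l3 by base_lia.
by have -> : flip3 l1 l2 l3 (rot1 w (w - 1)) = l2 + l3 by base_lia.
Qed.

Lemma chart1_cd : vcycle h v d = a.
Proof.
case/and5P: (V) => ? ? ? ? ?.
have W : l1 + l2 - 1 < w by lia.
have := chart1_vcycle W.
have -> : rot1 w (flip3 l1 l2 l3 (l1 + l2 - 1)) = l2 + l3 by base_lia.
by have -> : flip3 l1 l2 l3 (rot1 w (l1 + l2 - 1)) = 0 by base_lia.
Qed.

Lemma chart1_cone x y : (x, y) \in cell B ->
  cone h v (psi (x, y)) = (y == 0) && [|| x == 0, x == l3 | x == l2 + l3].
Proof.
case/and5P: (V) => ? ? ? ? ? /andP[/= xW yH].
have [y0|y0] := eqVneq y 0; last first.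
  by apply/negbTE/(chart_regular okB ch) => //; rewrite lt0n.
move: yH; rewrite y0 => _ /=.
have ne i j : i < w -> j < w -> i <> j -> psi (i, 0) != psi (j, 0).
  by move=> iW jW ij; apply/eqP => /chart1_inj0 E; apply: ij; exact: E.
have [->|x0] := eqVneq x 0; first by rewrite /cone chart1_ca; apply: ne; lia.
have [->|x1] := eqVneq x l3; first by rewrite /cone chart1_cb; apply: ne; lia.
have [->|x2] := eqVneq x (l2 + l3); first by rewrite /cone chart1_cd; apply: ne; lia.
pose z := flip3 l3 l2 l1 (x - 1).
have zW : z < w by rewrite /z; base_lia.
have := chart1_vcycle zW.
have -> : rot1 w (flip3 l1 l2 l3 z) = x by rewrite /z; base_lia.
have -> : flip3 l1 l2 l3 (rot1 w z) = x by rewrite /z; base_lia.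
by rewrite /cone => ->; rewrite eqxx.
Qed.

Lemma chart1_inH2 : inH2 h v.
Proof.
case/and5P: (V) => ? ? ? ? ?.
apply: (inH2_of_cycle _ _ _ chart1_ca chart1_cb chart1_cd).
- by move/chart1_inj0; lia.
- by move/chart1_inj0; lia.
- by move/chart1_inj0; lia.
move=> z; have [[x y] Hp <-] := ch_surj ch z; rewrite chart1_cone //.
by case/andP=> /eqP -> /or3P[] /eqP ->; [constructor 1|constructor 2|constructor 3].
Qed.

Lemma chart1_row j : j < w -> iter j h a = psi (j, 0).
Proof.
case/and5P: (V) => ? ? ? ? ? jw.
rewrite -(chart_row okB ch) /=; [|lia|by []].
congr (psi (_, _)); elim: j jw => //= j IH jw; rewrite IH; last lia.
by base_lia.
Qed.

Lemma chart1_order : is_order h a w.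
Proof.
case/and5P: (V) => ? ? ? ? ?; have w0 : 0 < w by lia.
split=> // [|j jw].
  rewrite -{1}(prednK w0) /= chart1_row; last lia.
  rewrite (ch_h ch); last by apply: chart1_cell0; lia.
  by congr (psi (_, _)); base_lia.
by rewrite chart1_row; [move/chart1_inj0; lia|lia].
Qed.

Lemma chart1_row_all k : exists2 j, j < w & iter k h a = psi (j, 0).
Proof.
have [w10 E _] := chart1_order.
by exists (k %% w); rewrite ?ltn_mod // -(@chart1_row (k %% w)) ?ltn_mod // iter_mod.
Qed.

Lemma chart1_roof j : j < w -> iter H v (iter (j + t) h a) = psi (flip3 l1 l2 l3 j, 0).
Proof.
case/and5P: (V) => ? ? ? ? ? jw; have [w0 Ew _] := chart1_order.
pose x := if j + t < w then j + t else j + t - w.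
have -> : iter (j + t) h a = iter x h a.
  rewrite /x; case: ltnP => // A; rewrite -{1}(subnK A) iterD Ew //.
have xw : x < w by rewrite /x; base_lia.
rewrite chart1_row // (chart_roof okB ch xw) /=; congr (psi (flip3 _ _ _ _, _)).
by rewrite /x; base_lia.
Qed.

Lemma chart1_twist : iter H v (iter t h a) = d.
Proof.
case/and5P: (V) => ? ? ? ? ?; rewrite -[t]add0n chart1_roof; last lia.
by congr (psi (_, _)); base_lia.
Qed.

Lemma chart1_height : is_height h v a H.
Proof.
case/and5P: (V) => ? ? ? ? ?; split=> // [|y k yh].
  exists t; rewrite chart1_twist chart1_cone ?eqxx ?orbT //; apply: chart1_cell0; lia.
have [j jw ->] := chart1_row_all k.
rewrite -(chart_base ch) /=; [|lia|lia].
by apply: (chart_regular okB ch) => //=; lia.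
Qed.

Lemma chart1_conn : sts_connected h v.
Proof.
case/and5P: (V) => ? ? ? ? ?; apply/connP => P Ph Pv.
have PhE x : P (h x) = P x by apply/idP/idP => [/(closed_back Ph)|/Ph].
have PvE x : P (v x) = P x by apply/idP/idP => [/(closed_back Pv)|/Pv].
have ih k x : P (iter k h x) = P x by elim: k => //= k <-; rewrite PhE.
have iv k x : P (iter k v x) = P x by elim: k => //= k <-; rewrite PvE.
have all i : P i = P a.
  have [[x y] /andP[/= X Y] <-] := ch_surj ch i.
  by rewrite (chart_base ch) ?iv // -chart1_row ?ih.
by move=> x y; rewrite !all.
Qed.

End Chart1.

Lemma chart1_params_uniq n (h v : {perm 'I_n}) l1 l2 l3 H t psi l1' l2' l3' H' t' psi' :
  valid1 l1 l2 l3 H t -> chart (base1 l1 l2 l3 H t) h v psi ->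
  valid1 l1' l2' l3' H' t' -> chart (base1 l1' l2' l3' H' t') h v psi' ->
  psi (0, 0) = psi' (0, 0) -> [/\ l1 = l1', l2 = l2', l3 = l3', H = H' & t = t'].
Proof.
move=> V ch V' ch' Ea.
have ca := chart1_ca V ch; have cb := chart1_cb V ch.
have ca' := chart1_ca V' ch'; have cb' := chart1_cb V' ch'.
have /and5P[? ? ? _ T] := V; have /and5P[? ? ? _ T'] := V'.
have O := chart1_order V ch; have O' := chart1_order V' ch'.
have Ew : l1 + l2 + l3 = l1' + l2' + l3' by apply: (is_order_uniq O); rewrite Ea.
have E3 : l3 = l3'.
  apply: (is_order_inj O); [lia|lia|rewrite (chart1_row V ch); last lia].
  by rewrite -ca Ea (chart1_row V' ch') ?ca' //; lia.
have E2 : l2 + l3 = l2' + l3'.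
  apply: (is_order_inj O); [lia|lia|rewrite (chart1_row V ch); last lia].
  by rewrite -cb -ca Ea (chart1_row V' ch') ?ca' ?cb' //; lia.
have EH : H = H'.
  by apply: (is_height_uniq (chart1_height V ch)); rewrite Ea; exact: (chart1_height V' ch').
split=> //; try lia.
apply: (is_order_inj O); [lia|lia|apply: (@iter_inj _ v H)].
by rewrite (chart1_twist V ch) Ea EH (chart1_twist V' ch') -cb' -ca' -Ea ca cb.
Qed.

(* If the same parameters could be read off from two of the three cone squares,
   then l1 = l2 = l3, and the two readings of the twist would disagree. *)
Lemma chart1_root_uniq n (h v : {perm 'I_n}) l1 l2 l3 H t psi psi' :
  valid1 l1 l2 l3 H t ->
  chart (base1 l1 l2 l3 H t) h v psi -> chart (base1 l1 l2 l3 H t) h v psi' ->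
  psi (0, 0) = psi' (0, 0).
Proof.
move=> V.
have step phi phi' : chart (base1 l1 l2 l3 H t) h v phi ->
    chart (base1 l1 l2 l3 H t) h v phi' -> phi' (0, 0) = vcycle h v (phi (0, 0)) -> False.
  move=> ch ch' Ea'.
  have /and5P[? ? ? _ T] := V.
  have O := chart1_order V ch; have [w0 Ew wmin] := O.
  have ca := chart1_ca V ch; have cb := chart1_cb V ch; have cd := chart1_cd V ch.
  have ca' := chart1_ca V ch'; have cb' := chart1_cb V ch'; have cd' := chart1_cd V ch'.
  have Eb' : phi' (l3, 0) = phi (l2 + l3, 0) by rewrite -ca' Ea' ca cb.
  have Ed' : phi' (l2 + l3, 0) = phi (0, 0) by rewrite -cb' Eb' cd.
  have r3 := chart1_row V ch' (j := l3) ltac:(lia).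
  rewrite Ea' ca Eb' in r3.
  have r2 := chart1_row V ch' (j := l2 + l3) ltac:(lia).
  rewrite Ea' ca Ed' in r2.
  rewrite -(chart1_row V ch (j := l3) ltac:(lia)) in r2 r3.
  rewrite -(chart1_row V ch (j := l2 + l3) ltac:(lia)) in r3.
  (* Both charts list the gaps between successive cone squares along the same row, starting one
     place apart, so the three gaps are equal. *)
  have E23 : l3 = l2.
    move: r3; rewrite [l2 + l3]addnC iterD => /iter_inj.
    by apply: (is_order_inj O); lia.
  move: r2; rewrite -iterD => r2.
  have E1 : l1 = l3.
    have [lt|lt|//] := ltngtP l1 l3; last first.
      by case: (wmin (l2 + l3 + l3)); first lia.
    move: r2; have -> : l2 + l3 + l3 = (l3 - l1) + (l1 + l2 + l3) by lia.
    by rewrite iterD Ew => r2; case: (wmin (l3 - l1)); first lia.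
  (* With equal lengths [flip3] keeps the middle interval in place, so the first chart finds b on
     the top where the second one requires a. *)
  have tw := chart1_twist V ch'; rewrite Ed' Ea' ca in tw.
  rewrite -(chart1_row V ch (j := l3)) in tw; last lia.
  move: tw; rewrite -iterD addnC (chart1_roof V ch); last lia.
  have -> : flip3 l1 l2 l3 l3 = l3 by base_lia.
  by move/(chart1_inj0 V ch); lia.
move=> ch ch'.
have Ca x : chart (base1 l1 l2 l3 H t) h v x -> cone h v (x (0, 0)).
  by move=> ?; rewrite (chart1_cone V) //; apply: (chart1_cell0 V); case/and5P: V; lia.
have [_ [_ _ cd] Kx] := cone_cycle (chart1_inH2 V ch) (Ca _ ch).
case/Kx: (Ca _ ch') => // E; first by case: (step _ _ ch ch').
by case: (step _ _ ch' ch); rewrite E cd.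
Qed.

(** In a one-cylinder chart all cone squares lie in the row of the origin, while a two-cylinder
    chart has one that is alone in its row. *)
Lemma chart1_not_chart2 n (h v : {perm 'I_n}) l1 l2 l3 H t psi w1 w2 h1 h2 t1 t2 psi' :
  valid1 l1 l2 l3 H t -> chart (base1 l1 l2 l3 H t) h v psi ->
  valid2 w1 w2 h1 h2 t1 t2 -> chart (base2 w1 w2 h1 h2 t1 t2) h v psi' -> False.
Proof.
move=> V ch V' ch'.
have /and5P[? ? ? _ T] := V; have /and5P[? ? ? ? /andP[? ?]] := V'.
have [i iw Ei] : exists2 i, i < l1 + l2 + l3 & psi (i, 0) = psi' (0, 0).
  have C : cone h v (psi' (0, 0)).
    by rewrite (chart2_cone V' ch') //; apply: (chart2_cell0 V'); lia.
  have [[x y] Hp E] := ch_surj ch (psi' (0, 0)).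
  move: C; rewrite -E (chart1_cone V ch) // => /andP[/eqP y0 _].
  by exists x; [case/andP: Hp|rewrite y0].
have [j jw Ej] : exists2 j, j < l1 + l2 + l3 & psi (j, 0) = psi' (w1, 0).
  have C : cone h v (psi' (w1, 0)).
    by rewrite (chart2_cone V' ch') ?eqxx ?orbT //; apply: (chart2_cell0 V'); lia.
  have [[x y] Hp E] := ch_surj ch (psi' (w1, 0)).
  move: C; rewrite -E (chart1_cone V ch) // => /andP[/eqP y0 _].
  by exists x; [case/andP: Hp|rewrite y0].
rewrite -(chart1_row V ch) // in Ei; rewrite -(chart1_row V ch) // in Ej.
have [m Em] := iter_back h i (psi (0, 0)).
have := chart2_alone V' ch' (k := j + m).
rewrite -Ei iterD Em Ej Ei => A.
have : psi' (w1, 0) = psi' (0, 0).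
  by apply: A; rewrite (chart2_cone V' ch') ?eqxx ?orbT //; apply: (chart2_cell0 V'); lia.
by move/(chart2_inj0 V' ch'); lia.
Qed.

(** * Weierstrass points *)

Lemma chart_comp B n (h v g : {perm 'I_n}) psi :
  (forall x, g (h x) = h (g x)) -> (forall x, g (v x) = v (g x)) ->
  chart B h v psi -> chart B h v (fun p => g (psi p)).
Proof.
move=> gh gv ch; split.
- by move=> p q Hp Hq /perm_inj; exact: (ch_inj ch).
- move=> i; have [p Hp E] := ch_surj ch ((g^-1)%g i).
  by exists p => //; rewrite E permKV.
- by move=> p Hp; rewrite -gh (ch_h ch).
- by move=> p Hp; rewrite -gv (ch_v ch).
Qed.

Lemma commute_fix_id n (h v g : {perm 'I_n}) x : sts_connected h v ->
  (forall x, g (h x) = h (g x)) -> (forall x, g (v x) = v (g x)) ->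
  g x = x -> forall y, g y = y.
Proof.
move=> /connP conn gh gv gx y; apply/eqP.
by apply: (conn (fun z => g z == z) _ _ x); rewrite ?gx // => z /eqP E; rewrite ?gh ?gv E.
Qed.

(** The absence of translation automorphisms makes -Id unique, so that the existential definitions
    of the two types exclude each other. *)
Definition rigid n (h v : {perm 'I_n}) := forall g : {perm 'I_n},
  (forall x, g (h x) = h (g x)) -> (forall x, g (v x) = v (g x)) -> forall x, g x = x.

Lemma chart2_rigid w1 w2 h1 h2 t1 t2 n (h v : {perm 'I_n}) psi :
  valid2 w1 w2 h1 h2 t1 t2 -> chart (base2 w1 w2 h1 h2 t1 t2) h v psi -> rigid h v.
Proof.
move=> V ch g gh gv; apply: (commute_fix_id (x := psi (0, 0)) (chart2_conn V ch) gh gv).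
by have [[<-]] := chart2_uniq V ch V (chart_comp gh gv ch).
Qed.

Lemma chart1_rigid l1 l2 l3 H t n (h v : {perm 'I_n}) psi :
  valid1 l1 l2 l3 H t -> chart (base1 l1 l2 l3 H t) h v psi -> rigid h v.
Proof.
move=> V ch g gh gv; apply: (commute_fix_id (x := psi (0, 0)) (chart1_conn V ch) gh gv).
by rewrite -(chart1_root_uniq V ch (chart_comp gh gv ch)).
Qed.

Lemma minus_idP n (h v sg : {perm 'I_n}) :
  reflect [/\ forall x, h (sg (h x)) = sg x, forall x, v (sg (v x)) = sg x &
              forall x, sg (sg x) = x] (minus_id h v sg).
Proof.
apply: (iffP forallP) => [F|[Fh Fv Fs] x].
  by split=> x; have /andP[/andP[/eqP Eh /eqP Ev] /eqP Es] := F x;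
    rewrite ?Eh ?Ev ?permKV.
have -> : (h^-1)%g (sg x) = sg (h x) by rewrite -(Fh x) permK.
have -> : (v^-1)%g (sg x) = sg (v x) by rewrite -(Fv x) permK.
by rewrite Fs !eqxx.
Qed.

Lemma minus_id_uniq n (h v sg sg' : {perm 'I_n}) : rigid h v ->
  minus_id h v sg -> minus_id h v sg' -> sg = sg'.
Proof.
move=> R /minus_idP[Eh Ev Es] /minus_idP[Eh' Ev' Es'].
have gg : forall x, (sg' * sg)%g x = x.
  apply: R => x; rewrite !permM.
    by rewrite -[in RHS](Eh' x) Eh.
  by rewrite -[in RHS](Ev' x) Ev.
by apply/permP=> x; have := gg (sg' x); rewrite permM Es' => ->.
Qed.

(* The corner of the cone squares is fixed by -Id; the other corners correspond
   to the squares that are not cone squares. *)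
Lemma n_int_weierstrassE n (h v sg : {perm 'I_n}) : inH2 h v -> minus_id h v sg ->
  n_int_weierstrass h v sg = (#|[set x | ~~ cone h v x && (v (h (sg x)) == x)]|).+1.
Proof.
move=> H2 /minus_idP[Eh Ev Es]; have [c3 card3] := inH2P _ _ H2.
set c := vcycle h v in c3 *; set A := [set x | _ && _].
pose m x := v (h (sg x)).
(* [m] is -Id acting on bottom-left corners; it preserves orientation, hence commutes with turning
   around a vertex. *)
have mc x : m (c x) = c (m x).
  rewrite /c -[x](permKV h) -[(h^-1)%g x](permKV v) vcycleE /m.
  move: ((v^-1)%g _) => z.
  have -> : sg (h (v z)) = (h^-1)%g (sg (v z)) by rewrite -(Eh (v z)) permK.
  have -> : sg (v (h z)) = (v^-1)%g (sg (h z)) by rewrite -(Ev (h z)) permK.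
  by rewrite -[LHS](vcycleE h v) -/c !permKV Eh Ev.
have porbit1 x : ~~ cone h v x -> porbit c x = [set x].
  rewrite negbK => /eqP cx; apply/setP=> y; rewrite inE.
  apply/porbitP/eqP => [[i ->]|->]; last by exists 0; rewrite expg0 perm1.
  by rewrite permX; elim: i => //= i ->.
have [k Ck] : exists k, cone h v k.
  have /card_gt0P[k] : 0 < #|[set x | cone h v x]| by rewrite card3.
  by rewrite inE; exists k.
have [_ [Cb Cd cd] Kx] := cone_cycle H2 Ck; rewrite -/c in Cb Cd cd Kx.
have inK x : cone h v x -> porbit c x = porbit c k.
  move=> /Kx[] -> //; apply/eqP; rewrite eq_porbit_mem.
    by have := mem_porbit c 1 k; rewrite expg1.
  by have := mem_porbit c 2 k; rewrite permX.
have -> : n_int_weierstrass h v sg = #|porbit c k |: [set [set x] | x in A]|.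
  congr (#|pred_of_set _|); apply/setP=> S; rewrite !inE; apply/imsetP/orP => [[x]|].
    rewrite inE -/c -/(m x) => mx ->; have [Cx|Cx] := boolP (cone h v x).
      by left; rewrite inK.
    right; apply/imsetP; exists x; last exact: porbit1.
    by rewrite inE Cx; move: mx; rewrite (porbit1 x Cx) inE.
  case=> [/eqP ->|/imsetP[x]].
    exists k => //; rewrite inE -/c -/(m k).
    have : cone h v (m k).
      by rewrite /cone -/c -mc; apply: contra Ck => /eqP/perm_inj/perm_inj/perm_inj ->.
    by move/inK => <-; exact: porbit_id.
  rewrite inE => /andP[Cx /eqP mx] ->; exists x; last by rewrite porbit1.
  by rewrite inE mx; exact: porbit_id.
rewrite cardsU1 card_imset; last exact: set1_inj.
case: imsetP => // -[x]; rewrite inE => /andP[Cx _] /setP/(_ k).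
by rewrite porbit_id inE => /esym/eqP E; rewrite -E Ck in Cx.
Qed.

Section Involution.
Variables (B : base) (n : nat) (h v : {perm 'I_n}) (psi : nat * nat -> 'I_n).
Hypotheses (okB : base_ok B) (ch : chart B h v psi).
Variable s : nat -> nat.
Hypotheses (s_lt : forall x, x < bW B -> s x < bW B)
  (s_s : forall x, x < bW B -> s (s x) = x)
  (s_H : forall x, x < bW B -> bH B (s x) = bH B x)
  (s_r : forall x, x < bW B -> br B (s (br B x)) = s x)
  (s_G : forall x, x < bW B -> bG B (s (bG B x)) = s x).

(** -Id puts the tower over x upside down on the place of the tower over [s x]; [s_r] and [s_G] are
    what makes it reverse [h] and, across the roofs, [v]. *)
Definition sgN p := (s p.1, bH B p.1 - 1 - p.2).

Lemma sgN_cell p : p \in cell B -> sgN p \in cell B.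
Proof. by case/andP=> X Y; rewrite !inE /= s_lt // s_H //; lia. Qed.

Lemma minus_id_exists : exists2 sg : {perm 'I_n}, minus_id h v sg &
  forall p, p \in cell B -> sg (psi p) = psi (sgN p).
Proof.
have [phi [phi_cell phiK psiK]] := chart_coordinates ch.
pose f i := psi (sgN (phi i)).
have fE p : p \in cell B -> f (psi p) = psi (sgN p).
  by move=> Hp; rewrite /f psiK.
have sgNK p : p \in cell B -> sgN (sgN p) = p.
  case: p => x y /andP[/= X Y]; rewrite /sgN /= s_s // s_H //.
  by congr pair; lia.
have ff : involutive f.
  by move=> i; rewrite -(phiK i) !fE ?sgN_cell // sgNK.
exists (perm (inv_inj ff)); last by move=> p Hp; rewrite permE fE.
apply/minus_idP; split=> i; rewrite ?permE ?ff //.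
  rewrite -(phiK i); case: (phi i) (phi_cell i) => x y Hp; case/andP: (Hp) => /= X Y.
  rewrite (ch_h ch Hp) !fE ?hN_cell // (ch_h ch) ?sgN_cell ?hN_cell //.
  by rewrite /hN /sgN /= s_r // bH_br.
rewrite -(phiK i); case: (phi i) (phi_cell i) => x y Hp; case/andP: (Hp) => /= X Y.
rewrite (ch_v ch Hp) !fE ?vN_cell // (ch_v ch) ?sgN_cell ?vN_cell //.
rewrite /vN /sgN /=; case: (ltnP y.+1 (bH B x)) => A /=.
  by rewrite s_H //; case: ltnP => A'; [congr (psi (_, _))|]; lia.
have HG := bH_gt0 okB (bG_lt okB X).
rewrite s_H ?bG_lt //; case: ltnP => A'; first lia.
by rewrite s_G //; congr (psi (_, _)); lia.
Qed.

(** A fixed corner above the bottom row lies halfway up its tower. For a corner of the bottom row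
    the image is reached across a roof, whence [bG]. *)
Definition fixedN p :=
  if p.2 == 0 then bG B (br B (s p.1)) == p.1
  else (br B (s p.1) == p.1) && (bH B p.1 == p.2 + p.2).

Lemma n_int_chart sg : inH2 h v -> minus_id h v sg ->
  (forall p, p \in cell B -> sg (psi p) = psi (sgN p)) ->
  n_int_weierstrass h v sg =
  (count (fun p => ~~ cone h v (psi p) && fixedN p) (cells B)).+1.
Proof.
move=> H2 sgP sgE; rewrite n_int_weierstrassE // (chart_card ch); congr _.+1.
apply: eq_in_count => p; rewrite mem_cells => Hp; congr andb.
rewrite sgE // (ch_h ch) ?sgN_cell // (ch_v ch) ?hN_cell ?sgN_cell //.
have -> : (psi (vN B (hN B (sgN p))) == psi p) = (vN B (hN B (sgN p)) == p).
  apply/eqP/eqP => [|-> //]; apply: (ch_inj ch) => //.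
  by rewrite vN_cell ?hN_cell ?sgN_cell.
case: p Hp => x y /andP[/= X Y]; rewrite /vN /hN /sgN /fixedN /= bH_br ?s_lt // s_H //.
have H0 := bH_gt0 okB X.
have [->|y0] := eqVneq y 0.
  by rewrite subn0 subn1 prednK // ltnn xpair_eqE eqxx andbT.
have -> : (bH B x - 1 - y).+1 < bH B x by lia.
by rewrite xpair_eqE; congr andb; lia.
Qed.

End Involution.

Lemma count_eq_size (T : eqType) (P : pred T) (s t : seq T) : uniq s -> uniq t ->
  {subset t <= s} -> (forall x, x \in s -> P x = (x \in t)) ->
  count P s = size t.
Proof.
move=> us ut ts E; rewrite -size_filter; apply/perm_size/uniq_perm => //.
  exact: filter_uniq.
move=> x; rewrite mem_filter; apply/andP/idP => [[Px xs]|xt].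
  by move: Px; rewrite E.
by rewrite E ?ts.
Qed.

Lemma count_two (T : eqType) (P : pred T) (s : seq T) p q : uniq s ->
  p \in s -> q \in s -> p != q -> P p -> P q ->
  (forall x, x \in s -> P x -> x = p \/ x = q) -> count P s = 2.
Proof.
move=> us ps qs pq Pp Pq E; apply: (@count_eq_size _ _ _ [:: p; q]) => //.
- by rewrite /= inE pq.
- by move=> x; rewrite !inE => /orP[] /eqP ->.
move=> x xs; rewrite !inE; apply/idP/orP => [Px|[] /eqP -> //].
by case: (E x xs Px) => ->; rewrite eqxx; [left|right].
Qed.

Definition type_of n (h v : {perm 'I_n}) (bB : bool) :=
  typeA h v = ~~ bB /\ typeB h v = bB.

Lemma type_of_count n (h v sg : {perm 'I_n}) (bB : bool) : rigid h v ->
  minus_id h v sg -> n_int_weierstrass h v sg = (if bB then 3 else 1) ->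
  type_of h v bB.
Proof.
move=> R sgP E; split.
  apply/existsP/idP => [[sg' /andP[sgP' /eqP E']]|].
    by rewrite (minus_id_uniq R sgP' sgP) E in E'; case: (bB) E'.
  by exists sg; rewrite sgP E; case: (bB) H.
apply/existsP/idP => [[sg' /andP[sgP' /eqP E']]|].
  by rewrite (minus_id_uniq R sgP' sgP) E in E'; case: (bB) E'.
by exists sg; rewrite sgP E; case: (bB) H.
Qed.

(* Two Weierstrass points other than the cone point have integer coordinates. *)
Definition is_typeB2 w1 w2 h1 h2 t1 t2 :=
  [|| odd w1 && odd w2, [&& ~~ odd w1, ~~ odd h1 & ~~ odd t1] |
      [&& ~~ odd w2, ~~ odd h2 & odd t2]].

(** Top coordinate of the image under -Id of the bottom square x. Each interval is reversed in
    place; the gluing [swap2] then exchanges the two saddle connections of length w1 and preserves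
    the third. *)
Definition flip2 w1 w2 x :=
  if x < w1 then w1 - 1 - x
  else if x < w1 + w1 then w1 + w1 + w1 - 1 - x else w1 + w1 + w1 + w2 - 1 - x.

(* The Weierstrass points with integer coordinates other than the cone point. *)
Definition weier2 w1 w2 h1 h2 t1 t2 (p : nat * nat) :=
  let: (x, y) := p in
  if y == 0 then (w1 <= x) && (x + x == w1 + w1 + w1 + w2)
  else if x < w1 then (h1 == y + y) && ((x + x == t1) || (x + x == t1 + w1))
  else (h2 == y + y) && [|| x + x == t2 + w1 + w1 + w1,
     x + x == t2 + w1 + w1 + w1 + w2 | x + x + w2 == t2 + w1 + w1 + w1].

Lemma size_cells2 w1 w2 h1 h2 t1 t2 :
  size (cells (base2 w1 w2 h1 h2 t1 t2)) = w1 * h1 + w2 * h2.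
Proof.
rewrite size_cells /= (big_cat_nat (n := w1)) //= ?leq_addr //; congr (_ + _).
  rewrite big_mkord (eq_bigr (fun=> h1)) ?sum_nat_const ?card_ord // => i _.
  by rewrite ltn_ord.
rewrite -{1}[w1]add0n big_addn addKn big_mkord (eq_bigr (fun=> h2)) => [|i _].
  by rewrite sum_nat_const card_ord.
by rewrite ltnNge leq_addl.
Qed.

(** Besides the cone point, -Id fixes the middle of the saddle connection of length w2 - w1 and, in
    each cylinder, two points at half height that are half a turn apart. If both widths are odd,
    that middle is integral and so is exactly one point of the cylinder of even height. Otherwise
    only the cylinder of even width can contribute, both of its points or none. *)
Lemma weier2_count w1 w2 h1 h2 t1 t2 :
  valid2 w1 w2 h1 h2 t1 t2 -> odd (w1 * h1 + w2 * h2) ->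
  count (weier2 w1 w2 h1 h2 t1 t2) (cells (base2 w1 w2 h1 h2 t1 t2)) =
  if is_typeB2 w1 w2 h1 h2 t1 t2 then 2 else 0.
Proof.
move=> V; rewrite oddD !oddM /is_typeB2 => par.
have /and5P[? ? ? ? /andP[? ?]] := V.
have two x1 y1 x2 y2 : x1 < w1 + w2 -> y1 < (if x1 < w1 then h1 else h2) ->
    x2 < w1 + w2 -> y2 < (if x2 < w1 then h1 else h2) -> (x1 <> x2) \/ (y1 <> y2) ->
    weier2 w1 w2 h1 h2 t1 t2 (x1, y1) -> weier2 w1 w2 h1 h2 t1 t2 (x2, y2) ->
    (forall x y, x < w1 + w2 -> y < (if x < w1 then h1 else h2) ->
      weier2 w1 w2 h1 h2 t1 t2 (x, y) -> (x = x1 /\ y = y1) \/ (x = x2 /\ y = y2)) ->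
    count (weier2 w1 w2 h1 h2 t1 t2) (cells (base2 w1 w2 h1 h2 t1 t2)) = 2.
  move=> X1 Y1 X2 Y2 ne p1 p2 E.
  apply: (@count_two _ _ _ (x1, y1) (x2, y2)); rewrite ?cells_uniq ?mem_cells //.
  - by rewrite !inE /= X1.
  - by rewrite !inE /= X2.
  - by rewrite xpair_eqE; apply/negP => /andP[/eqP ? /eqP ?]; case: ne.
  move=> [x y]; rewrite mem_cells => /andP[/= X Y] W.
  by case: (E x y X Y W) => -[-> ->]; [left|right].
case: ifP => tB; last first.
  apply/eqP; rewrite eqn0Ngt -has_count; apply/hasPn=> -[x y].
  rewrite mem_cells => /andP[/= xW yH]; rewrite /weier2.
  by move: yH; case: (ltnP x w1) => A yH; case: (eqVneq y 0) => B; lia.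
have half k : ~~ odd k -> exists m, m + m = k by exists (k./2); lia.
have row2 : ~~ odd (w1 + t2) \/ odd w2 -> exists m, [/\ w1 <= m, m < w1 + w2 &
    m + m = t2 + w1 + w1 + w1 \/ m + m = t2 + w1 + w1 + w1 + w2 \/
        m + m + w2 = t2 + w1 + w1 + w1].
  move=> alt; have [o|o] := boolP (odd (w1 + t2)); last first.
    have [m Em] := half (w1 + t2 + w1 + w1) ltac:(lia).
    by exists m; split; [lia|lia|lia].
  have o2 : odd w2 by case: alt => //; rewrite o.
  have [lt|le] := ltnP (w1 + t2) w2.
    have [m Em] := half (w1 + t2 + w1 + w1 + w2) ltac:(lia).
    by exists m; split; [lia|lia|lia].
  have [m Em] := half (w1 + t2 + w1 + w1 - w2) ltac:(lia).
  by exists m; split; [lia|lia|lia].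
have [o1|o1] := boolP (odd w1); have [o2|o2] := boolP (odd w2); last lia.
- have [x0 Ex0] := half (w1 + w1 + w1 + w2) ltac:(lia).
  have [o3|o3] := boolP (odd h1).
    have [y0 Ey0] := half h2 ltac:(lia).
    have [m [Am Bm Em]] := row2 (or_intror o2).
    clear par tB o1.
    apply: (two x0 0 m y0); rewrite /weier2; first [lia | split_ifs; lia | idtac].
    by move=> x y X Y; case: (eqVneq y 0) => C; case: (ltnP x w1) Y => D Y; lia.
  have [y0 Ey0] := half h1 ltac:(lia).
  have [z [zw Ez]] : exists z, z < w1 /\ (z + z = t1 \/ z + z = t1 + w1).
    have [o4|o4] := boolP (odd t1).
      by have [z Ez] := half (t1 + w1) ltac:(lia); exists z; split; lia.
    by have [z Ez] := half t1 o4; exists z; split; lia.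
  have o4 : odd h2 by lia.
  clear par tB o2.
  apply: (two x0 0 z y0); rewrite /weier2; first [lia | split_ifs; lia | idtac].
  by move=> x y X Y; case: (eqVneq y 0) => C; case: (ltnP x w1) Y => D Y; lia.
- have [y0 Ey0] := half h2 ltac:(lia).
  have [m1 Em1] := half (w1 + t2 + w1 + w1) ltac:(lia).
  have [m2 [Am2 Em2]] : exists m, w1 <= m /\ (w1 + t2 < w2 /\ m + m = t2 + w1 + w1 + w1 + w2 \/
      w2 <= w1 + t2 /\ m + m + w2 = t2 + w1 + w1 + w1).
    have [lt|le] := ltnP (w1 + t2) w2.
      have [m Em] := half (w1 + t2 + w1 + w1 + w2) ltac:(lia).
      by exists m; split; lia.
    have [m Em] := half (w1 + t2 + w1 + w1 - w2) ltac:(lia).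
    by exists m; split; lia.
  have o3 : odd h1 by lia.
  have o4 : odd (w1 + w2) by lia.
  clear par tB o1 o2.
  apply: (two m1 y0 m2 y0); rewrite /weier2; first [lia | split_ifs; lia | idtac].
  by move=> x y X Y; case: (eqVneq y 0) => C; case: (ltnP x w1) Y => D Y; lia.
have [y0 Ey0] := half h1 ltac:(lia).
have [z1 Ez1] := half t1 ltac:(lia).
have [z2 Ez2] := half (t1 + w1) ltac:(lia).
have o3 : odd h2 by lia.
have o4 : odd (w1 + w2) by lia.
clear par tB o1 o2.
apply: (two z1 y0 z2 y0); rewrite /weier2; first [lia | split_ifs; lia | idtac].
by move=> x y X Y; case: (eqVneq y 0) => C; case: (ltnP x w1) Y => D Y; lia.
Qed.

Ltac prune_lia := repeat match goal with
  |- context [if ?b then _ else _] =>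
    lazymatch b with context [if _ then _ else _] => fail
    | _ => case: (boolP b) => ?; first [exfalso; lia | idtac] end
  end; lia.

Lemma chart2_type w1 w2 h1 h2 t1 t2 n (h v : {perm 'I_n}) psi : odd n ->
  valid2 w1 w2 h1 h2 t1 t2 -> chart (base2 w1 w2 h1 h2 t1 t2) h v psi ->
  type_of h v (is_typeB2 w1 w2 h1 h2 t1 t2).
Proof.
move=> n_odd V ch; have okB := base2_ok V.
have /and5P[? ? ? ? /andP[? ?]] := V.
pose unshift := shift2 w1 w2 (w1 - t1) (w2 - t2).
pose s x := unshift (flip2 w1 w2 x).
have s_lt x : x < w1 + w2 -> s x < w1 + w2 by rewrite /s /unshift /flip2; base_lia.
have s_s x : x < w1 + w2 -> s (s x) = x.
  move=> xW; have E : flip2 w1 w2 (unshift (flip2 w1 w2 x)) = shift2 w1 w2 t1 t2 x.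
    by move: xW; rewrite /unshift /flip2; base_lia.
  by rewrite /s E /unshift; move: xW {E}; base_lia.
have s_H x : x < w1 + w2 -> (if s x < w1 then h1 else h2) = (if x < w1 then h1 else h2).
  by move=> xW; have -> : (s x < w1) = (x < w1) by move: xW; rewrite /s /unshift /flip2; base_lia.
have rs x : x < w1 + w2 -> rot2 w1 w2 (s x) = unshift (rot2 w1 w2 (flip2 w1 w2 x)).
  move=> xW; have zW : flip2 w1 w2 x < w1 + w2 by move: xW; rewrite /flip2; base_lia.
  by rewrite /s; move: (flip2 w1 w2 x) zW => z; rewrite /unshift; base_lia.
have Gun x : x < w1 + w2 -> shift2 w1 w2 t1 t2 (unshift x) = x.
  by rewrite /unshift; base_lia.
have s_r x : x < w1 + w2 -> rot2 w1 w2 (s (rot2 w1 w2 x)) = s x.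
  move=> xW; rewrite rs; last by move: xW; base_lia.
  by congr unshift; move: xW; rewrite /flip2; base_lia.
have s_G x : x < w1 + w2 ->
    swap2 w1 (shift2 w1 w2 t1 t2 (s (swap2 w1 (shift2 w1 w2 t1 t2 x)))) = s x.
  move=> xW; rewrite Gun; last by move: xW; rewrite /flip2; base_lia.
  have : shift2 w1 w2 t1 t2 x < w1 + w2 by move: xW; base_lia.
  have -> : s x = flip2 w1 w2 (shift2 w1 w2 t1 t2 x).
    case: (ltnP x w1) => A; rewrite /s /unshift /flip2.
      rewrite A; rewrite /shift2 A; have -> : w1 - 1 - x < w1 by lia.
      by case: (ltnP x t1) => C; base_lia.
    have -> : (x < w1) = false by lia.
    rewrite {2}/shift2; have -> : (x < w1) = false by lia.
    case: (ltnP x (w1 + t2)) => C; rewrite /shift2; case: (ltnP x (w1 + w1)) => D; prune_lia.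
  by move: (shift2 w1 w2 t1 t2 x) => z; rewrite /flip2; base_lia.
have [sg sgP sgE] := minus_id_exists okB ch s_lt s_s s_H s_r s_G.
apply: (type_of_count (chart2_rigid V ch) sgP).
rewrite (n_int_chart okB ch s_lt s_H (chart2_inH2 V ch) sgP sgE).
rewrite (eq_in_count (a2 := weier2 w1 w2 h1 h2 t1 t2)) => [|[x y]].
  rewrite weier2_count //; first by case: ifP.
  by rewrite -(size_cells2 _ _ _ _ t1 t2) (chart_size ch).
rewrite mem_cells => Hp; rewrite (chart2_cone V ch Hp) /fixedN /weier2 /=.
move: Hp => /andP[/= xW _]; rewrite rs //.
have [_|_] := eqVneq y 0.
  rewrite Gun; last by move: xW; rewrite /flip2; base_lia.
  by move: xW; rewrite /flip2; base_lia.
rewrite andTb.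
have -> : (unshift (rot2 w1 w2 (flip2 w1 w2 x)) == x) = (if x < w1 then
   (x + x == t1) || (x + x == t1 + w1) else [|| x + x == t2 + w1 + w1 + w1,
     x + x == t2 + w1 + w1 + w1 + w2 | x + x + w2 == t2 + w1 + w1 + w1]).
  have -> : rot2 w1 w2 (flip2 w1 w2 x) = if x < w1 then (if x == 0 then 0 else w1 - x)
      else if x <= w1 + w1 then w1 + w1 + w1 - x else w1 + w1 + w1 + w2 - x.
    by move: xW; rewrite /flip2; base_lia.
  by rewrite /unshift; move: xW; base_lia.
by case: ifP => _; rewrite andbC.
Qed.

(** For height 1 and an odd circumference, the integral Weierstrass points other than the cone point
    are the midpoints of the saddle connections of even length, and there are none or two of
    these. *)
Definition is_typeB1 l1 l2 l3 := ~~ [&& odd l1, odd l2 & odd l3].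

Lemma size_cells1 l1 l2 l3 H t :
  size (cells (base1 l1 l2 l3 H t)) = (l1 + l2 + l3) * H.
Proof. by rewrite size_cells /= sum_nat_const_nat subn0. Qed.

(** The midpoints of the three saddle connections, which follow each other on the bottom in the
    order l3, l2, l1. *)
Definition weier1 l1 l2 l3 (p : nat * nat) := let x := p.1 in
  [|| x + x == l3, x + x == l2 + l3 + l3 | x + x == l1 + l2 + l3 + l2 + l3].

Lemma chart1_type l1 l2 l3 t n (h v : {perm 'I_n}) psi : odd n ->
  valid1 l1 l2 l3 1 t -> chart (base1 l1 l2 l3 1 t) h v psi ->
  type_of h v (is_typeB1 l1 l2 l3).
Proof.
move=> n_odd V ch; have okB := base1_ok V.
have /and5P[? ? ? _ ?] := V.
pose w := l1 + l2 + l3.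
have par : odd w.
  by move: n_odd; rewrite -(chart_size ch) size_cells1 muln1.
pose unshift := shift1 w (w - t).
pose s x := unshift (w - 1 - x).
have s_lt x : x < w -> s x < w by rewrite /s /unshift /w; base_lia.
have s_s x : x < w -> s (s x) = x by rewrite /s /unshift /w; base_lia.
have s_H x : x < w -> 1 = 1 by [].
have Gun x : x < w -> shift1 w t (unshift x) = x by rewrite /unshift /w; base_lia.
have rs x : x < w -> rot1 w (s x) = unshift (rot1 w (w - 1 - x)).
  by rewrite /s /unshift /w; base_lia.
have s_r x : x < w -> rot1 w (s (rot1 w x)) = s x.
  by rewrite /s /unshift /w; base_lia.
have s_G x : x < w ->
    flip3 l1 l2 l3 (shift1 w t (s (flip3 l1 l2 l3 (shift1 w t x)))) = s x.
  move=> xW; rewrite Gun; last by move: xW; rewrite /w; base_lia.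
  have : shift1 w t x < w by move: xW; rewrite /w; base_lia.
  have -> : s x = w - 1 - shift1 w t x by move: xW; rewrite /s /unshift /w; base_lia.
  by move: (shift1 w t x) => z; rewrite /w; base_lia.
have [sg sgP sgE] := minus_id_exists okB ch s_lt s_s s_H s_r s_G.
apply: (type_of_count (chart1_rigid V ch) sgP).
rewrite (n_int_chart okB ch s_lt s_H (chart1_inH2 V ch) sgP sgE).
rewrite (eq_in_count (a2 := weier1 l1 l2 l3)) => [|[x y]]; last first.
  rewrite mem_cells => Hp; rewrite (chart1_cone V ch Hp) /fixedN /weier1 /=.
  move: Hp => /andP[/= xW]; case: y => // _; rewrite eqxx rs // Gun; last first.
    by move: xW; rewrite /w; base_lia.
  by move: xW; rewrite /w; base_lia.
have two p q : p < w -> q < w -> p != q ->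
    (forall x, x < w -> weier1 l1 l2 l3 (x, 0) = (x == p) || (x == q)) ->
    count (weier1 l1 l2 l3) (cells (base1 l1 l2 l3 1 t)) = 2.
  move=> pc qc pq E; apply: (@count_two _ _ _ (p, 0) (q, 0)); rewrite ?cells_uniq ?mem_cells //.
  - by rewrite !inE /= -/w pc.
  - by rewrite !inE /= -/w qc.
  - by rewrite xpair_eqE eqxx andbT.
  - by rewrite E // eqxx.
  - by rewrite E // eqxx orbT.
  move=> [x y]; rewrite mem_cells => /andP[/= xW]; case: y => // _.
  by rewrite E // => /orP[] /eqP ->; [left|right].
rewrite /is_typeB1; case: ifP => tB; congr _.+1; last first.
  apply/eqP; rewrite eqn0Ngt -has_count; apply/hasPn=> -[x y] _.
  by rewrite /weier1 /=; lia.
have [o1|o1] := boolP (odd l1); rewrite /w in par.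
  by apply: (two (l3./2) ((l2 + l3 + l3)./2)); rewrite ?/weier1 /w /=; lia.
have [o2|o2] := boolP (odd l2).
  by apply: (two (l3./2) ((l1 + l2 + l3 + l2 + l3)./2)); rewrite ?/weier1 /w /=; lia.
by apply: (two ((l2 + l3 + l3)./2) ((l1 + l2 + l3 + l2 + l3)./2)); rewrite ?/weier1 /w /=; lia.
Qed.

(** * Periods *)

(** [F] unfolds a block of a by b squares into the plane; the walk stays in the block and ends in
    its last square. *)
Lemma seg_walk_run n (hs vs : 'I_n -> 'I_n) a b (F : nat -> nat -> 'I_n) :
  (forall i j, i.+1 < a -> j < b -> hs (F i j) = F i.+1 j) ->
  (forall i j, i < a -> j.+1 < b -> vs (F i j) = F i j.+1) ->
  forall fuel i j, fuel + i + j + 2 = a + b -> i < a -> j < b ->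
  seg_walk hs vs a b fuel i j (F i j) = F a.-1 b.-1.
Proof.
move=> Fh Fv; elim=> [|fuel IH] i j /= E ia jb.
  by congr F; lia.
case: ltnP => A.
  have ia' : i.+1 < a by nia.
  by rewrite Fh // IH //; lia.
(* If j.+1 were b, then [A] would give a <= i.+1, and the walk would be at the last square with fuel
   left. *)
have jb' : j.+1 < b by nia.
by rewrite Fv // IH //; lia.
Qed.

(** * Potentials, which obstruct primitivity *)

Section Potential.
Local Open Scope ring_scope.
Variables (R : comNzRingType) (n : nat) (h v : {perm 'I_n}) (f : 'I_n -> R) (al be : R).
Hypotheses (fh : forall x, f (h x) = f x + al) (fv : forall x, f (v x) = f x + be).

(** Whatever the order of the crossings, a.-1 of them are horizontal and b.-1 vertical. In the axis
    directions a + b - 2 is truncated to 0, which is the right number of steps. *)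
Lemma potential_walk (hs vs : 'I_n -> 'I_n) al' be' a b t :
  (forall x, f (hs x) = f x + al') -> (forall x, f (vs x) = f x + be') ->
  ((0 < a) && (0 < b) || (a + b == 1))%N ->
  f (seg_walk hs vs a b (a + b - 2) 0 0 t) = f t + al' * a.-1%:R + be' * b.-1%:R.
Proof.
move=> Hh Hv /orP[/andP[a0 b0]|]; last first.
  case: a b => [|[|a]] [|[|b]] // _; rewrite /= ?mulr0 ?addr0 //.
suff aux fuel i j u : (fuel + i + j + 2 = a + b)%N -> (i < a)%N -> (j < b)%N ->
    f (seg_walk hs vs a b fuel i j u) = f u + al' * (a.-1 - i)%:R + be' * (b.-1 - j)%:R.
  by rewrite aux ?subn0 //; lia.
elim: fuel i j u => [|fuel IH] i j u /= E ia jb.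
  have -> : (a.-1 - i = 0)%N by lia.
  have -> : (b.-1 - j = 0)%N by lia.
  by rewrite !mulr0 !addr0.
case: ltnP => A.
  have ia' : (i.+1 < a)%N by nia.
  rewrite IH ?Hh //; last lia.
  have -> : (a.-1 - i = (a.-1 - i.+1).+1)%N by lia.
  by rewrite -[in RHS]natr1; ring.
have jb' : (j.+1 < b)%N by nia.
rewrite IH ?Hv //; last lia.
have -> : (b.-1 - j = (b.-1 - j.+1).+1)%N by lia.
by rewrite -[in RHS]natr1; ring.
Qed.

Lemma potential_piece p q s : gcdn `|p| `|q| = 1%N ->
  f (seg_piece h v p q s) = f s + al * p%:~R + be * q%:~R.
Proof.
move=> pq1.
have fh' x : f ((h^-1)%g x) = f x - al by rewrite -{2}[x](permKV h) fh addrK.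
have fv' x : f ((v^-1)%g x) = f x - be by rewrite -{2}[x](permKV v) fv addrK.
have Hh x : f (if 0 < p then h x else (h^-1)%g x) = f x + (if 0 < p then al else - al).
  by case: ifP.
have Hv x : f (if 0 < q then v x else (v^-1)%g x) = f x + (if 0 < q then be else - be).
  by case: ifP.
have cond : ((0 < `|p|) && (0 < `|q|) || (`|p| + `|q| == 1))%N.
  move: pq1; case: `|p|%N => [|a]; first by rewrite gcd0n => ->.
  by case: `|q|%N => [|b] //; rewrite gcdn0 => ->.
rewrite /seg_piece /seg_start.
set t := seg_walk _ _ _ _ _ _ _ _.
have Et := potential_walk (if p < 0 then (h^-1)%g (if q < 0 then (v^-1)%g s else s)
   else (if q < 0 then (v^-1)%g s else s)) Hh Hv cond.
rewrite -/t in Et.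
clearbody t; clear Hh Hv cond.
case: p q pq1 t Et => [[|p]|p] [[|q]|q] pq1 t Et; rewrite /= in Et *;
  rewrite ?fh ?fv ?Et ?fh' ?fv' ?NegzE ?mulrNz -?pmulrn -?natr1 ?mulr0; try ring;
  rewrite ?fh' ?fh ?Et; try ring.
Qed.

Lemma potential_vcycle x : f (vcycle h v x) = f x.
Proof.
rewrite -[x](permKV h) -[(h^-1)%g x](permKV v) vcycleE !(fh, fv).
by ring.
Qed.

(** A potential is unchanged by the commutator, so it takes one value on the three cone squares
    between which all saddle connections run. *)
Lemma potential_period z : inH2 h v -> in_periods h v z ->
  al * z.1%:~R + be * z.2%:~R = 0.
Proof.
move=> H2; elim=> {z} [z|||].
- move=> [s [p [q [k [[Cs [pq1 [k0 [_ Ct]]]] ->]]]]] /=.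
  have E i : f (iter i (seg_piece h v p q) s) = f s + i%:R * (al * p%:~R + be * q%:~R).
    elim: i => [|i IH] /=; first by rewrite mul0r addr0.
    by rewrite potential_piece // IH -natr1; ring.
  have {Cs}Cs : cone h v s by move: Cs; rewrite vangle_eq1 negbK.
  have {Ct}Ct : cone h v (iter k (seg_piece h v p q) s).
    by move: Ct; rewrite vangle_eq1 negbK.
  have [_ _ Kx] := cone_cycle H2 Cs.
  have : f (iter k (seg_piece h v p q) s) = f s.
    by case/Kx: Ct => ->; rewrite ?potential_vcycle.
  rewrite E => /(canRL (addKr _)); rewrite addNr => E0; rewrite -[RHS]E0 !intrM -!pmulrn; ring.
- by rewrite !mulr0 addr0.
- by move=> z w _ IHz _ IHw /=; rewrite -[RHS]addr0 -{1}IHz -IHw !intrD; ring.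
by move=> z _ IH /=; rewrite -[RHS]oppr0 -IH !mulrNz; ring.
Qed.

Lemma potential_not_primitive : inH2 h v -> primitive h v -> al = 0 /\ be = 0.
Proof.
move=> H2 prim; have := potential_period H2 (prim (1, 0)).
have := potential_period H2 (prim (0, 1)).
by rewrite /= !mulr0 !mulr1 add0r addr0.
Qed.

End Potential.

Lemma chart_potential (R : comNzRingType) B n (h v : {perm 'I_n}) psi (g : nat * nat -> R)
    (al be : R) : base_ok B -> chart B h v psi -> inH2 h v ->
  (forall p, p \in cell B -> g (hN B p) = g p + al)%R ->
  (forall p, p \in cell B -> g (vN B p) = g p + be)%R ->
  primitive h v -> (al = 0 /\ be = 0)%R.
Proof.
move=> okB ch H2 gh gv.
have [phi [phi_cell phiK psiK]] := chart_coordinates ch.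
apply: (@potential_not_primitive R n h v (fun i => g (phi i))) => // i.
  by rewrite -{1}(phiK i) (ch_h ch) // psiK ?gh ?hN_cell.
by rewrite -{1}(phiK i) (ch_v ch) // psiK ?gv ?vN_cell.
Qed.

Lemma Zp_nat_eq0 m k : 1 < m -> ((k%:R == 0 :> 'Z_m)%R) = (m %| k).
Proof. by move=> m1; rewrite -val_eqE /= val_Zp_nat. Qed.

Lemma cone_vangle n (h v : {perm 'I_n}) x : (vangle h v x != 1) = cone h v x.
Proof. by rewrite vangle_eq1 negbK. Qed.

Lemma saddle_horizontal n (h v : {perm 'I_n}) s k : 0 < k -> cone h v s ->
  cone h v (iter k h s) -> (forall j, 0 < j < k -> ~~ cone h v (iter j h s)) ->
  in_periods h v (k%:Z, 0)%R.
Proof.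
move=> k0 Cs Ck reg; apply: per_gen; exists s, 1%R, 0%R, k.
have E i : iter i (seg_piece h v 1 0) s = iter i h s by [].
split; last by rewrite mulr1 mulr0.
rewrite /saddle_connection !cone_vangle !E; do !split=> //.
by move=> i ik; apply/eqP; rewrite E vangle_eq1 reg.
Qed.

(** The lattice points met on the way from the bottom to the top of a cylinder have heights strictly
    between 0 and H, hence are regular; gcd(X, H) is the number of primitive pieces. *)
Lemma saddle_crossing n (h v : {perm 'I_n}) s H X : is_height h v s H -> cone h v s ->
  cone h v (iter H v (iter X h s)) -> in_periods h v (X%:Z, H%:Z)%R.
Proof.
move=> hgt Cs C; have [H0 _ reg] := hgt.
pose k := gcdn X H; have k0 : 0 < k by rewrite gcdn_gt0 H0 orbT.
have /dvdnP[p Ep] : k %| X by exact: dvdn_gcdl.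
have /dvdnP[q Eq] : k %| H by exact: dvdn_gcdr.
have q0 : 0 < q by move: H0; rewrite Eq muln_gt0 => /andP[].
have pq : gcdn p q = 1.
  apply/eqP; rewrite -(eqn_pmul2r k0) mul1n -{2}/k muln_gcdl -Ep -Eq //.
have piece Y Z : Y + q <= H -> seg_piece h v p%:Z q%:Z (iter Y v (iter Z h s)) =
    iter (Y + q) v (iter (Z + p) h s).
  move=> YH; case: q q0 pq YH {Eq} => // q _ pq YH.
  rewrite /seg_piece /seg_start /=.
  case: p pq {Ep} => [|p] pq.
    rewrite gcd0n in pq; case: q pq YH => // _ YH.
    by rewrite /= addn1 addn0.
  pose F i j := iter (Y + j) v (iter (Z + i) h s).
  have W : seg_walk h v p.+1 q.+1 (p.+1 + q.+1 - 2) 0 0 (F 0 0) = F p q.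
    apply: seg_walk_run; try lia; move=> i j A A'; rewrite /F.
      by rewrite (height_comm hgt) ?addnS //; lia.
    by rewrite addnS.
  have F0 : F 0 0 = iter Y v (iter Z h s) by rewrite /F !addn0.
  rewrite F0 in W; rewrite [seg_walk _ _ _ _ _ _ _ _]W /F.
  rewrite (height_comm hgt); last lia.
  by rewrite -iterS !addnS.
have run i : i <= k -> iter i (seg_piece h v p%:Z q%:Z) s = iter (i * q) v (iter (i * p) h s).
  elim: i => [|i IH] ik //=; rewrite IH ?(ltnW ik) // piece.
    by rewrite !mulSn ![_ + i * _]addnC.
  by rewrite Eq addnC -mulSn mulnC leq_mul2l ik orbT.
apply: per_gen; exists s, p%:Z%R, q%:Z%R, k; split; last first.
  by rewrite -!PoszM {1}Ep {1}Eq ![k * _]mulnC.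
rewrite /saddle_connection !cone_vangle; do !split=> //.
  move=> i ik; rewrite run; last lia.
  by apply/eqP; rewrite vangle_eq1 reg // Eq; nia.
by rewrite run // ![k * _]mulnC -Ep -Eq.
Qed.

Section PeriodGroup.
Variables (n : nat) (h v : {perm 'I_n}).
Local Open Scope ring_scope.

Lemma period_mul (k x y : int) : in_periods h v (x, y) -> in_periods h v (k * x, k * y).
Proof.
move=> Pz; have aux (m : nat) : in_periods h v (m%:Z * x, m%:Z * y).
  elim: m => [|m IH]; first by rewrite !mul0r; exact: per_zero.
  by have := per_add Pz IH; rewrite /= intS !mulrDl !mul1r.
case: k => m; first exact: aux.
by have := per_opp (aux m.+1); rewrite NegzE /= !mulNr.
Qed.

Lemma period_comb (k l x y x' y' : int) :
  in_periods h v (x, y) -> in_periods h v (x', y') ->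
  in_periods h v (k * x + l * x', k * y + l * y').
Proof. by move=> P1 P2; exact: (per_add (period_mul k P1) (period_mul l P2)). Qed.

Lemma period_gcd (x x' : int) :
  in_periods h v (x, 0) -> in_periods h v (x', 0) -> in_periods h v (gcdz x x', 0).
Proof.
move=> Px Px'; case: (Bezoutz x x') => k [l <-].
by have := period_comb k l Px Px'; rewrite !mulr0 addr0.
Qed.

Lemma primitive_of_periods (t : int) :
  in_periods h v (1, 0) -> in_periods h v (t, 1) -> primitive h v.
Proof.
move=> P1 Pt [x y]; have := period_comb (x - y * t) y P1 Pt.
by congr (in_periods h v (_, _)); ring.
Qed.

End PeriodGroup.

(* The lattice of periods is spanned by (w1, 0), (w2, 0), (t1, h1), (t2, h2). *)
Definition is_prim2 w1 w2 h1 h2 t1 t2 :=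
  coprime h1 h2 && (gcdn (gcdn w1 w2) (absz ((t1 * h2)%N%:Z - (t2 * h1)%N%:Z)%R) == 1).

(** The combination h2 (t1, h1) - h1 (t2, h2) is horizontal of length t1 h2 - t2 h1; together with
    w1 and w2 it yields (1, 0). Bezout coefficients for h1 and h2 yield a period of height 1. *)
Lemma chart2_primitive w1 w2 h1 h2 t1 t2 n (h v : {perm 'I_n}) psi :
  valid2 w1 w2 h1 h2 t1 t2 -> chart (base2 w1 w2 h1 h2 t1 t2) h v psi ->
  is_prim2 w1 w2 h1 h2 t1 t2 -> primitive h v.
Proof.
move=> V ch /andP[hh /eqP g1].
have /and5P[? ? ? ? /andP[? ?]] := V.
have Ca := chart2_cone V ch (chart2_cell0 V (x := 0) ltac:(lia)).
have Cd := chart2_cone V ch (chart2_cell0 V (x := w1) ltac:(lia)).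
have Cb := chart2_cone V ch (chart2_cell0 V (x := w1 + w1) ltac:(lia)).
rewrite !eqxx /= ?orbT in Ca Cd Cb.
have P1 : in_periods h v (w1%:Z, 0)%R.
  apply: (@saddle_horizontal _ _ _ (psi (w1, 0))); rewrite ?(chart2_row2 V ch) //; try lia.
  move=> j jw; rewrite (chart2_row2 V ch) ?(chart2_cone V ch) ?(chart2_cell0 V) //; lia.
have P2' : in_periods h v ((w2 - w1)%:Z, 0)%R.
  have row k : k <= w2 - w1 -> iter k h (psi (w1 + w1, 0)) = iter (k + w1) h (psi (w1, 0)).
    by move=> kw; rewrite -(chart2_row2 V ch) // iterD.
  apply: (@saddle_horizontal _ _ _ (psi (w1 + w1, 0))) => //; try lia.
    have le12 : w1 <= w2 by lia.
    by rewrite row // subnK //; have [_ -> _] := chart2_order2 V ch.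
  move=> j jw; rewrite row; last lia.
  rewrite (chart2_row2 V ch) ?(chart2_cone V ch) ?(chart2_cell0 V) //; lia.
have P2 : in_periods h v (w2%:Z, 0)%R.
  by have := per_add P1 P2'; rewrite /= -PoszD subnKC //; lia.
have T1 : in_periods h v (t1%:Z, h1%:Z)%R.
  by apply: (saddle_crossing (chart2_height1 V ch) Ca); rewrite (chart2_twist1 V ch).
have T2 : in_periods h v (t2%:Z, h2%:Z)%R.
  by apply: (saddle_crossing (chart2_height2 V ch) Cd); rewrite (chart2_twist2 V ch).
have PD : in_periods h v ((t1 * h2)%N%:Z - (t2 * h1)%N%:Z, 0)%R.
  have := period_comb h2%:Z (- h1%:Z) T1 T2.
  by congr (in_periods h v (_, _)); rewrite ?PoszM; ring.
have P10 : in_periods h v (1, 0)%R.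
  have := period_gcd (period_gcd P1 P2) PD.
  by rewrite /gcdz /= g1.
case: (Bezoutz h1%:Z h2%:Z) => k [l].
rewrite /gcdz /= (eqP hh) => E.
have := period_comb k l T1 T2; rewrite E; exact: primitive_of_periods.
Qed.

Definition is_prim1 l1 l2 l3 H := (H == 1) && (gcdn (gcdn l1 l2) l3 == 1).

Lemma chart1_primitive l1 l2 l3 H t n (h v : {perm 'I_n}) psi :
  valid1 l1 l2 l3 H t -> chart (base1 l1 l2 l3 H t) h v psi ->
  is_prim1 l1 l2 l3 H -> primitive h v.
Proof.
move=> V ch /andP[/eqP H1 /eqP g1]; subst H.
have /and5P[? ? ? ? ?] := V.
have Ca := chart1_cone V ch (chart1_cell0 V (x := 0) ltac:(lia)).
have Cb := chart1_cone V ch (chart1_cell0 V (x := l3) ltac:(lia)).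
have Cd := chart1_cone V ch (chart1_cell0 V (x := l2 + l3) ltac:(lia)).
rewrite !eqxx /= ?orbT in Ca Cb Cd.
have P3 : in_periods h v (l3%:Z, 0)%R.
  apply: (@saddle_horizontal _ _ _ (psi (0, 0))); rewrite ?(chart1_row V ch) //; try lia.
  move=> j jw; rewrite (chart1_row V ch) ?(chart1_cone V ch) ?(chart1_cell0 V) //; lia.
have P2 : in_periods h v (l2%:Z, 0)%R.
  have row k : iter k h (psi (l3, 0)) = iter (k + l3) h (psi (0, 0)).
    by rewrite -(chart1_row V ch (j := l3)) ?iterD //; lia.
  apply: (@saddle_horizontal _ _ _ (psi (l3, 0))) => //.
    by rewrite row (chart1_row V ch) //; lia.
  move=> j jw; rewrite row.
  rewrite (chart1_row V ch) ?(chart1_cone V ch) ?(chart1_cell0 V) //; lia.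
have P1 : in_periods h v (l1%:Z, 0)%R.
  have row k : iter k h (psi (l2 + l3, 0)) = iter (k + (l2 + l3)) h (psi (0, 0)).
    by rewrite -(chart1_row V ch (j := l2 + l3)) ?iterD //; lia.
  apply: (@saddle_horizontal _ _ _ (psi (l2 + l3, 0))) => //.
    by rewrite row addnA; have [_ -> _] := chart1_order V ch.
  move=> j jw; rewrite row.
  rewrite (chart1_row V ch) ?(chart1_cone V ch) ?(chart1_cell0 V) //; lia.
have T : in_periods h v (t%:Z, 1)%R.
  by apply: (saddle_crossing (chart1_height V ch) Ca); rewrite (chart1_twist V ch).
apply: primitive_of_periods T.
have := period_gcd (period_gcd P1 P2) P3.
by rewrite /gcdz /= g1.
Qed.

(** The height modulo H is a potential, and once H = 1 so is the horizontal coordinate modulo the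
    gcd of the lengths, which changes by -t along [v]. *)
Lemma primitive_chart1 l1 l2 l3 H t n (h v : {perm 'I_n}) psi :
  valid1 l1 l2 l3 H t -> chart (base1 l1 l2 l3 H t) h v psi ->
  primitive h v -> is_prim1 l1 l2 l3 H.
Proof.
move=> V ch prim; have /and5P[? ? ? ? ?] := V.
have okB := base1_ok V; have H2 := chart1_inH2 V ch.
have EH : H = 1.
  apply/eqP; rewrite eqn_leq andbC (_ : 0 < H) //= leqNgt; apply/negP => H1.
  have [] := @chart_potential 'Z_H _ _ _ _ _ (fun p => p.2%:R)%R 0%R 1%R okB ch H2 _ _ prim.
  - by move=> p _; rewrite addr0.
  - move=> [x y] /andP[/= X Y]; rewrite /vN /=; case: ltnP => A; first by rewrite natr1.
    have -> : (y = H.-1)%N by lia.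
    by rewrite natr1 prednK // pchar_Zp.
  by move=> _ /eqP; rewrite oner_eq0.
subst H; rewrite /is_prim1 eqxx /=; set m := gcdn _ _.
have m0 : 0 < m by rewrite !gcdn_gt0; lia.
have [m1|m1] := leqP m 1; first by rewrite eqn_leq m1.
have d1 : (l1%:R = 0 :> 'Z_m)%R.
  by apply/eqP; rewrite Zp_nat_eq0 // (dvdn_trans (dvdn_gcdl _ _)) ?dvdn_gcdl.
have d2 : (l2%:R = 0 :> 'Z_m)%R.
  by apply/eqP; rewrite Zp_nat_eq0 // (dvdn_trans (dvdn_gcdl _ _)) ?dvdn_gcdr.
have d3 : (l3%:R = 0 :> 'Z_m)%R by apply/eqP; rewrite Zp_nat_eq0 // dvdn_gcdr.
have [] := @chart_potential 'Z_m _ _ _ _ _ (fun p => p.1%:R)%R 1%R (- t%:R)%R okB ch H2 _ _ prim.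
- move=> [x y] /andP[/= X Y]; rewrite /hN /= /rot1; case: eqP => A; last by rewrite natr1.
  by rewrite natr1 A !natrD d1 d2 d3 !addr0.
- move=> [x y] /andP[/= X Y]; rewrite /vN /=.
  (* The gluing moves x by -t up to multiples of the lengths; putting multiples on both sides avoids
     subtraction in nat. *)
  have [k Ek] : exists k : nat * nat * nat * (nat * nat * nat),
      flip3 l1 l2 l3 (shift1 (l1 + l2 + l3) t x) + t + k.1.1.1 * l1 + k.1.1.2 * l2 + k.1.2 * l3 =
      x + k.2.1.1 * l1 + k.2.1.2 * l2 + k.2.2 * l3.
    rewrite /flip3 /shift1; case: (ltnP x t) => A; case: ltnP => C; [| | |].
    + by exists (0, 0, 0, (1, 2, 2)) => /=; lia.
    + case: ltnP => D; first by exists (0, 0, 0, (0, 1, 2)) => /=; lia.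
      by exists (0, 0, 0, (0, 0, 1)) => /=; lia.
    + by exists (0, 0, 0, (0, 1, 1)) => /=; lia.
    case: ltnP => D; first by exists (1, 0, 0, (0, 0, 1)) => /=; lia.
    by exists (1, 1, 0, (0, 0, 0)) => /=; lia.
  have := congr1 (fun u => u%:R : 'Z_m)%R Ek.
  rewrite !natrD !natrM d1 d2 d3 !mulr0 !addr0 => E.
  by rewrite -E addrK.
by move/eqP; rewrite oner_eq0.
Qed.

Lemma primitive_chart2 w1 w2 h1 h2 t1 t2 n (h v : {perm 'I_n}) psi :
  valid2 w1 w2 h1 h2 t1 t2 -> chart (base2 w1 w2 h1 h2 t1 t2) h v psi ->
  primitive h v -> is_prim2 w1 w2 h1 h2 t1 t2.
Proof.
move=> V ch prim; have /and5P[? ? ? ? /andP[? ?]] := V.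
have okB := base2_ok V; have H2 := chart2_inH2 V ch.
apply/andP.
have cop : coprime h1 h2.
  rewrite /coprime; set e := gcdn h1 h2.
  have e0 : 0 < e by rewrite gcdn_gt0; lia.
  have [e1|e1] := leqP e 1; first by rewrite eqn_leq e1.
  have d1 : (h1%:R = 0 :> 'Z_e)%R by apply/eqP; rewrite Zp_nat_eq0 // dvdn_gcdl.
  have d2 : (h2%:R = 0 :> 'Z_e)%R by apply/eqP; rewrite Zp_nat_eq0 // dvdn_gcdr.
  have [] := @chart_potential 'Z_e _ _ _ _ _ (fun p => p.2%:R)%R 0%R 1%R okB ch H2 _ _ prim.
  - by move=> p _; rewrite addr0.
  - move=> [x y] /andP[/= X Y]; rewrite /vN /=; case: ltnP => A; first by rewrite natr1.
    have Ey : y.+1 = if x < w1 then h1 else h2 by lia.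
    by rewrite natr1 Ey; case: ifP.
  by move=> _ /eqP; rewrite oner_eq0.
split=> //; set m := gcdn _ _.
have m0 : 0 < m by rewrite !gcdn_gt0; lia.
have [m1|m1] := leqP m 1; first by rewrite eqn_leq m1.
have d1 : (w1%:R = 0 :> 'Z_m)%R.
  by apply/eqP; rewrite Zp_nat_eq0 // (dvdn_trans (dvdn_gcdl _ _)) ?dvdn_gcdl.
have d2 : (w2%:R = 0 :> 'Z_m)%R.
  by apply/eqP; rewrite Zp_nat_eq0 // (dvdn_trans (dvdn_gcdl _ _)) ?dvdn_gcdr.
have dD : (t1%:R * h2%:R = t2%:R * h1%:R :> 'Z_m)%R.
  have : m %| (absz ((t1 * h2)%N%:Z - (t2 * h1)%N%:Z)%R) by exact: dvdn_gcdr.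
  rewrite -(Zp_nat_eq0 _ m1) => /eqP E; rewrite -!natrM.
  have [le|le] := leqP (t2 * h1) (t1 * h2).
    have E' : t1 * h2 = (absz ((t1 * h2)%N%:Z - (t2 * h1)%N%:Z)%R) + t2 * h1 by lia.
    by rewrite {1}E' natrD E add0r.
  have E' : t2 * h1 = (absz ((t1 * h2)%N%:Z - (t2 * h1)%N%:Z)%R) + t1 * h2 by lia.
  by rewrite [in RHS]E' natrD E add0r.
(* As w1 and w2 vanish modulo m, al x + be y is a potential as soon as it kills (t1, h1) and (t2,
   h2). *)
have key (al be : 'Z_m) : (al * t1%:R + be * h1%:R = 0)%R -> (al * t2%:R + be * h2%:R = 0)%R ->
    (al = 0)%R.
  move=> E1 E2.
  have [] // := @chart_potential 'Z_m _ _ _ _ _ (fun p => al * p.1%:R + be * p.2%:R)%R al be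
    okB ch H2 _ _ prim.
  - move=> [x y] /andP[/= X Y]; rewrite /hN /= /rot2; case: eqP => A.
      have -> : (al * x%:R + be * y%:R + al = al * (x.+1)%:R + be * y%:R)%R by rewrite -natr1; ring.
      by rewrite A d1.
    have -> : (al * x%:R + be * y%:R + al = al * (x.+1)%:R + be * y%:R)%R by rewrite -natr1; ring.
    by case: eqP => [->|//]; rewrite natrD d1 d2 addr0.
  move=> [x y] /andP[/= X Y]; rewrite /vN /=; case: ltnP => A /=; first by rewrite -natr1; ring.
  rewrite mulr0 addr0.
  have Ey : y.+1 = if x < w1 then h1 else h2 by lia.
  have -> : (al * x%:R + be * y%:R + be = al * x%:R + be * (y.+1)%:R)%R by rewrite -natr1; ring.
  rewrite Ey /swap2 /shift2; case: (ltnP x w1) => B.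
    have [k Ek] : exists k, (if x < t1 then x + w1 - t1 else x - t1) + w1 + t1 = x + k * w1.
      by case: ifP => D; [exists 2|exists 1]; lia.
    have -> : (if x < t1 then x + w1 - t1 else x - t1) < w1 by case: ifP; lia.
    move: Ek; set z := (_ + w1) => Ek; clearbody z; have := congr1 (fun u => u%:R : 'Z_m)%R Ek.
    rewrite !natrD natrM d1 mulr0 addr0 => <-.
    by rewrite -[LHS]addr0 -E1; ring.
  set z := (if x < w1 + t2 then _ else _).
  have zw : (z < w1) = false by rewrite /z; case: ifP; lia.
  rewrite zw; set z' := (if _ then _ else _).
  have [k Ek] : exists k : nat * nat, z' + t2 + k.1 * w1 = x + k.2 * w2.
    rewrite /z' /z; case: (ltnP x (w1 + t2)) => C; case: ltnP => D.
    - by exists (1, 1) => /=; lia.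
    - by exists (0, 1) => /=; lia.
    - by exists (1, 0) => /=; lia.
    by exists (0, 0) => /=; lia.
  clearbody z'; have := congr1 (fun u => u%:R : 'Z_m)%R Ek.
  rewrite !natrD !natrM d1 d2 !mulr0 !addr0 => <-.
  by rewrite -[LHS]addr0 -E2; ring.
(* By [dD] the coefficients (h1, -t1) and (h2, -t2) kill both twist vectors, so m divides the
   coprime numbers h1 and h2. *)
have z1 : (h1%:R = 0 :> 'Z_m)%R by apply: (key _ (- t1%:R)%R); rewrite ?mulNr; [ring|rewrite dD; ring].
have z2 : (h2%:R = 0 :> 'Z_m)%R by apply: (key _ (- t2%:R)%R); rewrite ?mulNr; [rewrite -[(h2%:R * _)%R]mulrC dD; ring|ring].
have : m %| gcdn h1 h2 by rewrite dvdn_gcd -!(Zp_nat_eq0 _ m1) z1 z2 !eqxx.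
by rewrite (eqP cop) dvdn1 => /eqP ->.
Qed.

(** * Isomorphism classes *)

Lemma sts_classP n (x y : {perm 'I_n} * {perm 'I_n}) :
  reflect (exists g, y = (x.1 ^ g, x.2 ^ g)%g) (y \in sts_class x).
Proof. by apply: (iffP imsetP) => [[g _ ->]|[g ->]]; exists g. Qed.

Lemma sts_class_refl n (x : {perm 'I_n} * {perm 'I_n}) : x \in sts_class x.
Proof. by apply/sts_classP; exists 1%g; rewrite !conjg1; case: x. Qed.

Lemma sts_class_eq n (x y : {perm 'I_n} * {perm 'I_n}) :
  y \in sts_class x -> sts_class x = sts_class y.
Proof.
case/sts_classP=> g ->; apply/setP=> z; apply/sts_classP/sts_classP => -[k ->] /=.
  by exists (g^-1 * k)%g; rewrite -!conjgM !mulgA mulgV !mul1g.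
by exists (g * k)%g; rewrite !conjgM.
Qed.

Lemma chart_conj B n (h v g : {perm 'I_n}) psi : chart B h v psi ->
  chart B (h ^ g)%g (v ^ g)%g (fun p => g (psi p)).
Proof.
move=> ch; split.
- by move=> p q Hp Hq /perm_inj; exact: (ch_inj ch).
- move=> i; have [p Hp E] := ch_surj ch ((g^-1)%g i).
  by exists p => //; rewrite E permKV.
- by move=> p Hp; rewrite permJ (ch_h ch).
- by move=> p Hp; rewrite permJ (ch_v ch).
Qed.

Lemma chart_same_class B n (h v h' v' : {perm 'I_n}) psi psi' : base_ok B ->
  chart B h v psi -> chart B h' v' psi' -> sts_class (h, v) = sts_class (h', v').
Proof.
move=> okB ch ch'; apply: sts_class_eq.
have [phi [phi_cell phiK psiK]] := chart_coordinates ch.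
have f_inj : injective (fun i => psi' (phi i)).
  by move=> i j /(ch_inj ch' (phi_cell i) (phi_cell j)) E; rewrite -(phiK i) E phiK.
pose g := perm f_inj.
have gE p : p \in cell B -> g (psi p) = psi' p by move=> Hp; rewrite permE psiK.
apply/sts_classP; exists g => /=; congr pair; apply/permP => i.
  have [p Hp <-] := ch_surj ch' i.
  by rewrite (ch_h ch') // -(gE p Hp) permJ (ch_h ch) // gE // hN_cell.
have [p Hp <-] := ch_surj ch' i.
by rewrite (ch_v ch') // -(gE p Hp) permJ (ch_v ch) // gE // vN_cell.
Qed.

(** Double counting of the pairs of a parameter and a class: a parameter describes one class, and a
    class has k descriptions in [L]. *)
Lemma card_classes_by_params n (T : eqType) (L : seq T) (k : nat)
    (Rel : T -> {perm 'I_n} * {perm 'I_n} -> Prop)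
    (Q : {perm 'I_n} -> {perm 'I_n} -> bool) :
  (forall p, p \in L -> exists2 x, Rel p x & Q x.1 x.2) ->
  (forall p x y, p \in L -> Rel p x -> Rel p y -> sts_class x = sts_class y) ->
  (forall p x y, Rel p x -> sts_class x = sts_class y -> Rel p y) ->
  (forall x, Q x.1 x.2 -> count (fun p => `[< Rel p x >]) L = k) ->
  size L = k * n_classes Q.
Proof.
move=> ex same inv cnt.
have /choice[f fP] : forall p, exists x, p \in L -> Rel p x /\ Q x.1 x.2.
  move=> p; have [/ex[x Rx Qx]|pL] := boolP (p \in L); first by exists x.
  by exists (1, 1)%g.
rewrite /n_classes; set C := [set _ | x in _].
have fC p : p \in L -> sts_class (f p) \in C.
  by move=> /fP[_ Qp]; apply: imset_f; rewrite inE.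
have fib S : S \in C -> count (fun p => sts_class (f p) == S) L = k.
  case/imsetP=> x; rewrite inE => Qx ->; rewrite -(cnt x Qx); apply: eq_in_count => p pL.
  have [Rp Qp] := fP p pL; apply/eqP/asboolP; first exact: inv.
  exact: same.
transitivity (\sum_(S in C) count (fun p => sts_class (f p) == S) L); last first.
  by rewrite (eq_bigr _ fib) sum_nat_const mulnC.
transitivity (\sum_(p <- L) \sum_(S in C) (sts_class (f p) == S)).
  rewrite -sum1_size big_seq [RHS]big_seq; apply: eq_bigr => p pL.
  rewrite (bigD1 (sts_class (f p))) ?fC //= eqxx big1 // => S /andP[_].
  by rewrite eq_sym => /negPf ->.
by rewrite exchange_big; apply: eq_bigr => S _; rewrite -sum1_count [RHS]big_mkcond;
  apply: eq_bigr => p _; case: eqP.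
Qed.

Lemma mem_allpairs_pair (T1 T2 : eqType) (s1 : seq T1) (s2 : seq T2) u w :
  ((u, w) \in allpairs pair s1 s2) = (u \in s1) && (w \in s2).
Proof. by apply/allpairsP/andP => [[p [? ? [-> ->]]] //|[us ws]]; exists (u, w). Qed.

Definition quads n : seq (nat * nat * nat * nat) :=
  [seq q <- allpairs pair (allpairs pair (allpairs pair (iota 1 n) (iota 1 n)) (iota 1 n))
              (iota 1 n) | let: (a, b, x, y) := q in a * x + b * y == n].

Lemma mem_quads n a b x y : ((a, b, x, y) \in quads n) =
  [&& 0 < a, 0 < b, 0 < x, 0 < y & a * x + b * y == n].
Proof.
rewrite mem_filter andbC.
rewrite !mem_allpairs_pair !mem_iota.
apply/idP/idP => [/andP[/andP[/andP[/andP[? ?] ?] ?] ->]|]; first by lia.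
case/and5P=> a0 b0 x0 y0 /eqP E; rewrite E eqxx; nia.
Qed.

Lemma quads_uniq n : uniq (quads n).
Proof.
apply: filter_uniq; do 3 (apply: allpairs_uniq; rewrite ?iota_uniq //; last by move=> [? ?] [? ?] _ _).
Qed.

Definition params2 n (bB : bool) : seq (nat * nat * nat * nat * (nat * nat)) :=
  [seq p <- [seq (q, t) | q <- quads n, t <- allpairs pair (iota 0 n) (iota 0 n)] |
    let: (w1, w2, h1, h2, (t1, t2)) := p in
    [&& w1 < w2, t1 < w1, t2 < w2, is_prim2 w1 w2 h1 h2 t1 t2 &
        is_typeB2 w1 w2 h1 h2 t1 t2 == bB]].

Lemma mem_params2 n bB w1 w2 h1 h2 t1 t2 :
  ((w1, w2, h1, h2, (t1, t2)) \in params2 n bB) =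
  [&& valid2 w1 w2 h1 h2 t1 t2, w1 * h1 + w2 * h2 == n,
      is_prim2 w1 w2 h1 h2 t1 t2 & is_typeB2 w1 w2 h1 h2 t1 t2 == bB].
Proof.
rewrite mem_filter andbC.
rewrite !mem_allpairs_pair !mem_iota mem_quads /valid2.
move: (is_prim2 _ _ _ _ _ _) (is_typeB2 _ _ _ _ _ _ == _) => P1 P2.
apply/idP/idP; first by lia.
case/and4P=> /and5P[w10 lt h10 h20 /andP[t1w t2w]] /eqP E -> ->.
by rewrite E eqxx lt t1w t2w w10 h10 h20; nia.
Qed.

Lemma params2_uniq n bB : uniq (params2 n bB).
Proof.
apply/filter_uniq/allpairs_uniq; [exact: quads_uniq| |by move=> [? ?] [? ?] _ _].
by apply: allpairs_uniq; rewrite ?iota_uniq // => -[? ?] [? ?] _ _.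
Qed.

Definition params1 n (bB : bool) : seq (nat * nat * nat * nat) :=
  [seq p <- allpairs pair (allpairs pair (allpairs pair (iota 1 n) (iota 1 n)) (iota 1 n))
              (iota 0 n) | let: (l1, l2, l3, t) := p in
    [&& l1 + l2 + l3 == n, gcdn (gcdn l1 l2) l3 == 1 & is_typeB1 l1 l2 l3 == bB]].

Lemma mem_params1 n bB l1 l2 l3 t : ((l1, l2, l3, t) \in params1 n bB) =
  [&& valid1 l1 l2 l3 1 t, l1 + l2 + l3 == n, is_prim1 l1 l2 l3 1 &
      is_typeB1 l1 l2 l3 == bB].
Proof.
rewrite mem_filter andbC.
rewrite !mem_allpairs_pair !mem_iota /valid1 /is_prim1 eqxx /=.
by move: (gcdn _ _ == _) (is_typeB1 _ _ _ == _) => P1 P2; lia.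
Qed.

Lemma params1_uniq n bB : uniq (params1 n bB).
Proof.
apply: filter_uniq; do 3 (apply: allpairs_uniq; rewrite ?iota_uniq //; last by move=> [? ?] [? ?] _ _).
Qed.

Definition is_type n (bB : bool) (h v : {perm 'I_n}) :=
  if bB then typeB h v else typeA h v.

Lemma type_of_is_type n (h v : {perm 'I_n}) tB bB : type_of h v tB ->
  is_type bB h v = (tB == bB).
Proof. by case=> A C; rewrite /is_type; case: bB; rewrite ?A ?C; case: tB {A C}. Qed.

Definition describes2 n (p : nat * nat * nat * nat * (nat * nat))
    (x : {perm 'I_n} * {perm 'I_n}) : Prop :=
  let: (w1, w2, h1, h2, (t1, t2)) := p in
  valid2 w1 w2 h1 h2 t1 t2 /\ exists psi, chart (base2 w1 w2 h1 h2 t1 t2) x.1 x.2 psi.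

Definition describes1 n (p : nat * nat * nat * nat) (x : {perm 'I_n} * {perm 'I_n}) : Prop :=
  let: (l1, l2, l3, t) := p in
  valid1 l1 l2 l3 1 t /\ exists psi, chart (base1 l1 l2 l3 1 t) x.1 x.2 psi.

Lemma exists_cone n (h v : {perm 'I_n}) : inH2 h v -> exists a, cone h v a.
Proof.
move=> /inH2P[_ c3]; have /card_gt0P[a] : 0 < #|[set x | cone h v x]| by rewrite c3.
by rewrite inE; exists a.
Qed.

Section ClassCount.
Variables (n : nat) (n_odd : odd n) (bB : bool).
Let Q (h v : {perm 'I_n}) :=
  [&& sts_connected h v, inH2 h v, `[< primitive h v >] & is_type bB h v].

Lemma chart2_params w1 w2 h1 h2 t1 t2 (h v : {perm 'I_n}) psi :
  valid2 w1 w2 h1 h2 t1 t2 -> chart (base2 w1 w2 h1 h2 t1 t2) h v psi ->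
  Q h v = ((w1, w2, h1, h2, (t1, t2)) \in params2 n bB).
Proof.
move=> V ch; rewrite mem_params2 V /Q (chart2_conn V ch) (chart2_inH2 V ch) /=.
rewrite (type_of_is_type _ (chart2_type n_odd V ch)).
rewrite -(size_cells2 _ _ _ _ t1 t2) (chart_size ch) eqxx /=; congr andb.
apply/asboolP/idP; first exact: primitive_chart2 V ch.
exact: chart2_primitive V ch.
Qed.

Lemma chart1_params l1 l2 l3 t (h v : {perm 'I_n}) psi :
  valid1 l1 l2 l3 1 t -> chart (base1 l1 l2 l3 1 t) h v psi ->
  Q h v = ((l1, l2, l3, t) \in params1 n bB).
Proof.
move=> V ch; rewrite mem_params1 V /Q (chart1_conn V ch) (chart1_inH2 V ch) /=.
rewrite (type_of_is_type _ (chart1_type n_odd V ch)).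
have := chart_size ch; rewrite size_cells1 muln1 => ->; rewrite eqxx /=; congr andb.
apply/asboolP/idP; first exact: primitive_chart1 V ch.
exact: chart1_primitive V ch.
Qed.

Lemma count_describes2 w1 w2 h1 h2 t1 t2 (h v : {perm 'I_n}) psi : Q h v ->
  valid2 w1 w2 h1 h2 t1 t2 -> chart (base2 w1 w2 h1 h2 t1 t2) h v psi ->
  count (fun p => `[< describes2 p (h, v) >]) (params2 n bB) = 1.
Proof.
move=> Qx V ch; apply: (@count_eq_size _ _ _ [:: (w1, w2, h1, h2, (t1, t2))]).
- exact: params2_uniq.
- by [].
- by move=> p; rewrite inE => /eqP ->; rewrite -(chart2_params V ch).
move=> [[[[w1' w2'] h1'] h2'] [t1' t2']] _; rewrite inE; apply/asboolP/eqP.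
  by move=> [V' [psi' ch']]; have [[_ -> -> -> ->] [-> ->]] := chart2_uniq V ch V' ch'.
by case=> -> -> -> -> -> ->; split=> //; exists psi.
Qed.

Lemma count_describes1 (h v : {perm 'I_n}) : Q h v ->
  (forall a, cone h v a -> exists l1 l2 l3 H t, valid1 l1 l2 l3 H t /\
    exists2 psi, chart (base1 l1 l2 l3 H t) h v psi & psi (0, 0) = a) ->
  count (fun p => `[< describes1 p (h, v) >]) (params1 n bB) = 3.
Proof.
move=> Qx all1; have /and4P[conn H2 /asboolP prim ty] := Qx.
have root a : cone h v a -> exists p, p \in params1 n bB /\
    let: (l1, l2, l3, t) := p in valid1 l1 l2 l3 1 t /\
    exists2 psi, chart (base1 l1 l2 l3 1 t) h v psi & psi (0, 0) = a.
  move=> /all1[l1 [l2 [l3 [H [t [V [psi ch Ea]]]]]]].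
  have /andP[/eqP H1 _] := primitive_chart1 V ch prim; subst H.
  exists (l1, l2, l3, t); rewrite -(chart1_params V ch) Qx; split=> //; split=> //.
  by exists psi.
have [a Ca] := exists_cone H2.
have [[ab ad bd] [Cb Cd _] Kx] := cone_cycle H2 Ca.
have [pa [La Ra]] := root _ Ca; have [pb [Lb Rb]] := root _ Cb.
have [pd [Ld Rd]] := root _ Cd.
have ne x y p q : x <> y -> (let: (l1, l2, l3, t) := p in valid1 l1 l2 l3 1 t /\
    exists2 psi, chart (base1 l1 l2 l3 1 t) h v psi & psi (0, 0) = x) ->
   (let: (l1, l2, l3, t) := q in valid1 l1 l2 l3 1 t /\
    exists2 psi, chart (base1 l1 l2 l3 1 t) h v psi & psi (0, 0) = y) -> p != q.
  move=> xy Rp Rq; apply/eqP => E; subst q; apply: xy.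
  case: p Rp Rq => -[[l1 l2] l3] t [V [psi ch <-]] [_ [psi' ch' <-]].
  exact: chart1_root_uniq V ch ch'.
apply: (@count_eq_size _ _ _ [:: pa; pb; pd]).
- exact: params1_uniq.
- by rewrite /= !inE negb_or (ne _ _ _ _ ab Ra Rb) (ne _ _ _ _ ad Ra Rd) (ne _ _ _ _ bd Rb Rd).
- by move=> p; rewrite !inE => /or3P[] /eqP ->.
move=> p _; rewrite !inE; apply/asboolP/or3P; last first.
  have weak q x : (let: (l1, l2, l3, t) := q in valid1 l1 l2 l3 1 t /\
      exists2 psi, chart (base1 l1 l2 l3 1 t) h v psi & psi (0, 0) = x) ->
      describes1 q (h, v).
    by case: q => -[[l1 l2] l3] t [V [psi ch _]]; split=> //; exists psi.
  by case=> /eqP ->; apply: weak; [exact: Ra|exact: Rb|exact: Rd].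
case: p => -[[l1 l2] l3] t [V [psi ch]].
have eqp q x : psi (0, 0) = x -> (let: (l1, l2, l3, t) := q in valid1 l1 l2 l3 1 t /\
    exists2 psi, chart (base1 l1 l2 l3 1 t) h v psi & psi (0, 0) = x) ->
    (l1, l2, l3, t) == q.
  move=> Ex; case: q => -[[l1' l2'] l3'] t' [V' [psi' ch' Ea']].
  by have [-> -> -> _ ->] := chart1_params_uniq V ch V' ch' (etrans Ex (esym Ea')).
have C0 : cone h v (psi (0, 0)).
  by rewrite (chart1_cone V ch) //; apply: (chart1_cell0 V); case/and5P: V; lia.
case/Kx: C0 => E; [constructor 1|constructor 2|constructor 3].
- exact: eqp E Ra.
- exact: eqp E Rb.
- exact: eqp E Rd.
Qed.

Theorem card_classes : size (params1 n bB) + 3 * size (params2 n bB) = 3 * n_classes Q.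
Proof.
(* The two-cylinder parameters are listed three times to match the three descriptions of a
   one-cylinder surface, so that k = 3 for every class. *)
pose L := map inl (params1 n bB) ++ map inr (params2 n bB ++ params2 n bB ++ params2 n bB).
pose Rel (p : _ + _) x := match p with
  inl p => @describes1 n p x | inr p => describes2 p x end.
have <- : size L = size (params1 n bB) + 3 * size (params2 n bB).
  by rewrite size_cat !size_map !size_cat; lia.
have n0 : 0 < n by case: (n) n_odd.
apply: (card_classes_by_params (Rel := Rel)).
- move=> p; rewrite mem_cat => /orP[] /mapP[] q.
    case: q => -[[l1 l2] l3] t Lp ->.
    have := Lp; rewrite mem_params1 => /and4P[V /eqP sum _ _].
    have [|h [v [psi ch]]] := chart_exists (base1_ok V) n0.
      by rewrite size_cells1 muln1.
    exists (h, v); last by rewrite /= (chart1_params V ch).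
    by split=> //; exists psi.
  case: q => -[[[w1 w2] h1] h2] [t1 t2] Lp ->.
  have {}Lp : (w1, w2, h1, h2, (t1, t2)) \in params2 n bB by move: Lp; rewrite !mem_cat !orbb.
  have := Lp; rewrite mem_params2 => /and4P[V /eqP sum _ _].
  have [|h [v [psi ch]]] := chart_exists (base2_ok V) n0.
    by rewrite size_cells2.
  exists (h, v); last by rewrite /= (chart2_params V ch).
  by split=> //; exists psi.
- move=> [[[[l1 l2] l3] t]|[[[[w1 w2] h1] h2] [t1 t2]]] [h v] [h' v'] _ [V [psi ch]] [_ [psi' ch']].
    exact: chart_same_class (base1_ok V) ch ch'.
  exact: chart_same_class (base2_ok V) ch ch'.
- move=> p x y Rp E; have : y \in sts_class x by rewrite E sts_class_refl.
  case/sts_classP=> g ->.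
  case: p Rp => [[[[l1 l2] l3] t]|[[[[w1 w2] h1] h2] [t1 t2]]] [V [psi ch]]; split=> //;
    exists (fun p => g (psi p)); exact: chart_conj.
move=> [h v] /= Qx; have /and4P[conn H2 _ _] := Qx.
rewrite count_cat !count_map !count_cat.
have [[w1 [w2 [h1 [h2 [t1 [t2 [V [psi ch]]]]]]]]|all1] := classification conn H2.
  rewrite (count_describes2 Qx V ch) /preim /=.
  rewrite (eq_count (a2 := pred0)) ?count_pred0 // => -[[[l1 l2] l3] t].
  by apply/asboolP => -[V' [psi' ch']]; exact: chart1_not_chart2 V' ch' V ch.
rewrite (count_describes1 Qx all1) /preim /=.
rewrite (eq_count (a2 := pred0)) ?count_pred0 // => -[[[[w1 w2] h1] h2] [t1 t2]].
apply/asboolP => -[V' [psi' ch']]; have [a Ca] := exists_cone H2.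
have [l1 [l2 [l3 [H [t [V [psi ch _]]]]]]] := all1 a Ca.
exact: chart1_not_chart2 V ch V' ch'.
Qed.

End ClassCount.

(** * Liouville's method *)

Lemma big_seq_bij (R : Type) (idx : R) (op : Monoid.com_law idx) (T1 T2 : eqType)
    (s1 : seq T1) (s2 : seq T2) (P1 : pred T1) (P2 : pred T2) (f : T1 -> T2) (g : T2 -> T1)
    (F : T2 -> R) : uniq s1 -> uniq s2 ->
  (forall x, x \in s1 -> P1 x -> [/\ f x \in s2, P2 (f x) & g (f x) = x]) ->
  (forall y, y \in s2 -> P2 y -> [/\ g y \in s1, P1 (g y) & f (g y) = y]) ->
  \big[op/idx]_(x <- s1 | P1 x) F (f x) = \big[op/idx]_(y <- s2 | P2 y) F y.
Proof.
move=> u1 u2 Hf Hg; rewrite -big_filter -[RHS]big_filter -(big_map f xpredT F); apply: perm_big.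
apply: uniq_perm; rewrite ?filter_uniq //.
  rewrite map_inj_in_uniq ?filter_uniq // => x y; rewrite !mem_filter.
  move=> /andP[Px sx] /andP[Py sy] E.
  by have [_ _ <-] := Hf x sx Px; have [_ _ <-] := Hf y sy Py; rewrite E.
move=> y; apply/mapP/idP => [[x]|]; rewrite !mem_filter => /andP[].
  by move=> Px sx ->; have [-> -> _] := Hf x sx Px.
by move=> Py sy; have [A C E] := Hg y sy Py; exists (g y); rewrite ?mem_filter ?C.
Qed.

Local Open Scope ring_scope.

Definition qsum n (F : nat -> nat -> nat -> nat -> rat) : rat :=
  \sum_(q <- quads n) let: (a, b, x, y) := q in F a b x y.

Section Quads.
Variable n : nat.
Implicit Types F G : nat -> nat -> nat -> nat -> rat.
Local Notation qsum := (qsum n).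

Lemma eq_qsum F G :
  (forall a b x y, (0 < a)%N -> (0 < b)%N -> (0 < x)%N -> (0 < y)%N ->
     (a * x + b * y = n)%N -> F a b x y = G a b x y) -> qsum F = qsum G.
Proof.
move=> E; apply: eq_big_seq => -[[[a b] x] y].
by rewrite mem_quads => /and5P[? ? ? ? /eqP ?]; apply: E.
Qed.

Lemma qsumD F G : qsum (fun a b x y => F a b x y + G a b x y) = qsum F + qsum G.
Proof. by rewrite /qsum -big_split /=; apply: eq_bigr => -[[[a b] x] y]. Qed.

Lemma qsumZ c F : qsum (fun a b x y => c * F a b x y) = c * qsum F.
Proof. by rewrite /qsum big_distrr /=; apply: eq_bigr => -[[[a b] x] y]. Qed.

Lemma qsum_swap F : qsum (fun a b x y => F b a y x) = qsum F.
Proof.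
pose f (q : nat * nat * nat * nat) := let: (a, b, x, y) := q in (b, a, y, x).
rewrite /qsum -(@big_seq_bij _ _ _ _ _ (quads n) (quads n) predT predT f f) ?quads_uniq //.
- by apply: eq_bigr => -[[[a b] x] y].
- by move=> [[[a b] x] y]; rewrite !mem_quads => H _; split=> //; lia.
by move=> [[[a b] x] y]; rewrite !mem_quads => H _; split=> //; lia.
Qed.

(* Liouville's substitution (a, b, x, y) -> (a, a + b, x - y, y). *)
Lemma qsum_shift F : qsum (fun a b x y => (y < x)%N%:R * F a (a + b)%N (x - y)%N y) =
  qsum (fun a b x y => (a < b)%N%:R * F a b x y).
Proof.
pose f (q : nat * nat * nat * nat) := let: (a, b, x, y) := q in (a, a + b, x - y, y)%N.
pose g (q : nat * nat * nat * nat) := let: (a, b, x, y) := q in (a, b - a, x + y, y)%N.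
pose P1 (q : nat * nat * nat * nat) := let: (a, b, x, y) := q in (y < x)%N.
pose P2 (q : nat * nat * nat * nat) := let: (a, b, x, y) := q in (a < b)%N.
pose F' (q : nat * nat * nat * nat) := let: (a, b, x, y) := q in F a b x y.
transitivity (\sum_(q <- quads n | P1 q) F' (f q)).
  rewrite [RHS]big_mkcond; apply: eq_bigr => -[[[a b] x] y] _ /=.
  by case: ifP; rewrite ?mul1r ?mul0r.
transitivity (\sum_(q <- quads n | P2 q) F' q); last first.
  rewrite [LHS]big_mkcond; apply: eq_bigr => -[[[a b] x] y] _ /=.
  by case: ifP; rewrite ?mul1r ?mul0r.
apply: (@big_seq_bij _ _ _ _ _ _ _ P1 P2 f g); rewrite ?quads_uniq //.
  move=> [[[a b] x] y]; rewrite mem_quads /f /g /P1 /P2 mem_quads => H xy; split; [nia|lia|].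
  by congr (_, _, _, _); lia.
move=> [[[a b] x] y]; rewrite mem_quads /f /g /P1 /P2 mem_quads => H xy; split; [nia|lia|].
by congr (_, _, _, _); lia.
Qed.

Lemma qsum_shift' F : qsum (fun a b x y => (x < y)%N%:R * F (a + b)%N b x (y - x)%N) =
  qsum (fun a b x y => (b < a)%N%:R * F a b x y).
Proof.
rewrite -qsum_swap -[RHS]qsum_swap -(qsum_shift (fun a b x y => F b a y x)).
by apply: eq_qsum => a b x y *; rewrite addnC.
Qed.

Lemma qsum_split_xy F : qsum F = qsum (fun a b x y => (x < y)%N%:R * F a b x y) +
  qsum (fun a b x y => (y < x)%N%:R * F a b x y) +
  qsum (fun a b x y => (x == y)%N%:R * F a b x y).
Proof.
rewrite -!qsumD; apply: eq_qsum => a b x y _ _ _ _ _.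
by case: ltngtP; rewrite ?mul1r ?mul0r ?addr0 ?add0r.
Qed.

Lemma qsum_split_ab F : qsum F = qsum (fun a b x y => (a < b)%N%:R * F a b x y) +
  qsum (fun a b x y => (b < a)%N%:R * F a b x y) +
  qsum (fun a b x y => (a == b)%N%:R * F a b x y).
Proof.
rewrite -!qsumD; apply: eq_qsum => a b x y _ _ _ _ _.
by case: ltngtP; rewrite ?mul1r ?mul0r ?addr0 ?add0r.
Qed.

(** For x = y the equation is (a + b) x = n, and d stands for a + b. *)
Lemma qsum_diag_xy F : (0 < n)%N -> qsum (fun a b x y => (x == y)%N%:R * F a b x y) =
  \sum_(d <- divisors n) \sum_(1 <= a < d) F a (d - a)%N (n %/ d)%N (n %/ d)%N.
Proof.
move=> n0; pose s := [seq (d, a) | d <- divisors n, a <- index_iota 1 d].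
pose G (p : nat * nat) := F p.2 (p.1 - p.2)%N (n %/ p.1)%N (n %/ p.1)%N.
transitivity (\sum_(p <- s) G p); last by rewrite big_allpairs_dep.
pose P (q : nat * nat * nat * nat) := let: (a, b, x, y) := q in (x == y)%N.
pose f (q : nat * nat * nat * nat) := let: (a, b, x, y) := q in (a + b, a)%N.
pose g (p : nat * nat) := (p.2, p.1 - p.2, n %/ p.1, n %/ p.1)%N.
have us : uniq s.
  apply: allpairs_uniq_dep; rewrite ?divisors_uniq //.
    by move=> d _; exact: iota_uniq.
  by move=> [d a] [d' a'] _ _ [-> ->].
have ms d a : ((d, a) \in s) = (d %| n)%N && (0 < a < d)%N.
  apply/allpairsPdep/andP => [[d' [a' []]]|[dn ad]].
    by rewrite -dvdn_divisors // mem_index_iota => ? ? [-> ->].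
  by exists d, a; rewrite -dvdn_divisors // mem_index_iota.
rewrite -(@big_seq_bij _ _ _ _ _ (quads n) s P predT f g) ?quads_uniq //.
- rewrite [RHS]big_mkcond; apply: eq_big_seq => -[[[a b] x] y].
  rewrite mem_quads => /and5P[a0 b0 x0 y0 /eqP E] /=.
  case: eqP => xy; rewrite ?mul1r ?mul0r // /G /= addKn.
  have -> : n = (x * (a + b))%N by rewrite -E xy; lia.
  by rewrite mulnK -?xy //; lia.
- move=> [[[a b] x] y]; rewrite mem_quads /P /f /g => /and5P[a0 b0 x0 y0 /eqP E] /eqP xy.
  have En : n = (x * (a + b))%N by rewrite -E xy; lia.
  rewrite ms {1}En dvdn_mull // addKn En mulnK ?xy; last lia.
  by split=> //; lia.
move=> [d a]; rewrite ms /P /f /g => /andP[dn ad] _; rewrite mem_quads; split=> //.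
  have := divnK dn; move: (n %/ d)%N => k E.
  have k0 : (0 < k)%N by rewrite lt0n; apply/eqP=> k0; move: n0; rewrite -E k0.
  apply/and5P; split=> /=; try lia.
by rewrite /= subnKC //; lia.
Qed.

(** For a = b = d the equation is d (x + y) = n. *)
Lemma qsum_diag_ab F : (0 < n)%N -> qsum (fun a b x y => (a == b)%N%:R * F a b x y) =
  \sum_(d <- divisors n) \sum_(1 <= x < n %/ d) F d d x (n %/ d - x)%N.
Proof.
move=> n0; pose s := [seq (d, a) | d <- divisors n, a <- index_iota 1 (n %/ d)].
pose G (p : nat * nat) := F p.1 p.1 p.2 (n %/ p.1 - p.2)%N.
transitivity (\sum_(p <- s) G p); last by rewrite big_allpairs_dep.
pose P (q : nat * nat * nat * nat) := let: (a, b, x, y) := q in (a == b)%N.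
pose f (q : nat * nat * nat * nat) := let: (a, b, x, y) := q in (a, x)%N.
pose g (p : nat * nat) := (p.1, p.1, p.2, n %/ p.1 - p.2)%N.
have us : uniq s.
  apply: allpairs_uniq_dep; rewrite ?divisors_uniq //.
    by move=> d _; exact: iota_uniq.
  by move=> [d a] [d' a'] _ _ [-> ->].
have ms d a : ((d, a) \in s) = (d %| n)%N && (0 < a < n %/ d)%N.
  apply/allpairsPdep/andP => [[d' [a' []]]|[dn ad]].
    by rewrite -dvdn_divisors // mem_index_iota => ? ? [-> ->].
  by exists d, a; rewrite -dvdn_divisors // mem_index_iota.
rewrite -(@big_seq_bij _ _ _ _ _ (quads n) s P predT f g) ?quads_uniq //.
- rewrite [RHS]big_mkcond; apply: eq_big_seq => -[[[a b] x] y].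
  rewrite mem_quads => /and5P[a0 b0 x0 y0 /eqP E] /=.
  case: eqP => xy; rewrite ?mul1r ?mul0r // /G /=.
  have -> : n = (a * (x + y))%N by rewrite -E xy; lia.
  by rewrite mulKn // addKn -xy.
- move=> [[[a b] x] y]; rewrite mem_quads /P /f /g => /and5P[a0 b0 x0 y0 /eqP E] /eqP xy.
  have En : n = (a * (x + y))%N by rewrite -E xy; lia.
  rewrite ms {1}En dvdn_mulr // En mulKn // addKn xy.
  by split=> //; lia.
move=> [d a]; rewrite ms /P /f /g => /andP[dn ad] _; rewrite mem_quads; split=> //.
have d0 : (0 < d)%N by exact: dvdn_gt0 dn.
have := divnK dn; move: (n %/ d)%N ad => k ad E; apply/and5P; split=> /=; try lia.
Qed.

End Quads.

Local Close Scope ring_scope.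

Local Open Scope ring_scope.

Definition sigma k n : rat := \sum_(d <- divisors n) d%:R ^+ k.

Lemma odd_part d : odd d -> d = (d./2).*2.+1.
Proof. lia. Qed.

Lemma sum_step2 (F : nat -> rat) k :
  \sum_(1 <= a < k.+1.*2.+1) F a = \sum_(1 <= a < k.*2.+1) F a + F k.*2.+1 + F k.*2.+2.
Proof. by rewrite doubleS big_nat_recr //= big_nat_recr. Qed.

Lemma sum_even_sq d : odd d ->
  \sum_(1 <= a < d) (~~ odd a)%:R * a%:R ^+ 2 = (d%:R ^+ 3 - d%:R) / 6 :> rat.
Proof.
move=> /odd_part ->; move: d./2 => k {d}; elim: k => [|k IH]; first by rewrite big_geq // double0; field.
rewrite sum_step2 IH /= odd_double /=.
have -> : k.+1.*2.+1 = (2 * k + 3)%N by lia.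
have -> : k.*2.+2 = (2 * k + 2)%N by lia.
have -> : k.*2.+1 = (2 * k + 1)%N by lia.
by rewrite !(natrD _ (2 * k)) !(natrM _ 2); field.
Qed.

Lemma sum_odd_sq d : odd d -> \sum_(1 <= a < d) (odd a)%:R * a%:R ^+ 2 =
  (d%:R ^+ 3 - 3 * d%:R ^+ 2 + 2 * d%:R) / 6 :> rat.
Proof.
move=> /odd_part ->; move: d./2 => k {d}; elim: k => [|k IH]; first by rewrite big_geq // double0; field.
rewrite sum_step2 IH /= odd_double /=.
have -> : k.+1.*2.+1 = (2 * k + 3)%N by lia.
have -> : k.*2.+2 = (2 * k + 2)%N by lia.
have -> : k.*2.+1 = (2 * k + 1)%N by lia.
by rewrite !(natrD _ (2 * k)) !(natrM _ 2); field.
Qed.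

Lemma sum_odd_count d : odd d -> \sum_(1 <= a < d) (odd a)%:R = (d%:R - 1) / 2 :> rat.
Proof.
move=> /odd_part ->; move: d./2 => k {d}; elim: k => [|k IH]; first by rewrite big_geq // double0; field.
rewrite sum_step2 IH /= odd_double /=.
have -> : k.+1.*2.+1 = (2 * k + 3)%N by lia.
have -> : k.*2.+1 = (2 * k + 1)%N by lia.
by rewrite !(natrD _ (2 * k)) !(natrM _ 2); field.
Qed.

Section Odd.
Variable n : nat.
Hypothesis n_odd : odd n.
Let n0 : (0 < n)%N. Proof. by case: n n_odd. Qed.

Lemma odd_divisors d : d \in divisors n -> odd d /\ odd (n %/ d).
Proof.
rewrite -dvdn_divisors // => dn; have := n_odd; rewrite -{1}(divnK dn) oddM.
by case/andP.
Qed.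

Lemma quad_parity a b x y : (a * x + b * y = n)%N ->
  (odd a && odd x) (+) (odd b && odd y).
Proof. by move=> E; rewrite -!oddM -oddD E. Qed.

Ltac parity := rewrite ?oddD ?natrD;
  repeat match goal with |- context [odd ?a] => case: (odd a) end; rewrite /=; try done; try (move=> *; ring).

Definition widths_odd a b := (odd a && odd b)%:R * (a%:R * b%:R) : rat.
Definition widths_mixed a b := (odd a && ~~ odd b)%:R * (a%:R * b%:R) : rat.
(** Here y is the height of the cylinder of even width b, the only height on which the type depends
    when the widths have different parities. *)
Definition widths_mixed_h a b y := (odd a && ~~ odd b && odd y)%:R * (a%:R * b%:R) : rat.

(** Let S(c) be the sum of [K] under the condition c. The substitution evaluates the sum of (a +
    b)^2 as 2 S(a < b) and that of (a - b)^2 as 2 S(y < x). By [E3], and because both ways of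
    splitting [K] have the same total, S(a < b) - S(y < x) = S(x = y) - S(a = b). *)
Lemma qsum_widths_odd :
  qsum n (fun a b x y => widths_odd a b) = (sigma 3 n - sigma 1 n) / 12.
Proof.
pose K (a b x y : nat) : rat := (odd a && ~~ odd b)%:R * b%:R ^+ 2.
pose Dsum (a b x y : nat) : rat := (odd a && odd b)%:R * (a%:R + b%:R) ^+ 2.
pose Ddif (a b x y : nat) : rat := (odd a && odd b)%:R * (a%:R - b%:R) ^+ 2.
have E1 : qsum n Dsum = 2 * qsum n (fun a b x y => (a < b)%N%:R * K a b x y).
  rewrite qsum_split_xy.
  have A1 : qsum n (fun a b x y => (y < x)%N%:R * Dsum a b x y) =
      qsum n (fun a b x y => (a < b)%N%:R * K a b x y).
    rewrite -qsum_shift; apply: eq_qsum => a b x y *; congr (_ * _).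
    by rewrite /K /Dsum; parity.
  have -> : qsum n (fun a b x y => (x < y)%N%:R * Dsum a b x y) =
      qsum n (fun a b x y => (a < b)%N%:R * K a b x y).
    rewrite -A1 -qsum_swap; apply: eq_qsum => a b x y *; congr (_ * _).
    by rewrite /Dsum; parity.
  (* With a and b odd, x = y would make n even. *)
  have -> : qsum n (fun a b x y => (x == y)%N%:R * Dsum a b x y) = 0.
    rewrite -[RHS](mul0r (qsum n Dsum)) -qsumZ; apply: eq_qsum => a b x y _ _ _ _ /quad_parity.
    rewrite /Dsum; have [->|] := eqVneq x y; last by rewrite !mul0r.
    by parity.
  by rewrite A1; ring.
have E2 : qsum n Ddif = 2 * qsum n (fun a b x y => (y < x)%N%:R * K a b x y).
  rewrite qsum_split_ab.
  have A1 : qsum n (fun a b x y => (a < b)%N%:R * Ddif a b x y) =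
      qsum n (fun a b x y => (y < x)%N%:R * K a b x y).
    rewrite -qsum_shift; apply: eq_qsum => a b x y *; congr (_ * _).
    by rewrite /K /Ddif; parity.
  have -> : qsum n (fun a b x y => (b < a)%N%:R * Ddif a b x y) =
      qsum n (fun a b x y => (y < x)%N%:R * K a b x y).
    rewrite -A1 -qsum_swap; apply: eq_qsum => a b x y *; congr (_ * _).
    by rewrite /Ddif; parity.
  have -> : qsum n (fun a b x y => (a == b)%N%:R * Ddif a b x y) = 0.
    rewrite -[RHS](mul0r (qsum n Ddif)) -qsumZ; apply: eq_qsum => a b x y *.
    by rewrite /Ddif; have [->|] := eqVneq a b; rewrite ?subrr ?mul0r ?mulr0 // expr0n mulr0 mulr0.
  by rewrite A1; ring.
have E3 : qsum n (fun a b x y => (x < y)%N%:R * K a b x y) =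
    qsum n (fun a b x y => (b < a)%N%:R * K a b x y).
  rewrite -qsum_shift'; apply: eq_qsum => a b x y *; congr (_ * _).
  by rewrite /K; parity.
have E4 : qsum n (fun a b x y => (a == b)%N%:R * K a b x y) = 0.
  rewrite -[RHS](mul0r (qsum n K)) -qsumZ; apply: eq_qsum => a b x y *.
  by rewrite /K; have [->|] := eqVneq a b; rewrite ?mul0r //; parity.
have E5 : qsum n (fun a b x y => (x == y)%N%:R * K a b x y) = (sigma 3 n - sigma 1 n) / 6.
  rewrite -qsum_swap.
  rewrite (eq_qsum (G := fun a b x y => (x == y)%N%:R * ((odd b && ~~ odd a)%:R * a%:R ^+ 2))).
    rewrite qsum_diag_xy // /sigma -sumrB big_distrl /=; apply: eq_big_seq => d /odd_divisors[od _].
    rewrite expr1 -sum_even_sq //; apply: eq_big_nat => a /andP[_ ad].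
    by rewrite oddB ?(ltnW ad) // od; case: (odd a).
  by move=> a b x y *; rewrite eq_sym.
have := qsum_split_xy n K; rewrite (qsum_split_ab n K) E3 E4 E5 => E6.
have : qsum n Dsum - qsum n Ddif = 4 * qsum n (fun a b x y => widths_odd a b).
  rewrite -mulN1r -!qsumZ -qsumD; apply: eq_qsum => a b x y *.
  by rewrite /Dsum /Ddif /widths_odd; ring.
by rewrite E1 E2; lra.
Qed.
Lemma sum_cofactor_sq :
  \sum_(d <- divisors n) d%:R ^+ 2 * ((n %/ d)%:R - 1) = n%:R * sigma 1 n - sigma 2 n.
Proof.
rewrite /sigma big_distrr -sumrB; apply: eq_big_seq => d.
rewrite -dvdn_divisors // => dn; rewrite -[in RHS](divnK dn) natrM /=; ring.
Qed.

Lemma diag_top_mixed (F : nat -> nat -> nat -> nat -> rat) :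
  (forall a b x, odd x -> F a b x x = (odd a && ~~ odd b)%:R * (a%:R + b%:R) ^+ 2) ->
  qsum n (fun a b x y => (x == y)%N%:R * F a b x y) = (sigma 3 n - sigma 2 n) / 2.
Proof.
move=> FE; rewrite qsum_diag_xy // /sigma -sumrB big_distrl /=.
apply: eq_big_seq => d /odd_divisors[od oe].
transitivity (d%:R ^+ 2 * \sum_(1 <= a < d) (odd a)%:R : rat); last first.
  by rewrite sum_odd_count //; field.
rewrite big_distrr /=; apply: eq_big_nat => a /andP[_ ad].
rewrite FE // -natrD subnKC 1?ltnW // oddB 1?ltnW // od.
by case: (odd a) => /=; ring.
Qed.

(** The scheme of [qsum_widths_odd], except that the parts y < x and x < y of the sum of (a + b)^2
    now give the terms of [J] with b odd and with b even, and that the diagonal x = y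
    contributes. *)
Lemma qsum_widths_mixed : qsum n (fun a b x y => widths_mixed a b) =
  sigma 3 n / 6 - n%:R * sigma 1 n / 4 + sigma 1 n / 12.
Proof.
pose J (a b x y : nat) : rat := (odd a)%:R * a%:R ^+ 2.
pose Jo (a b x y : nat) : rat := (odd a && odd b)%:R * a%:R ^+ 2.
pose Je (a b x y : nat) : rat := (odd a && ~~ odd b)%:R * a%:R ^+ 2.
pose Dsum (a b x y : nat) : rat := (odd a && ~~ odd b)%:R * (a%:R + b%:R) ^+ 2.
pose Ddif (a b x y : nat) : rat := (odd a && ~~ odd b)%:R * (a%:R - b%:R) ^+ 2.
have JJ (c : nat -> nat -> nat -> nat -> rat) : qsum n (fun a b x y => c a b x y * J a b x y) =
    qsum n (fun a b x y => c a b x y * Jo a b x y) +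
    qsum n (fun a b x y => c a b x y * Je a b x y).
  rewrite -qsumD; apply: eq_qsum => a b x y *; rewrite -mulrDr; congr (_ * _).
  by rewrite /J /Jo /Je; parity.
have E1 : qsum n Dsum = qsum n (fun a b x y => (b < a)%N%:R * J a b x y) +
    (sigma 3 n - sigma 2 n) / 2.
  rewrite qsum_split_xy JJ; congr (_ + _); last exact: diag_top_mixed.
  rewrite addrC; congr (_ + _).
    rewrite -[RHS]qsum_swap -(qsum_shift _ (fun a b x y => Jo b a y x)).
    apply: eq_qsum => a b x y *; congr (_ * _).
    by rewrite /Jo /Dsum; parity.
  rewrite -qsum_shift'; apply: eq_qsum => a b x y *; congr (_ * _).
  by rewrite /Je /Dsum; parity.
have E2 : qsum n Ddif = qsum n (fun a b x y => (x < y)%N%:R * J a b x y).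
  rewrite qsum_split_ab JJ.
  have -> : qsum n (fun a b x y => (a == b)%N%:R * Ddif a b x y) = 0.
    rewrite -[RHS](mul0r (qsum n Ddif)) -qsumZ; apply: eq_qsum => a b x y *.
    by rewrite /Ddif; have [->|] := eqVneq a b; rewrite ?mul0r //; parity.
  rewrite addr0; congr (_ + _).
    rewrite -qsum_shift -qsum_swap; apply: eq_qsum => a b x y *; congr (_ * _).
    by rewrite /Jo /Ddif; parity.
  rewrite -qsum_shift'; apply: eq_qsum => a b x y *; congr (_ * _).
  by rewrite /Je /Ddif; parity.
have E3 : qsum n (fun a b x y => (y < x)%N%:R * J a b x y) =
    qsum n (fun a b x y => (a < b)%N%:R * J a b x y).
  by rewrite -qsum_shift.
have E4 : qsum n (fun a b x y => (a == b)%N%:R * J a b x y) = n%:R * sigma 1 n - sigma 2 n.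
  rewrite qsum_diag_ab // -sum_cofactor_sq; apply: eq_big_seq => d dn.
  have [od oe] := odd_divisors dn; rewrite /J od mul1r sumr_const_nat.
  by rewrite -[LHS]mulr_natr natrB //; case: (n %/ d)%N oe.
have E5 : qsum n (fun a b x y => (x == y)%N%:R * J a b x y) =
    (sigma 3 n - 3 * sigma 2 n + 2 * sigma 1 n) / 6.
  rewrite qsum_diag_xy // /sigma !big_distrr -sumrB -big_split big_distrl /=.
  by apply: eq_big_seq => d /odd_divisors[od _]; rewrite /J sum_odd_sq // expr1.
have := qsum_split_xy n J; rewrite (qsum_split_ab n J) E3 E4 E5 => E6.
have : qsum n Dsum - qsum n Ddif = 4 * qsum n (fun a b x y => widths_mixed a b).
  rewrite -mulN1r -!qsumZ -qsumD; apply: eq_qsum => a b x y *.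
  by rewrite /Dsum /Ddif /widths_mixed; ring.
by rewrite E1 E2; lra.
Qed.

(** The same scheme with a condition on y; [quad_parity] relates this condition before and after the
    substitution. *)
Lemma qsum_widths_mixed_h : qsum n (fun a b x y => widths_mixed_h a b y) =
  (sigma 3 n - n%:R * sigma 1 n) / 8.
Proof.
pose M (a b x y : nat) : rat := (odd a && ~~ odd y)%:R * a%:R ^+ 2.
pose Mo (a b x y : nat) : rat := (odd a && odd b && ~~ odd y)%:R * a%:R ^+ 2.
pose Me (a b x y : nat) : rat := (odd a && ~~ odd b && ~~ odd y)%:R * a%:R ^+ 2.
pose Dsum (a b x y : nat) : rat := (odd a && ~~ odd b && odd y)%:R * (a%:R + b%:R) ^+ 2.
pose Ddif (a b x y : nat) : rat := (odd a && ~~ odd b && odd y)%:R * (a%:R - b%:R) ^+ 2.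
have MM (c : nat -> nat -> nat -> nat -> rat) : qsum n (fun a b x y => c a b x y * M a b x y) =
    qsum n (fun a b x y => c a b x y * Mo a b x y) +
    qsum n (fun a b x y => c a b x y * Me a b x y).
  rewrite -qsumD; apply: eq_qsum => a b x y *; rewrite -mulrDr; congr (_ * _).
  by rewrite /M /Mo /Me; parity.
have E1 : qsum n Dsum = qsum n (fun a b x y => (b < a)%N%:R * M a b x y) +
    (sigma 3 n - sigma 2 n) / 2.
  rewrite qsum_split_xy MM; congr (_ + _).
    rewrite addrC; congr (_ + _).
      rewrite -[RHS]qsum_swap -(qsum_shift _ (fun a b x y => Mo b a y x)).
      apply: eq_qsum => a b x y _ _ _ _ /quad_parity par.
      have [yx|] := boolP (y < x)%N; last by rewrite !mul0r.
      congr (_ * _); move: par; rewrite /Mo /Dsum oddB; last exact: ltnW.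
      by parity.
    rewrite -qsum_shift'; apply: eq_qsum => a b x y _ _ _ _ /quad_parity par.
    have [yx|] := boolP (x < y)%N; last by rewrite !mul0r.
    congr (_ * _); move: par; rewrite /Me /Dsum oddB; last exact: ltnW.
    by parity.
  by apply: diag_top_mixed => a b x ox; rewrite /Dsum ox andbT.
have E2 : qsum n Ddif = qsum n (fun a b x y => (x < y)%N%:R * M a b x y).
  rewrite qsum_split_ab MM.
  have -> : qsum n (fun a b x y => (a == b)%N%:R * Ddif a b x y) = 0.
    rewrite -[RHS](mul0r (qsum n Ddif)) -qsumZ; apply: eq_qsum => a b x y *.
    by rewrite /Ddif; have [->|] := eqVneq a b; rewrite ?mul0r //; parity.
  rewrite addr0; congr (_ + _).
    rewrite -qsum_shift -qsum_swap; apply: eq_qsum => a b x y _ _ _ _ /quad_parity par.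
    congr (_ * _); move: par; rewrite /Mo /Ddif.
    by parity.
  rewrite -qsum_shift'; apply: eq_qsum => a b x y _ _ _ _ /quad_parity par.
  have [yx|] := boolP (x < y)%N; last by rewrite !mul0r.
  congr (_ * _); move: par; rewrite /Me /Ddif oddB; last exact: ltnW.
  by parity.
have E3 : qsum n (fun a b x y => (y < x)%N%:R * M a b x y) =
    qsum n (fun a b x y => (a < b)%N%:R * M a b x y).
  by rewrite -qsum_shift.
have E4 : qsum n (fun a b x y => (a == b)%N%:R * M a b x y) =
    (n%:R * sigma 1 n - sigma 2 n) / 2.
  rewrite qsum_diag_ab // -sum_cofactor_sq big_distrl /=; apply: eq_big_seq => d dn.
  have [od oe] := odd_divisors dn.
  transitivity (d%:R ^+ 2 * \sum_(1 <= x < n %/ d) (odd x)%:R : rat); last first.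
    by rewrite sum_odd_count //; field.
  rewrite big_distrr; apply: eq_big_nat => x /andP[_ xd]; rewrite /M od oddB ?oe 1?ltnW //.
  by case: (odd x) => /=; ring.
have E5 : qsum n (fun a b x y => (x == y)%N%:R * M a b x y) = 0.
  rewrite -[RHS](mul0r (qsum n M)) -qsumZ; apply: eq_qsum => a b x y _ _ _ _ /quad_parity.
  rewrite /M; have [->|] := eqVneq x y; last by rewrite !mul0r.
  by parity.
have := qsum_split_xy n M; rewrite (qsum_split_ab n M) E3 E4 E5 => E6.
have : qsum n Dsum - qsum n Ddif = 4 * qsum n (fun a b x y => widths_mixed_h a b y).
  rewrite -mulN1r -!qsumZ -qsumD; apply: eq_qsum => a b x y *.
  by rewrite /Dsum /Ddif /widths_mixed_h; ring.
by rewrite E1 E2; lra.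
Qed.

End Odd.

Local Close Scope ring_scope.

(** * Dirichlet convolutions *)

Local Open Scope ring_scope.

Lemma quo_gt0 n d : (0 < n)%N -> (d %| n)%N -> (0 < n %/ d)%N.
Proof. by move=> n0 dn; rewrite divn_gt0 ?(dvdn_gt0 n0 dn) // dvdn_leq. Qed.

Lemma dirichlet_swap n (f : nat -> nat -> rat) : (0 < n)%N ->
  \sum_(m <- divisors n) \sum_(e <- divisors (n %/ m)) f m e =
  \sum_(e <- divisors n) \sum_(m <- divisors (n %/ e)) f m e.
Proof.
move=> n0; pose s := [seq (m, e) | m <- divisors n, e <- divisors (n %/ m)].
have us : uniq s.
  apply: allpairs_uniq_dep; rewrite ?divisors_uniq //.
    by move=> d _; exact: divisors_uniq.
  by move=> [d a] [d' a'] _ _ [-> ->].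
have ms m e : ((m, e) \in s) = (e * m %| n)%N.
  apply/allpairsPdep/idP => [[d' [a' []]]|emn].
    rewrite -dvdn_divisors // => d'n; rewrite -dvdn_divisors; last exact: quo_gt0.
    by rewrite dvdn_divRL // => ? [-> ->].
  have mn : (m %| n)%N by apply: dvdn_trans emn; exact: dvdn_mull.
  exists m, e; rewrite -!dvdn_divisors //; last exact: quo_gt0.
  by rewrite dvdn_divRL.
pose fl (p : nat * nat) := (p.2, p.1).
transitivity (\sum_(p <- s) f p.1 p.2); first by rewrite big_allpairs_dep.
transitivity (\sum_(p <- s) f p.2 p.1); last by rewrite big_allpairs_dep.
apply: (@big_seq_bij _ _ _ _ _ s s predT predT fl fl (fun p => f p.2 p.1)) => //.
  by move=> [m e]; rewrite !ms mulnC.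
by move=> [m e]; rewrite !ms mulnC.
Qed.

Lemma divisors_rev n (F : nat -> rat) : (0 < n)%N ->
  \sum_(d <- divisors n) F (n %/ d)%N = \sum_(d <- divisors n) F d.
Proof.
move=> n0; have aux d : d \in divisors n -> (n %/ d)%N \in divisors n /\ (n %/ (n %/ d) = d)%N.
  rewrite -!dvdn_divisors // => dn; split; last first.
    by rewrite -{1}(divnK dn) mulKn ?quo_gt0.
  by rewrite -{2}(divnK dn) dvdn_mulr.
apply: (@big_seq_bij _ _ _ _ _ _ _ predT predT (fun d => n %/ d)%N (fun d => n %/ d)%N);
  rewrite ?divisors_uniq //.
  by move=> d /aux[].
by move=> d /aux[].
Qed.

Lemma dirichlet_sigma n (F : nat -> rat) : (0 < n)%N ->
  \sum_(m <- divisors n) sigma 1 (n %/ m) * F m =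
  \sum_(e <- divisors n) e%:R * \sum_(m <- divisors (n %/ e)) F m.
Proof.
move=> n0; transitivity (\sum_(m <- divisors n) \sum_(e <- divisors (n %/ m)) e%:R * F m).
  by apply: eq_bigr => m _; rewrite /sigma big_distrl /=; apply: eq_bigr => e _; rewrite expr1.
rewrite dirichlet_swap //; apply: eq_bigr => e _.
by rewrite big_distrr.
Qed.

(** As Dirichlet convolutions, sigma_1 is the constant 1 convolved with the identity, and convolving
    the identity with m g(m) gives w times the sum of g over the divisors of w. *)
Lemma dirichlet_sigma_id n (g : nat -> rat) : (0 < n)%N ->
  \sum_(m <- divisors n) sigma 1 (n %/ m) * (m%:R * g m) =
  \sum_(w <- divisors n) w%:R * \sum_(m <- divisors w) g m.
Proof.
move=> n0.
transitivity (\sum_(m <- divisors n) \sum_(e <- divisors (n %/ m)) (n %/ e)%:R * g m).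
  apply: eq_big_seq => m; rewrite -dvdn_divisors // => mn.
  have m0 : (0 < m)%N by exact: dvdn_gt0 n0 mn.
  have nm0 : (0 < n %/ m)%N by exact: quo_gt0.
  rewrite /sigma -divisors_rev // big_distrl /=; apply: eq_big_seq => e.
  rewrite -dvdn_divisors // => emn; rewrite expr1 mulrA; congr (_ * _).
  rewrite -natrM; congr (_%:R).
  have e0 : (0 < e)%N by exact: dvdn_gt0 nm0 emn.
  rewrite -[in RHS](divnK mn) -{2}(divnK emn) -mulnA [(e * m)%N]mulnC mulnA mulnK //.
rewrite dirichlet_swap // -[RHS]divisors_rev //; apply: eq_bigr => e _.
by rewrite big_distrr.
Qed.

Definition jordan2 n : rat := n%:R ^+ 2 * prime_factor_prod n.

Lemma prime_factor_prod_coprime p k m : prime p -> (0 < m)%N -> ~~ (p %| m)%N -> (0 < k)%N ->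
  prime_factor_prod (p ^ k * m) = (1 - (p%:R ^+ 2)^-1) * prime_factor_prod m.
Proof.
move=> pp m0 pm k0; rewrite /prime_factor_prod.
rewrite (perm_big (p :: primes m)) ?big_cons //; apply: uniq_perm.
- exact: primes_uniq.
- by rewrite /= primes_uniq andbT mem_primes pp m0.
move=> q; have pk0 : (0 < p ^ k)%N by rewrite expn_gt0 prime_gt0.
by rewrite primesM // inE primesX // primes_prime // inE.
Qed.

(** The sum over the powers of p telescopes, since J_2(p^(i+1)) = p^(2i+2) - p^(2i). *)
Lemma sum_jordan2_coprime p k m : prime p -> (0 < m)%N -> ~~ (p %| m)%N ->
  \sum_(d <- divisors (p ^ k * m)) jordan2 d =
  p%:R ^+ (2 * k) * \sum_(d <- divisors m) jordan2 d.
Proof.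
move=> pp m0 pm; have p0 := prime_gt0 pp.
have pk0 i : (0 < p ^ i)%N by rewrite expn_gt0 p0.
pose s := [seq (i, d) | i <- iota 0 k.+1, d <- divisors m].
have ms i d : ((i, d) \in s) = (i <= k)%N && (d %| m)%N.
  apply/allpairsP/andP => [[[i' d'] []]|[ik dm]].
    by rewrite mem_iota -dvdn_divisors // => ? ? [-> ->].
  by exists (i, d); rewrite mem_iota -dvdn_divisors.
have us : uniq s.
  by apply: allpairs_uniq; rewrite ?iota_uniq ?divisors_uniq // => -[? ?] [? ?] _ _ [-> ->].
have logm d : (d %| m)%N -> logn p d = 0%N.
  move=> dm; apply/eqP; rewrite lognE pp (dvdn_gt0 m0 dm) /= .
  by case: ifP => // pd; rewrite (dvdn_trans pd dm) in pm.
rewrite -(@big_seq_bij _ _ _ _ _ s _ predT predT (fun z => p ^ z.1 * z.2)%N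
   (fun x => (logn p x, x %/ p ^ logn p x)%N)) ?divisors_uniq //.
- rewrite big_allpairs /= exchange_big /= big_distrr /=; apply: eq_big_seq => d.
  rewrite -dvdn_divisors // => dm.
  have d0 := dvdn_gt0 m0 dm.
  have pd : ~~ (p %| d)%N by apply: contra pm => /dvdn_trans; apply.
  have p2 : p%:R ^+ 2 != 0 :> rat by rewrite expf_eq0 /= pnatr_eq0 -lt0n.
  have step i : jordan2 (p ^ i.+1 * d) =
      (p%:R ^+ (2 * i.+1) - p%:R ^+ (2 * i)) * jordan2 d.
    rewrite /jordan2 prime_factor_prod_coprime // natrM natrX.
    have -> : (p%:R : rat) ^+ (2 * i.+1) = p%:R ^+ 2 * (p%:R ^+ i) ^+ 2.
      by rewrite -exprM -exprD; congr (_ ^+ _); lia.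
    have -> : (p%:R : rat) ^+ (2 * i) = (p%:R ^+ i) ^+ 2 by rewrite -exprM mulnC.
    by rewrite (exprS _ i); field; rewrite pnatr_eq0 -lt0n.
  clear s ms us; rewrite -[0%N :: iota 1 k]/(iota 0 k.+1).
  elim: k => [|k IH]; first by rewrite big_seq1 expn0 mul1n muln0 expr0 mul1r.
  have -> : iota 0 k.+2 = iota 0 k.+1 ++ [:: k.+1] by rewrite -(addn1 k.+1) iotaD.
  rewrite big_cat IH big_seq1 step.
  by rewrite /= -mulrDl; congr (_ * _); ring.
- move=> [i d]; rewrite ms => /andP[ik dm] _ /=; have d0 := dvdn_gt0 m0 dm.
  have L : logn p (p ^ i * d) = i.
    by rewrite lognM // pfactorK // logm // addn0.
  by rewrite L mulKn // -dvdn_divisors ?muln_gt0 ?pk0 // dvdn_mul // dvdn_exp2l.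
move=> x; rewrite -dvdn_divisors ?muln_gt0 ?pk0 // => xn _ /=.
have n0 : (0 < p ^ k * m)%N by rewrite muln_gt0 pk0.
have x0 := dvdn_gt0 n0 xn.
have [d pd Ex] : exists2 d, ~~ (p %| d)%N & x = (p ^ logn p x * d)%N.
  have [d cop E] := pfactor_coprime pp x0; exists d; last by rewrite mulnC.
  by rewrite -prime_coprime.
have K : (x %/ p ^ logn p x = d)%N by rewrite {1}Ex mulKn.
rewrite ms K; split=> //.
have le : (logn p x <= k)%N.
  by rewrite -(pfactorK k pp) -[logn p (p ^ k)]addn0 -(logm m) // -lognM // dvdn_leq_log.
rewrite le /=; have dx : (d %| p ^ k * m)%N by apply: dvdn_trans xn; rewrite Ex dvdn_mull.
by move: dx; rewrite Gauss_dvdr // coprime_sym coprimeXl // prime_coprime.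
Qed.

Lemma sum_jordan2 n : (0 < n)%N -> \sum_(d <- divisors n) jordan2 d = n%:R ^+ 2.
Proof.
elim/ltn_ind: n => n IH n0; have [n1|n1] := leqP n 1.
  have -> : n = 1%N by lia.
  by rewrite /divisors /= big_seq1 /jordan2 /prime_factor_prod big_nil mulr1.
have pp := pdiv_prime n1; set p := pdiv n in pp.
have [m cop E] := pfactor_coprime pp n0.
have pm : ~~ (p %| m)%N by rewrite -prime_coprime.
have m0 : (0 < m)%N by move: n0; rewrite E muln_gt0 => /andP[].
have k0 : (0 < logn p n)%N by rewrite logn_gt0 mem_primes pp n0 pdiv_dvd.
rewrite E mulnC sum_jordan2_coprime // IH //.
  by rewrite natrM natrX exprMn -exprM mulnC.
rewrite [X in (_ < X)%N]E -{1}[m]muln1 ltn_pmul2l // -(expn0 p) ltn_exp2l //.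
exact: prime_gt1.
Qed.

Local Close Scope ring_scope.

(** * Counting parameters *)

Definition twists2 bB w1 w2 h1 h2 : seq (nat * nat) :=
  [seq t <- allpairs pair (iota 0 w1) (iota 0 w2) | is_typeB2 w1 w2 h1 h2 t.1 t.2 == bB].

Definition all_params2 n bB : seq (nat * nat * nat * nat * (nat * nat)) :=
  [seq (q, t) | q <- [seq q <- quads n | q.1.1.1 < q.1.1.2],
                t <- twists2 bB q.1.1.1 q.1.1.2 q.1.2 q.2].

Lemma mem_all_params2 n bB w1 w2 h1 h2 t1 t2 :
  ((w1, w2, h1, h2, (t1, t2)) \in all_params2 n bB) =
  [&& valid2 w1 w2 h1 h2 t1 t2, w1 * h1 + w2 * h2 == n &
      is_typeB2 w1 w2 h1 h2 t1 t2 == bB].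
Proof.
apply/allpairsPdep/idP => [[q [t []]]|].
  case: q => -[[w1' w2'] h1'] h2'; case: t => t1' t2'.
  rewrite mem_filter mem_quads /= => /andP[lt /and5P[a b c d e]].
  rewrite mem_filter => /andP[/= ty]; move=> /allpairsP[[u1 u2] /= [+ + [Eu1 Eu2]]]; rewrite !mem_iota /= => U1 U2.
  case=> -> -> -> -> -> ->; rewrite ty e andbT andbT /valid2 a lt c d Eu1 Eu2; lia.
case/and3P=> /and5P[a lt c d /andP[e f]] g ty.
exists (w1, w2, h1, h2), (t1, t2); split=> //.
  by rewrite mem_filter /= lt mem_quads a c d g; lia.
rewrite mem_filter /= ty; apply/allpairsP; exists (t1, t2).
by rewrite !mem_iota /= e f.
Qed.

Lemma all_params2_uniq n bB : uniq (all_params2 n bB).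
Proof.
apply: allpairs_uniq_dep; first exact/filter_uniq/quads_uniq.
  move=> q _; apply/filter_uniq/allpairs_uniq; rewrite ?iota_uniq //.
  by move=> [? ?] [? ?] _ _.
by move=> [q t] [q' t'] _ _ [-> ->].
Qed.

Lemma count_pairs (P1 P2 : pred nat) s1 s2 :
  count (fun t => P1 t.1 && P2 t.2) (allpairs pair s1 s2) = count P1 s1 * count P2 s2.
Proof.
rewrite -sum1_count big_mkcond big_allpairs /= -[in RHS]sum1_count big_distrl /= [RHS]big_mkcond.
apply: eq_bigr => x _; case: (P1 x) => /=; last by rewrite big1_eq.
by rewrite mul1n -sum1_count [RHS]big_mkcond.
Qed.

Lemma count_odd_iota k : count odd (iota 0 k.*2) = k /\ count (fun t => ~~ odd t) (iota 0 k.*2) = k.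
Proof.
elim: k => [//|k [IH1 IH2]]; rewrite doubleS -addn2 iotaD !count_cat IH1 IH2 /= odd_double /=.
by lia.
Qed.

Local Open Scope ring_scope.

Definition mixed_even a b y : rat := (odd a && ~~ odd b && ~~ odd y)%:R * (a%:R * b%:R).

Lemma mixed_evenE a b y : mixed_even a b y = widths_mixed a b - widths_mixed_h a b y.
Proof.
rewrite /mixed_even /widths_mixed /widths_mixed_h.
by case: (odd a); case: (odd b); case: (odd y) => /=; ring.
Qed.

(** If both widths are odd, all twists give type B. If one width is even, half of the twists do when
    the height of that cylinder is even, and none otherwise. *)
Lemma size_twists2 w1 w2 h1 h2 : odd (w1 * h1 + w2 * h2) ->
  (size (twists2 true w1 w2 h1 h2))%:R =
  widths_odd w1 w2 + (mixed_even w1 w2 h2 + mixed_even w2 w1 h1) / 2.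
Proof.
rewrite oddD !oddM => par; rewrite size_filter /widths_odd /mixed_even /is_typeB2.
have half w : ~~ odd w -> w = (w./2).*2 by lia.
have [o1|o1] := boolP (odd w1); have [o2|o2] := boolP (odd w2) => /=.
- rewrite (eq_count (a2 := fun t => xpredT t.1 && xpredT t.2)) => [|t //].
  by rewrite (count_pairs xpredT xpredT) !count_predT !size_iota natrM; field.
- have [o4|o4] := boolP (odd h2) => /=.
    rewrite (eq_count (a2 := pred0)) => [|t //]; rewrite count_pred0.
    by field.
  rewrite (eq_count (a2 := fun t => xpredT t.1 && odd t.2)) => [|t]; last by rewrite /=; case: odd.
  rewrite (count_pairs xpredT odd) count_predT size_iota {1 3}(half w2 o2) (count_odd_iota _).1.
  by rewrite -mul2n !natrM; field.
- have [o3|o3] := boolP (odd h1) => /=.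
    rewrite (eq_count (a2 := pred0)) => [|t //]; rewrite count_pred0.
    by field.
  rewrite (eq_count (a2 := fun t => ~~ odd t.1 && xpredT t.2)) => [|t]; last by rewrite /=; case: odd.
  rewrite (count_pairs (fun t => ~~ odd t) xpredT) count_predT size_iota {1 4}(half w1 o1) (count_odd_iota _).2.
  by rewrite -mul2n !natrM; field.
by move: par; rewrite (negPf o1) (negPf o2).
Qed.

Lemma size_twists2_sum w1 w2 h1 h2 :
  (size (twists2 true w1 w2 h1 h2) + size (twists2 false w1 w2 h1 h2) = w1 * w2)%N.
Proof.
rewrite !size_filter.
rewrite (eq_count (a2 := fun t => is_typeB2 w1 w2 h1 h2 t.1 t.2)); last by move=> t; case: is_typeB2.
rewrite [X in (_ + X)%N](eq_count (a2 := predC (fun t => is_typeB2 w1 w2 h1 h2 t.1 t.2))); last first.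
  by move=> t /=; case: is_typeB2.
by rewrite count_predC size_allpairs !size_iota.
Qed.

Lemma size_all_params2 n bB : (size (all_params2 n bB))%:R =
  qsum n (fun a b x y => (a < b)%N%:R * (size (twists2 bB a b x y))%:R).
Proof.
rewrite size_allpairs_dep sumnE big_map big_filter natr_sum /qsum big_mkcond.
by apply: eq_bigr => -[[[a b] x] y] _ /=; case: ifP; rewrite ?mul1r ?mul0r.
Qed.

(** This removes the constraint w1 < w2, so that the sums evaluated by Liouville's method apply. *)
Lemma qsum_symmetrize n (E : nat -> nat -> nat -> nat -> rat) :
  (forall a x y, E a a x y = 0) ->
  qsum n (fun a b x y => (a < b)%N%:R * (E a b x y + E b a y x)) = qsum n E.
Proof.
move=> E0; rewrite (qsum_split_ab n E).
have -> : qsum n (fun a b x y => (a == b)%N%:R * E a b x y) = 0.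
  rewrite -[RHS](mul0r (qsum n E)) -qsumZ; apply: eq_qsum => a b x y *.
  by have [->|] := eqVneq a b; rewrite ?E0 ?mul0r ?mulr0.
rewrite addr0 -[X in _ = _ + X]qsum_swap -qsumD; apply: eq_qsum => a b x y *.
by rewrite mulrDr.
Qed.

Lemma size_all_params2A n : odd n -> (size (all_params2 n false))%:R =
  (7 * sigma 3 n - 9 * n%:R * sigma 1 n + 2 * sigma 1 n) / 48.
Proof.
move=> n_odd; rewrite size_all_params2.
(* With b the even width, all twists give type A if y is odd and half of them if y is even: the
   proportion is (1 + [y odd]) / 2. *)
pose G (a b x y : nat) := 2^-1 * (widths_mixed a b + widths_mixed_h a b y).
transitivity (qsum n G); last first.
  by rewrite qsumZ qsumD qsum_widths_mixed // qsum_widths_mixed_h //; field.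
rewrite -[RHS]qsum_symmetrize => [|a x y]; last first.
  by rewrite /G /widths_mixed /widths_mixed_h; case: (odd a) => /=; ring.
apply: eq_qsum => a b x y _ _ _ _ E; congr (_ * _).
have -> : (size (twists2 false a b x y))%:R =
    a%:R * b%:R - (size (twists2 true a b x y))%:R :> rat.
  by rewrite -natrM -(size_twists2_sum a b x y) natrD; ring.
rewrite size_twists2 ?E // /G !mixed_evenE /widths_odd.
have := quad_parity n_odd E; rewrite /widths_mixed /widths_mixed_h.
by case: (odd a); case: (odd b); case: (odd x); case: (odd y) => //= _; field.
Qed.

(** The sum over two odd widths is symmetric, so its part a < b is half of what remains after
    removing the diagonal a = b; this diagonal is the origin of sigma_2. *)
Lemma size_all_params2B n : odd n -> (size (all_params2 n true))%:R =
  sigma 3 n / 16 + sigma 2 n / 2 - 9 / 16 * n%:R * sigma 1 n.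
Proof.
move=> n_odd; have n0 : (0 < n)%N by case: (n) n_odd.
rewrite size_all_params2.
pose E (a b x y : nat) := 2^-1 * mixed_even a b y.
transitivity (qsum n (fun a b x y => (a < b)%N%:R * widths_odd a b) + qsum n E).
  rewrite -[X in _ + X]qsum_symmetrize => [|a x y]; last first.
    by rewrite /E /mixed_even; case: (odd a) => /=; ring.
  rewrite -qsumD; apply: eq_qsum => a b x y _ _ _ _ Eq; rewrite -mulrDr; congr (_ * _).
  by rewrite size_twists2 ?Eq // /E; field.
have -> : qsum n E = (sigma 3 n - 3 * n%:R * sigma 1 n + 2 * sigma 1 n) / 48.
  have -> : qsum n E = 2^-1 * (qsum n (fun a b x y => widths_mixed a b) +
      (-1) * qsum n (fun a b x y => widths_mixed_h a b y)).
    rewrite -!qsumZ -qsumD -qsumZ; apply: eq_qsum => a b x y *.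
    by rewrite /E mixed_evenE; ring.
  by rewrite qsum_widths_mixed // qsum_widths_mixed_h //; field.
have := qsum_split_ab n (fun a b x y => widths_odd a b).
have -> : qsum n (fun a b x y => (b < a)%N%:R * widths_odd a b) =
    qsum n (fun a b x y => (a < b)%N%:R * widths_odd a b).
  rewrite -qsum_swap; apply: eq_qsum => a b x y *; congr (_ * _).
  by rewrite /widths_odd andbC [a%:R * _]mulrC.
have -> : qsum n (fun a b x y => (a == b)%N%:R * widths_odd a b) =
    n%:R * sigma 1 n - sigma 2 n.
  rewrite qsum_diag_ab // -(sum_cofactor_sq n_odd); apply: eq_big_seq => d dn.
  have [od oe] := odd_divisors n_odd dn; rewrite /widths_odd od mul1r sumr_const_nat.
  by rewrite -[LHS]mulr_natr natrB //; case: (n %/ d)%N oe.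
by rewrite qsum_widths_odd // => H; lra.
Qed.

Local Close Scope ring_scope.

(** * Sorting the two-cylinder parameters by lattice of periods *)

Definition twist_det (h1 h2 t1 t2 : nat) : nat :=
  absz ((t1 * h2)%N%:Z - (t2 * h1)%N%:Z)%R.

Lemma gcdn_shift (g : nat) (x y : int) :
  (g%:Z %| (x - y)%R)%Z -> gcdn g (absz x) = gcdn g (absz y).
Proof.
have aux (u w : int) : (g%:Z %| (u - w)%R)%Z -> gcdn g (absz u) %| gcdn g (absz w).
  move=> guw; rewrite dvdn_gcd dvdn_gcdl /=; set k := gcdn _ _.
  have H1 : (k%:Z %| u)%Z by rewrite dvdzE; exact: dvdn_gcdr.
  have H2 : (k%:Z %| (u - w)%R)%Z by apply: dvdz_trans guw; rewrite dvdzE; exact: dvdn_gcdl.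
  have : (k%:Z %| (u - (u - w))%R)%Z by apply: rpredB.
  by have -> : (u - (u - w) = w)%R by ring.
move=> gxy; apply/eqP; rewrite eqn_dvd !aux //.
have -> : (y - x = - (x - y))%R by ring.
by rewrite rpredN.
Qed.

Lemma lift_det d w1 w2 h1 h2 s t1 t2 :
  gcdn (gcdn (d * w1) (d * w2))
    (twist_det h1 h2 ((d * t1 + s * h1) %% (d * w1)) ((d * t2 + s * h2) %% (d * w2))) =
  d * gcdn (gcdn w1 w2) (twist_det h1 h2 t1 t2).
Proof.
rewrite /twist_det; have E1 := divn_eq (d * t1 + s * h1) (d * w1).
have E2 := divn_eq (d * t2 + s * h2) (d * w2).
move: (_ %% _) (_ %/ _) E1 => T1 q1 E1; move: (_ %% _) (_ %/ _) E2 => T2 q2 E2.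
pose x : int := ((t1 * h2)%N%:Z - (t2 * h1)%N%:Z)%R.
pose y : int := (x - q1%:Z * w1%:Z * h2%:Z + q2%:Z * w2%:Z * h1%:Z)%R.
have -> : ((T1 * h2)%N%:Z - (T2 * h1)%N%:Z = d%:Z * y)%R.
  have F1 : (T1%:Z = d%:Z * t1%:Z + s%:Z * h1%:Z - q1%:Z * (d%:Z * w1%:Z))%R by lia.
  have F2 : (T2%:Z = d%:Z * t2%:Z + s%:Z * h2%:Z - q2%:Z * (d%:Z * w2%:Z))%R by lia.
  by rewrite /y /x !PoszM F1 F2; ring.
rewrite abszM absz_nat -!muln_gcdr; congr (_ * _); apply: gcdn_shift.
have -> : (y - x = - (q1%:Z * h2%:Z) * w1%:Z + (q2%:Z * h1%:Z) * w2%:Z)%R by rewrite /y; ring.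
by apply: rpredD; apply: dvdz_mull; rewrite dvdzE /= ?dvdn_gcdl ?dvdn_gcdr.
Qed.

Lemma coprime_shear_uniq d h1 h2 s s' : coprime h1 h2 -> s < d -> s' < d ->
  s * h1 = s' * h1 %[mod d] -> s * h2 = s' * h2 %[mod d] -> s = s'.
Proof.
move=> cop; wlog le : s s' / s' <= s.
  move=> W sd sd' E1 E2; case/orP: (leq_total s' s) => le; first exact: W.
  by symmetry; apply: W.
move=> sd sd' /eqP E1 /eqP E2.
rewrite eqn_mod_dvd ?leq_mul2r ?le ?orbT // -mulnBl in E1.
rewrite eqn_mod_dvd ?leq_mul2r ?le ?orbT // -mulnBl in E2.
have : d %| gcdn ((s - s') * h1) ((s - s') * h2) by rewrite dvdn_gcd E1.
rewrite -muln_gcdr (eqP cop) muln1 => D; have [|k0] := posnP (s - s'); first lia.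
by have := dvdn_leq k0 D; lia.
Qed.

(** If u h1 + v h2 = 1, then s = u T1 + v T2 works, because s h1 - T1 and s h2 - T2 are multiples of
    T1 h2 - T2 h1. *)
Lemma shear_exists d h1 h2 T1 T2 : 0 < d -> coprime h1 h2 -> d %| twist_det h1 h2 T1 T2 ->
  exists s, [/\ s < d, s * h1 = T1 %[mod d] & s * h2 = T2 %[mod d]].
Proof.
move=> d0 cop; rewrite /twist_det => dD.
have /dvdzP[k Ek] : (d%:Z %| ((T1 * h2)%N%:Z - (T2 * h1)%N%:Z)%R)%Z by rewrite dvdzE.
case: (Bezoutz h1%:Z h2%:Z) => u [v]; rewrite /gcdz /= (eqP cop) => Euv.
pose s0 := (u * T1%:Z + v * T2%:Z)%R.
have d0' : (d%:Z != 0)%R by rewrite eqz_nat -lt0n.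
have Es := divz_eq s0 (Posz d); have r0 := modz_ge0 s0 d0'; have rd := ltz_mod s0 d0'.
move: (modz s0 d) (divz s0 d) Es r0 rd => r q Es r0 rd.
have to_mod (a b : nat) (c : int) : (a%:Z = b%:Z + c * d%:Z)%R -> a = b %[mod d].
  case: c => c E.
    have -> : a = c * d + b by lia.
    by rewrite modnMDl.
  have -> : b = c.+1 * d + a by rewrite NegzE in E; lia.
  by rewrite modnMDl.
exists `|r|%N; split; first lia.
  apply: (to_mod _ _ (- v * k - q * h1%:Z)%R).
  rewrite PoszM gez0_abs //.
  have -> : r = (s0 - q * d%:Z)%R by rewrite Es; ring.
  have -> : (T1%:Z + (- v * k - q * h1%:Z) * d%:Z =
      T1%:Z * (u * h1%:Z + v * h2%:Z) - v * (k * d%:Z) - q * h1%:Z * d%:Z)%R by rewrite Euv; ring.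
  by rewrite -Ek /s0 !PoszM; ring.
apply: (to_mod _ _ (u * k - q * h2%:Z)%R).
rewrite PoszM gez0_abs //.
have -> : r = (s0 - q * d%:Z)%R by rewrite Es; ring.
have -> : (T2%:Z + (u * k - q * h2%:Z) * d%:Z =
    T2%:Z * (u * h1%:Z + v * h2%:Z) + u * (k * d%:Z) - q * h2%:Z * d%:Z)%R by rewrite Euv; ring.
by rewrite -Ek /s0 !PoszM; ring.
Qed.

Lemma twist_exists d w A T : 0 < d -> 0 < w -> T < d * w -> A = T %[mod d] ->
  exists2 t, t < w & (d * t + A) %% (d * w) = T.
Proof.
move=> d0 w0 TW AT; have D0 : 0 < d * w by rewrite muln_gt0 d0.
(* The multiple of d w keeps the truncated subtraction exact. *)
pose N := T + A * (d * w) - A.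
have AN : A <= T + A * (d * w) by rewrite (leq_trans (leq_pmulr A D0)) ?leq_addl.
have dN : d %| N.
  rewrite -eqn_mod_dvd // mulnCA mulnC addnC modnMDl; apply/eqP/esym; exact: AT.
exists ((N %/ d) %% w); first by rewrite ltn_mod.
rewrite muln_modr mulnC divnK // modnDml subnK // addnC modnMDl modn_small //.
Qed.

Lemma lift_twist_uniq d w A t t' : 0 < d -> t < w -> t' < w ->
  d * t + A = d * t' + A %[mod d * w] -> t = t'.
Proof.
move=> d0 tw tw' /eqP; rewrite eqn_modDr -!muln_modr eqn_pmul2l //.
by rewrite !modn_small // => /eqP.
Qed.

Lemma lift_shear_mod d w h s t : (d * t + s * h) %% (d * w) = s * h %[mod d].
Proof. by rewrite modn_dvdm ?dvdn_mulr // mulnC modnMDl. Qed.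

Section Lift.
Variables (n : nat) (n_odd : odd n) (bB : bool).
Let n0 : 0 < n. Proof. by case: n n_odd. Qed.

(* The image of a primitive surface with m squares under (x, y) -> (d x + s y, e y),
   where m d e = n: its lattice of periods is spanned by (d, 0) and (s, e). *)
Definition lift_params2 (z : nat * nat * (nat * (nat * nat * nat * nat * (nat * nat)))) :=
  let: (m, d, (s, (w1, w2, h1, h2, (t1, t2)))) := z in
  let e := n %/ m %/ d in
  (d * w1, d * w2, e * h1, e * h2,
   ((d * t1 + s * h1) %% (d * w1), (d * t2 + s * h2) %% (d * w2))).

Definition lift_domain :=
  [seq (md, sp) | md <- [seq (m, d) | m <- divisors n, d <- divisors (n %/ m)],
     sp <- allpairs pair (iota 0 md.2) (params2 md.1 bB)].

Lemma mem_lift_domain m d s p : ((m, d, (s, p)) \in lift_domain) =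
  [&& m %| n, d %| n %/ m, s < d & p \in params2 m bB].
Proof.
apply/allpairsPdep/and4P => [[[m' d'] [[s' p'] []]]|[mn dnm sd pm]].
  case/allpairsPdep=> [m'' [d'' []]]; rewrite -dvdn_divisors // => mn.
  rewrite -dvdn_divisors ?quo_gt0 // => dm [Em Ed] /allpairsP[[u1 u2] /= [+ U2 [Eu1 Eu2]]].
  by rewrite mem_iota /= => U1 [-> -> -> ->]; subst; split.
exists (m, d), (s, p); split=> //.
  by apply/allpairsPdep; exists m, d; rewrite -!dvdn_divisors ?quo_gt0.
by apply/allpairsP; exists (s, p); rewrite mem_iota.
Qed.

Lemma lift_domain_uniq : uniq lift_domain.
Proof.
apply: allpairs_uniq_dep.
- apply: allpairs_uniq_dep; first exact: divisors_uniq.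
    by move=> m _; exact: divisors_uniq.
  by move=> [? ?] [? ?] _ _ [-> ->].
- move=> md _; apply: allpairs_uniq; rewrite ?iota_uniq ?params2_uniq //.
  by move=> [? ?] [? ?] _ _.
by move=> [? ?] [? ?] _ _ [-> ->].
Qed.

(** Odd factors preserve parities. The parity of a twist matters only in a cylinder of even width
    and even height, and there neither the shear nor the reduction modulo the width affects it. *)
Lemma lift_type d e w1 w2 h1 h2 s t1 t2 : odd d -> odd e ->
  is_typeB2 (d * w1) (d * w2) (e * h1) (e * h2)
    ((d * t1 + s * h1) %% (d * w1)) ((d * t2 + s * h2) %% (d * w2)) =
  is_typeB2 w1 w2 h1 h2 t1 t2.
Proof.
move=> od oe; rewrite /is_typeB2 !oddM od oe /=.
have par w h t : ~~ odd w -> ~~ odd h -> odd ((d * t + s * h) %% (d * w)) = odd t.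
  move=> ow oh; rewrite odd_mod; last by rewrite oddM od (negPf ow).
  by rewrite oddD !oddM od (negPf oh) andbF addbF.
congr [|| _, _ | _].
  by have [|o1] := boolP (odd w1); have [|o2] := boolP (odd h1) => //=; rewrite par.
by have [|o1] := boolP (odd w2); have [|o2] := boolP (odd h2) => //=; rewrite par.
Qed.

(** The lattice is recovered from the parameters: e is the gcd of the heights, d the gcd of the
    widths and of the determinant formed with the heights divided by e, and s is fixed modulo d by s
    h_i = T_i. *)
Lemma lift_params2_perm : perm_eq (map lift_params2 lift_domain) (all_params2 n bB).
Proof.
apply: uniq_perm; last 1 first.
- move=> [[[[W1 W2] H1] H2] [T1 T2]]; rewrite mem_all_params2; apply/mapP/and3P.
    case=> -[[m d] [s [[[[w1 w2] h1] h2] [t1 t2]]]].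
    rewrite mem_lift_domain mem_params2 => /and4P[mn dnm sd /and4P[V /eqP sum prim ty]].
    case=> -> -> -> -> -> ->.
    have m0 := dvdn_gt0 n0 mn; have nm0 := quo_gt0 n0 mn.
    have d0 := dvdn_gt0 nm0 dnm; have e0 := quo_gt0 nm0 dnm.
    have En : n = n %/ m %/ d * d * m by rewrite !divnK.
    move: (n %/ m %/ d) e0 En => e e0 En.
    have : odd (e * d * m) by rewrite -En.
    rewrite !oddM => /andP[/andP[oe od] _].
    have /and5P[w10 lt h10 h20 /andP[? ?]] := V.
    split; last by rewrite lift_type.
      rewrite /valid2 !muln_gt0 d0 e0 w10 h10 h20 ltn_pmul2l // lt !ltn_mod !muln_gt0 d0 w10 /=.
      by rewrite (leq_ltn_trans _ lt).
    by rewrite En -sum; apply/eqP; ring.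
  case=> /and5P[W10 lt H10 H20 /andP[T1W T2W]] /eqP sum ty.
  pose e := gcdn H1 H2; have e0 : 0 < e by rewrite gcdn_gt0 H10.
  have /dvdnP[h1 Eh1] : e %| H1 by exact: dvdn_gcdl.
  have /dvdnP[h2 Eh2] : e %| H2 by exact: dvdn_gcdr.
  have cop : coprime h1 h2.
    by rewrite /coprime -(eqn_pmul2r e0) muln_gcdl -Eh1 -Eh2 mul1n.
  pose d := gcdn (gcdn W1 W2) (twist_det h1 h2 T1 T2).
  have d0 : 0 < d by rewrite !gcdn_gt0 W10.
  have /dvdnP[w1 Ew1] : d %| W1 by apply: dvdn_trans (dvdn_gcdl _ _) _; exact: dvdn_gcdl.
  have /dvdnP[w2 Ew2] : d %| W2 by apply: dvdn_trans (dvdn_gcdl _ _) _; exact: dvdn_gcdr.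
  have [s [sd Es1 Es2]] := shear_exists d0 cop (dvdn_gcdr _ _ : d %| twist_det h1 h2 T1 T2).
  rewrite mulnC in Ew1; rewrite mulnC in Ew2; rewrite mulnC in Eh1; rewrite mulnC in Eh2.
  have w10 : 0 < w1 by move: W10; rewrite Ew1 muln_gt0 => /andP[].
  have h10 : 0 < h1 by move: H10; rewrite Eh1 muln_gt0 => /andP[].
  have h20 : 0 < h2 by move: H20; rewrite Eh2 muln_gt0 => /andP[].
  have ltw : w1 < w2 by move: lt; rewrite Ew1 Ew2 ltn_pmul2l.
  have w20 : 0 < w2 by rewrite (leq_ltn_trans _ ltw).
  have [t1 t1w Et1] := @twist_exists d w1 (s * h1) T1 d0 w10 ltac:(by rewrite -Ew1) Es1.
  have [t2 t2w Et2] := @twist_exists d w2 (s * h2) T2 d0 w20 ltac:(by rewrite -Ew2) Es2.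
  have En : n = e * d * (w1 * h1 + w2 * h2) by rewrite -sum Ew1 Ew2 Eh1 Eh2; ring.
  have m0 : 0 < w1 * h1 + w2 * h2 by rewrite addn_gt0 muln_gt0 w10 h10.
  exists (w1 * h1 + w2 * h2, d, (s, (w1, w2, h1, h2, (t1, t2)))).
    rewrite mem_lift_domain mem_params2 eqxx sd /valid2 w10 ltw h10 h20 t1w t2w /=.
    have -> : n %/ (w1 * h1 + w2 * h2) = e * d by rewrite En mulnK.
    rewrite dvdn_mull // andTb; apply/and3P; split.
    - by rewrite En dvdn_mull.
    - rewrite /is_prim2 cop /= -(eqn_pmul2l d0) muln1.
      by rewrite -/(twist_det h1 h2 t1 t2) -(lift_det d w1 w2 h1 h2 s) Et1 Et2 -Ew1 -Ew2.
    have : odd (e * d * (w1 * h1 + w2 * h2)) by rewrite -En.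
    rewrite oddM => /andP[+ _]; rewrite oddM => /andP[oe od].
    by rewrite -(lift_type w1 w2 h1 h2 s t1 t2 od oe) Et1 Et2 -Ew1 -Ew2 -Eh1 -Eh2.
  rewrite /lift_params2 Et1 Et2.
  have -> : n %/ (w1 * h1 + w2 * h2) %/ d = e by rewrite En mulnK // mulnK.
  by rewrite -Ew1 -Ew2 -Eh1 -Eh2.
- rewrite map_inj_in_uniq ?lift_domain_uniq //.
  move=> [[m d] [s [[[[w1 w2] h1] h2] [t1 t2]]]] [[m' d'] [s' [[[[w1' w2'] h1'] h2'] [t1' t2']]]].
  rewrite !mem_lift_domain !mem_params2.
  move=> /and4P[mn dnm sd /and4P[V /eqP sum /andP[cop /eqP prim] ty]].
  move=> /and4P[mn' dnm' sd' /and4P[V' /eqP sum' /andP[cop' /eqP prim'] ty']].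
  have nm0 := quo_gt0 n0 mn; have d0 := dvdn_gt0 nm0 dnm; have e0 := quo_gt0 nm0 dnm.
  have nm0' := quo_gt0 n0 mn'; have d0' := dvdn_gt0 nm0' dnm'; have e0' := quo_gt0 nm0' dnm'.
  have En : n = n %/ m %/ d * d * m by rewrite !divnK.
  have En' : n = n %/ m' %/ d' * d' * m' by rewrite !divnK.
  rewrite /lift_params2.
  move: (n %/ m %/ d) (n %/ m' %/ d') e0 e0' En En' => e e' e0 e0' En En'.
  have /and5P[w10 lt h10 h20 /andP[t1w t2w]] := V.
  have /and5P[w10' lt' h10' h20' /andP[t1w' t2w']] := V'.
  case=> Ew1 Ew2 Eh1 Eh2 Et1 Et2.
  have Ee : e = e'.
    have := congr2 gcdn Eh1 Eh2; rewrite -!muln_gcdr (eqP cop) (eqP cop').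
    by rewrite !muln1.
  subst e'; have {}Eh1 : h1 = h1' by apply/eqP; rewrite -(eqn_pmul2l e0) Eh1.
  have {}Eh2 : h2 = h2' by apply/eqP; rewrite -(eqn_pmul2l e0) Eh2.
  subst h1' h2'.
  have Ed : d = d'.
    have := lift_det d w1 w2 h1 h2 s t1 t2; rewrite /twist_det prim muln1 Et1 Et2 Ew1 Ew2.
    by have := lift_det d' w1' w2' h1 h2 s' t1' t2'; rewrite /twist_det prim' muln1 => -> ->.
  subst d'; have {}Ew1 : w1 = w1' by apply/eqP; rewrite -(eqn_pmul2l d0) Ew1.
  have {}Ew2 : w2 = w2' by apply/eqP; rewrite -(eqn_pmul2l d0) Ew2.
  subst w1' w2'.
  have Es : s = s'.
    apply: (coprime_shear_uniq cop sd sd').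
      by rewrite -(lift_shear_mod d w1 h1 s t1) Et1 lift_shear_mod.
    by rewrite -(lift_shear_mod d w2 h2 s t2) Et2 lift_shear_mod.
  subst s'; have {}Et1 : t1 = t1' by exact: lift_twist_uniq Et1.
  have {}Et2 : t2 = t2' by exact: lift_twist_uniq Et2.
  by subst t1' t2'; congr (_, _, _); rewrite -sum -sum'.
exact: all_params2_uniq.
Qed.

(** sigma_1(n / m) counts the sublattices of index n / m in Z^2, given by d dividing n / m and s <
    d. *)
Lemma dirichlet_params2 : (\sum_(m <- divisors n) sigma 1 (n %/ m) * (size (params2 m bB))%:R =
  (size (all_params2 n bB))%:R)%R.
Proof.
rewrite -(perm_size lift_params2_perm) size_map size_allpairs_dep sumnE big_map.
rewrite big_allpairs_dep /= natr_sum; apply: eq_bigr => m _.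
rewrite natr_sum /sigma big_distrl /=; apply: eq_bigr => d _.
by rewrite size_allpairs size_iota natrM expr1.
Qed.

End Lift.

(** * One-cylinder parameters and compositions into three parts *)

Definition compositions3 m : seq (nat * nat * nat) :=
  [seq (a, b, m - a - b) | a <- index_iota 1 m, b <- index_iota 1 (m - a)].

Lemma mem_compositions3 m a b c : ((a, b, c) \in compositions3 m) =
  [&& 0 < a, 0 < b, 0 < c & a + b + c == m].
Proof.
apply/allpairsPdep/idP => [[a' [b' []]]|H].
  by rewrite !mem_index_iota => A C [-> -> ->]; lia.
exists a, b; rewrite !mem_index_iota; split; [lia|lia|].
by congr (_, _, _); lia.
Qed.

Lemma compositions3_uniq m : uniq (compositions3 m).
Proof.
apply: allpairs_uniq_dep; first exact: iota_uniq.
  by move=> a _; exact: iota_uniq.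
by move=> [? ?] [? ?] _ _ [-> ->].
Qed.

Definition typed3 bB m := [seq l <- compositions3 m | is_typeB1 l.1.1 l.1.2 l.2 == bB].
Definition prim_typed3 bB m :=
  [seq l <- typed3 bB m | gcdn (gcdn l.1.1 l.1.2) l.2 == 1].

Lemma mem_typed3 bB m a b c : ((a, b, c) \in typed3 bB m) =
  [&& 0 < a, 0 < b, 0 < c, a + b + c == m & is_typeB1 a b c == bB].
Proof. by rewrite mem_filter mem_compositions3 /= andbC -!andbA. Qed.

Lemma mem_prim_typed3 bB m a b c : ((a, b, c) \in prim_typed3 bB m) =
  (gcdn (gcdn a b) c == 1) && ((a, b, c) \in typed3 bB m).
Proof. by rewrite mem_filter. Qed.

Lemma typed3_uniq bB m : uniq (typed3 bB m).
Proof. exact/filter_uniq/compositions3_uniq. Qed.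

Lemma size_params1 m bB : size (params1 m bB) = m * size (prim_typed3 bB m).
Proof.
have -> : m * size (prim_typed3 bB m) =
    size (allpairs pair (prim_typed3 bB m) (iota 0 m)) by rewrite size_allpairs size_iota mulnC.
apply/perm_size/uniq_perm.
- exact: params1_uniq.
- apply: allpairs_uniq; rewrite ?iota_uniq //; first exact/filter_uniq/typed3_uniq.
  by move=> [? ?] [? ?] _ _.
move=> [[[a b] c] t]; rewrite mem_params1 /valid1 /is_prim1 /=.
apply/idP/allpairsP => [H|[[l u] /= []]].
  by exists ((a, b, c), t); rewrite mem_prim_typed3 mem_typed3 mem_iota /=; split=> //; lia.
case: l => -[a' b'] c'; rewrite mem_prim_typed3 mem_typed3 mem_iota => H1 H2 [-> -> -> ->].
lia.
Qed.

(** Composition by composition, divide by the gcd of the parts; it divides the odd number w, so the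
    parities and hence the type are preserved. *)
Lemma sum_prim_typed3 bB w : odd w ->
  \sum_(m <- divisors w) size (prim_typed3 bB m) = size (typed3 bB w).
Proof.
move=> ow; have w0 : 0 < w by case: w ow.
pose s := [seq (m, l) | m <- divisors w, l <- prim_typed3 bB m].
have ms m l : ((m, l) \in s) = (m %| w) && (l \in prim_typed3 bB m).
  apply/allpairsPdep/andP => [[m' [l' []]]|[mw lm]].
    by rewrite -dvdn_divisors // => ? ? [-> ->].
  by exists m, l; rewrite -dvdn_divisors.
pose f (z : nat * (nat * nat * nat)) :=
  let: (m, (a, b, c)) := z in (w %/ m * a, w %/ m * b, w %/ m * c).
have <- : size (map f s) = \sum_(m <- divisors w) size (prim_typed3 bB m).
  by rewrite size_map size_allpairs_dep sumnE big_map.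
apply/perm_size/uniq_perm.
- rewrite map_inj_in_uniq.
    apply: allpairs_uniq_dep; first exact: divisors_uniq.
      by move=> m _; exact/filter_uniq/typed3_uniq.
    by move=> [? ?] [? ?] _ _ [-> ->].
  move=> [m [[a b] c]] [m' [[a' b'] c']]; rewrite !ms !mem_prim_typed3 !mem_typed3.
  move=> /and3P[mw /eqP g /and5P[_ _ _ /eqP sum _]] /and3P[mw' /eqP g' /and5P[_ _ _ /eqP sum' _]].
  rewrite /f; have k0 := quo_gt0 w0 mw; move: (w %/ m) (w %/ m') k0 => k k' k0.
  case=> Ea Eb Ec; have Ek : k = k'.
    have := congr2 gcdn (congr2 gcdn Ea Eb) Ec; rewrite -!muln_gcdr g g'.
    by rewrite !muln1.
  subst k'; move: Ea Eb Ec => /eqP + /eqP + /eqP.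
  rewrite !eqn_pmul2l // => /eqP ? /eqP ? /eqP ?; subst a' b' c'.
  by rewrite -sum -sum'.
- exact: typed3_uniq.
move=> [[A C] D]; rewrite mem_typed3; apply/mapP/idP.
  case=> -[m [[a b] c]]; rewrite ms mem_prim_typed3 mem_typed3.
  move=> /and3P[mw _ /and5P[a0 b0 c0 /eqP sum /eqP <-]] [-> -> ->].
  have k0 := quo_gt0 w0 mw; have Ew := divnK mw; have ok : odd (w %/ m).
    by have := ow; rewrite -{1}Ew oddM => /andP[].
  rewrite !muln_gt0 k0 a0 b0 c0 -!mulnDr sum Ew eqxx /is_typeB1 !oddM ok /=.
  exact: eqxx.
case/and5P=> A0 C0 D0 /eqP sum /eqP ty.
pose g := gcdn (gcdn A C) D; have g0 : 0 < g by rewrite !gcdn_gt0 A0.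
have /dvdnP[a Ea] : g %| A by apply: dvdn_trans (dvdn_gcdl _ _) _; exact: dvdn_gcdl.
have /dvdnP[b Eb] : g %| C by apply: dvdn_trans (dvdn_gcdl _ _) _; exact: dvdn_gcdr.
have /dvdnP[c Ec] : g %| D by exact: dvdn_gcdr.
have Ew : w = g * (a + b + c) by rewrite -sum Ea Eb Ec; ring.
have m0 : 0 < a + b + c by move: w0; rewrite Ew muln_gt0 => /andP[].
have [og _] : odd g /\ odd (a + b + c) by apply/andP; rewrite -oddM -Ew.
exists (a + b + c, (a, b, c)).
  rewrite ms mem_prim_typed3 mem_typed3 {1}Ew dvdn_mull //= eqxx /=.
  have -> : gcdn (gcdn a b) c == 1.
    by rewrite -(eqn_pmul2r g0) mul1n !muln_gcdl -Ea -Eb -Ec.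
  move: A0 C0 D0 ty; rewrite Ea Eb Ec !muln_gt0 /is_typeB1 !oddM og !andbT.
  by move=> /andP[-> _] /andP[-> _] /andP[-> _] ->; rewrite eqxx.
by rewrite /f Ew mulnK // Ea Eb Ec ![g * _]mulnC.
Qed.

Local Open Scope ring_scope.

Lemma sum_odd_lin d : odd d ->
  \sum_(1 <= a < d) (odd a)%:R * a%:R = ((d%:R - 1) / 2) ^+ 2 :> rat.
Proof.
move=> /odd_part ->; move: d./2 => k {d}; elim: k => [|k IH]; first by rewrite big_geq // double0; field.
rewrite sum_step2 IH /= odd_double /=.
have -> : k.+1.*2.+1 = (2 * k + 3)%N by lia.
have -> : k.*2.+2 = (2 * k + 2)%N by lia.
have -> : k.*2.+1 = (2 * k + 1)%N by lia.
by rewrite !(natrD _ (2 * k)) !(natrM _ 2); field.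
Qed.

Lemma sum_lin d : (0 < d)%N -> \sum_(1 <= a < d) a%:R = d%:R * (d%:R - 1) / 2 :> rat.
Proof.
case: d => // d _; elim: d => [|d IH]; first by rewrite big_geq //; field.
by rewrite big_nat_recr //= IH -!natr1; field.
Qed.

Lemma sum_odd_count_even d : ~~ odd d -> \sum_(1 <= a < d) (odd a)%:R = d%:R / 2 :> rat.
Proof.
case: d => [_|d od]; first by rewrite big_geq // mul0r.
have o : odd d by move: od; rewrite /= negbK.
rewrite big_nat_recr /=; last by case: (d) o.
by rewrite sum_odd_count // o -!natr1; field.
Qed.

Lemma size_typed3 bB m : (size (typed3 bB m))%:R =
  \sum_(1 <= a < m) \sum_(1 <= b < m - a) (is_typeB1 a b (m - a - b) == bB)%N%:R :> rat.
Proof.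
rewrite size_filter -sum1_count big_mkcond big_allpairs_dep /= natr_sum.
apply: eq_bigr => a _; rewrite natr_sum; apply: eq_bigr => b _.
by case: eqP.
Qed.

(** For odd a the other two parts have the same parity, and (w - a) / 2 values of b are odd. *)
Lemma size_typed3A w : odd w -> (size (typed3 false w))%:R = (w%:R ^+ 2 - 1) / 8 :> rat.
Proof.
move=> ow; rewrite size_typed3.
transitivity (\sum_(1 <= a < w) (odd a)%:R * (w%:R - a%:R) / 2 : rat).
  apply: eq_big_nat => a /andP[a0 aw].
  have [oa|oa] := boolP (odd a); last first.
    rewrite !mul0r big1_seq // => b _; rewrite /is_typeB1 (negPf oa); reflexivity.
  rewrite mul1r -natrB 1?ltnW // -sum_odd_count_even; last by rewrite oddB ?ow ?oa // ltnW.
  apply: eq_big_nat => b /andP[b0 bw]; rewrite /is_typeB1 oa oddB 1?ltnW // oddB 1?ltnW // ow oa.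
  by case: (odd b).
rewrite -big_distrl /=.
have -> : \sum_(1 <= a < w) (odd a)%:R * (w%:R - a%:R) =
    w%:R * (\sum_(1 <= a < w) (odd a)%:R) - \sum_(1 <= a < w) (odd a)%:R * a%:R :> rat.
  by rewrite big_distrr -sumrB /=; apply: eq_bigr => a _; ring.
by rewrite sum_odd_count // sum_odd_lin //; field.
Qed.

Lemma size_typed3B w : odd w ->
  (size (typed3 true w))%:R = (3 * w%:R ^+ 2 - 12 * w%:R + 9) / 8 :> rat.
Proof.
move=> ow; have w0 : (0 < w)%N by case: (w) ow.
have : (size (typed3 true w))%:R + (size (typed3 false w))%:R =
    (w%:R - 1) * (w%:R - 2) / 2 :> rat.
  rewrite !size_typed3 -big_split /=.
  transitivity (\sum_(1 <= a < w) (w%:R - 1 - a%:R) : rat).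
    apply: eq_big_nat => a /andP[a0 aw]; rewrite -big_split /=.
    rewrite (eq_bigr (fun=> 1)) => [|b _]; last by case: is_typeB1.
    by rewrite sumr_const_nat natrB ?subn_gt0 // natrB 1?ltnW //; ring.
  by rewrite sumrB sum_lin // sumr_const_nat -[X in X - _ = _]mulr_natr natrB //; field.
by rewrite size_typed3A // => H; lra.
Qed.

(** The right-hand side is the count of all one-cylinder parameters, with circumference w, height n
    / w and w possible twists. *)
Lemma dirichlet_params1 n bB : odd n ->
  \sum_(m <- divisors n) sigma 1 (n %/ m) * (size (params1 m bB))%:R =
  \sum_(w <- divisors n) w%:R * (size (typed3 bB w))%:R.
Proof.
move=> n_odd; have n0 : (0 < n)%N by case: (n) n_odd.
transitivity (\sum_(w <- divisors n) w%:R *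
    \sum_(m <- divisors w) (size (prim_typed3 bB m))%:R : rat).
  rewrite -dirichlet_sigma_id //; apply: eq_bigr => m _.
  by rewrite size_params1 natrM.
apply: eq_big_seq => w /(odd_divisors n_odd)[ow _].
by rewrite -sum_prim_typed3 // natr_sum.
Qed.

(** For odd n this is three times the number of classes, by [card_classes]. *)
Definition class_weight bB n : rat :=
  (size (params1 n bB))%:R + 3 * (size (params2 n bB))%:R.

(** The sigma_1 terms of the one- and two-cylinder counts cancel. *)
Lemma dirichlet_class_weightA n : odd n ->
  \sum_(m <- divisors n) sigma 1 (n %/ m) * class_weight false m =
  9 / 16 * (sigma 3 n - n%:R * sigma 1 n).
Proof.
move=> n_odd; rewrite /class_weight.
transitivity (\sum_(m <- divisors n) sigma 1 (n %/ m) * (size (params1 m false))%:R +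
  3 * \sum_(m <- divisors n) sigma 1 (n %/ m) * (size (params2 m false))%:R).
  by rewrite big_distrr -big_split /=; apply: eq_bigr => m _; ring.
rewrite dirichlet_params1 // dirichlet_params2 // size_all_params2A //.
have -> : \sum_(w <- divisors n) w%:R * (size (typed3 false w))%:R = (sigma 3 n - sigma 1 n) / 8.
  rewrite /sigma -sumrB big_distrl /=; apply: eq_big_seq => w /(odd_divisors n_odd)[ow _].
  by rewrite size_typed3A //; field.
by field.
Qed.

(** Here it is the sigma_2 terms that cancel. *)
Lemma dirichlet_class_weightB n : odd n ->
  \sum_(m <- divisors n) sigma 1 (n %/ m) * class_weight true m =
  9 / 16 * (sigma 3 n - 3 * n%:R * sigma 1 n + 2 * sigma 1 n).
Proof.
move=> n_odd; rewrite /class_weight.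
transitivity (\sum_(m <- divisors n) sigma 1 (n %/ m) * (size (params1 m true))%:R +
  3 * \sum_(m <- divisors n) sigma 1 (n %/ m) * (size (params2 m true))%:R).
  by rewrite big_distrr -big_split /=; apply: eq_bigr => m _; ring.
rewrite dirichlet_params1 // dirichlet_params2 // size_all_params2B //.
have -> : \sum_(w <- divisors n) w%:R * (size (typed3 true w))%:R =
    (3 * sigma 3 n - 12 * sigma 2 n + 9 * sigma 1 n) / 8.
  rewrite /sigma !big_distrr -sumrB -big_split big_distrl /=.
  apply: eq_big_seq => w /(odd_divisors n_odd)[ow _].
  by rewrite size_typed3B //; field.
by field.
Qed.

Lemma sigma1_1 : sigma 1 1 = 1.
Proof. by rewrite /sigma /divisors /= big_seq1. Qed.

(** Strong induction: the term m = n has coefficient sigma_1(1) = 1, and the other divisors of an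
    odd n are smaller and again odd. *)
Lemma dirichlet_sigma_inj (f g : nat -> rat) :
  (forall n, odd n -> \sum_(m <- divisors n) sigma 1 (n %/ m) * f m =
                      \sum_(m <- divisors n) sigma 1 (n %/ m) * g m) ->
  forall n, odd n -> f n = g n.
Proof.
move=> E; elim/ltn_ind => n IH n_odd; have n0 : (0 < n)%N by case: (n) n_odd.
have nn : n \in divisors n by rewrite -dvdn_divisors.
have := E n n_odd; rewrite !(bigD1_seq n nn (divisors_uniq n)) /=.
rewrite divnn n0 sigma1_1 !mul1r; set r := \sum_(_ <- _ | _) _; set r' := \sum_(_ <- _ | _) _.
suff -> : r = r' by move/addIr.
rewrite /r /r' big_seq_cond [RHS]big_seq_cond; apply: eq_bigr => m /andP[mn m_n].
have [om _] := odd_divisors n_odd mn.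
by rewrite IH // ltn_neqAle m_n dvdn_leq // dvdn_divisors.
Qed.

Lemma dirichlet_jordan2 n : (0 < n)%N ->
  \sum_(m <- divisors n) sigma 1 (n %/ m) * jordan2 m = n%:R * sigma 1 n.
Proof.
move=> n0; rewrite dirichlet_sigma // /sigma -[in RHS]divisors_rev // big_distrr /=.
apply: eq_big_seq => e; rewrite -dvdn_divisors // => en.
have -> : n%:R = (n %/ e)%:R * e%:R :> rat by rewrite -natrM divnK.
by rewrite sum_jordan2 ?quo_gt0 //; ring.
Qed.

Lemma dirichlet_id_jordan2 n : (0 < n)%N ->
  \sum_(m <- divisors n) sigma 1 (n %/ m) * (m%:R * jordan2 m) = sigma 3 n.
Proof.
move=> n0; rewrite dirichlet_sigma_id //; apply: eq_big_seq => w.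
rewrite -dvdn_divisors // => wn; rewrite sum_jordan2 ?(dvdn_gt0 n0 wn) //; ring.
Qed.

Lemma dirichlet_unit n : (0 < n)%N ->
  \sum_(m <- divisors n) sigma 1 (n %/ m) * (m == 1)%N%:R = sigma 1 n.
Proof.
move=> n0; have n1 : 1%N \in divisors n by rewrite -dvdn_divisors // dvd1n.
rewrite (bigD1_seq 1%N n1 (divisors_uniq n)) /= divn1 mulr1 big1 ?addr0 // => m /negPf ->.
by rewrite mulr0.
Qed.

Lemma class_weightA n : odd n -> class_weight false n = 9 / 16 * (n%:R - 1) * jordan2 n.
Proof.
move: n; apply: dirichlet_sigma_inj => n n_odd.
have n0 : (0 < n)%N by case: (n) n_odd.
rewrite dirichlet_class_weightA // -dirichlet_id_jordan2 // -dirichlet_jordan2 //.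
by rewrite -sumrB big_distrr /=; apply: eq_bigr => m _; ring.
Qed.

(** The term 2 sigma_1(n) of the relation comes from twice the indicator of n = 1. It compensates (n
    - 3) J_2(n) = -2 at n = 1, which is why this case is exceptional. *)
Lemma class_weightB n : odd n ->
  class_weight true n = 9 / 16 * ((n%:R - 3) * jordan2 n + 2 * (n == 1)%N%:R).
Proof.
move: n; apply: dirichlet_sigma_inj => n n_odd.
have n0 : (0 < n)%N by case: (n) n_odd.
rewrite dirichlet_class_weightB //.
transitivity (9 / 16 * (\sum_(m <- divisors n) sigma 1 (n %/ m) * (m%:R * jordan2 m) -
  3 * (\sum_(m <- divisors n) sigma 1 (n %/ m) * jordan2 m) +
  2 * \sum_(m <- divisors n) sigma 1 (n %/ m) * (m == 1)%N%:R)).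
  by rewrite dirichlet_id_jordan2 // dirichlet_jordan2 // dirichlet_unit //; ring.
rewrite !big_distrr -sumrB -big_split big_distrr /=; apply: eq_bigr => m _; ring.
Qed.

Lemma card_classes_weight n bB : odd n ->
  class_weight bB n = 3 * (n_classes (fun h v : {perm 'I_n} =>
    [&& sts_connected h v, inH2 h v, `[< primitive h v >] & is_type bB h v]))%:R.
Proof.
by move=> n_odd; rewrite /class_weight -!natrM -natrD (card_classes n_odd bB).
Qed.

Local Close Scope ring_scope.

Theorem mainTheorem1 (n : nat) (n_odd : odd n) :
  ((n_prim_typeA n)%:R =
     3%:R / 16%:R * (n%:R - 1) * (n%:R) ^+ 2 * prime_factor_prod n :> rat)%R /\
  ((3 <= n)%N ->
     ((n_prim_typeB n)%:R =
        3%:R / 16%:R * (n%:R - 3%:R) * (n%:R) ^+ 2 * prime_factor_prod n :> rat)%R) /\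
  (n = 1%N -> n_prim_typeB n = 0%N).
Proof.
have WA : (9 / 16 * (n%:R - 1) * jordan2 n = 3 * (n_prim_typeA n)%:R)%R.
  by rewrite -class_weightA //; exact: card_classes_weight false n_odd.
have WB : (9 / 16 * ((n%:R - 3) * jordan2 n + 2 * (n == 1)%N%:R) = 3 * (n_prim_typeB n)%:R)%R.
  by rewrite -class_weightB //; exact: card_classes_weight true n_odd.
move: (n_prim_typeA n) (n_prim_typeB n) WA WB => NA NB; rewrite /jordan2 => WA WB.
split; last split.
- by apply: (mulfI (_ : 3 != 0)%R) => //; rewrite -WA; field.
- move=> n3; apply: (mulfI (_ : 3 != 0)%R) => //; rewrite -WB.
  have -> : (n == 1) = false by lia.
  by rewrite /= mulr0 addr0; field.
move=> n1; move: WB; rewrite n1 /prime_factor_prod /= big_nil => WB.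
apply/eqP; rewrite -(pnatr_eq0 rat); apply/eqP; lra.
Qed.
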